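(* Let $X=X_\Delta$ be a smooth compact toric variety of dimension $n$ associated with a fan $\Delta$ in $N_{\mathbb R}\cong\mathbb R^n$. With the notation $P_\Delta$, $P_\Delta(i)$, $S_k(\Delta)$, $V_I^k(\Delta)$, $V_I^k$ of the context: (1) For all $0\le k\le n$ there is a decomposition $$H^0(X,\wedge^kT_X)=\bigoplus_{I\in S_k(\Delta)}V_I^k(\Delta),$$ where $V_I^k(\Delta)=V_{-I}^k$ for all $I\in S_k(\Delta)$. (2) For all $0\le k\le n$, $$\dim H^0(X,\wedge^kT_X)=\sum_{0\le i\le k}\ \sum_{F_j\in P_\Delta(n-i)}\binom{n-i}{k-i}\cdot\#\big(\mathrm{int}(F_j)\cap M\big).$$
   Context: Torus and lattices: $T=(\mathbb C^* )^n$ is the dense open torus of $X$; $N=\mathrm{Hom}(\mathbb C^*,T)\cong\mathbb Z^n$, $M=\mathrm{Hom}(T,\mathbb C^* )\cong\mathrm{Hom}_{\mathbb Z}(N,\mathbb Z)$; $N_{\mathbb R}=N\otimes\mathbb R$, $N_{\mathbb C}=N\otimes\mathbb C$, $M_{\mathbb R}=M\otimes\mathbb R$. For $m\in M$, $\chi^m$ is the corresponding character of $T$, also viewed as a rational function on $X$. Weight spaces: $T_X$ is the holomorphic tangent bundle and $H^0(X,\wedge^kT_X)$ is the space of holomorphic $k$-vector fields. $T$ acts on it by pushforward $v\mapsto t_*(v)$; for $I\in M$, $V_I^k=\{v\in H^0(X,\wedge^kT_X)\mid t_*(v)=\chi^I(t)v\text{ for all }t\in T\}$. The map $\rho$: $\rho:N_{\mathbb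 C}\cong\mathrm{Lie}(T)\to H^0(X,T_X)$ is the infinitesimal action, determined by $\rho(x)(\chi^m)=\langle x,m\rangle\chi^m$ for $x\in N_{\mathbb C}$, $m\in M$; the induced maps $\wedge^kN_{\mathbb C}\to H^0(X,\wedge^kT_X)$ are also denoted $\rho$. Put $W=\rho(N_{\mathbb C})$, $W^k=\wedge^kW=\rho(\wedge^kN_{\mathbb C})$, $W^0=\mathbb C$. Polytope: $\Delta(1)=\{\alpha_1,\dots,\alpha_r\}$ is the set of one-dimensional cones of $\Delta$, and $e(\alpha_t)\in N$ is the primitive generator of $\alpha_t\cap N$. Let $P_\Delta=\{I\in M_{\mathbb R}\mid\langle I,e(\alpha_t)\rangle\ge-1\text{ for all }\alpha_t\in\Delta(1)\}$ (a compact polytope), $P_\Delta(i)$ the set of its $i$-dimensional faces (so $P_\Delta(n)=\{P_\Delta\}$), $\mathrm{int}(F)$ the relative interior of a face $F$, $S_\Delta=P_\Delta\cap M$, $S(\Delta,i)=\bigcup_{F_j\in P_\Delta(n-i)}(\mathrm{int}(F_j)\cap M)$ for $0\le i\le n$, and $S_k(\Delta)=\bigcup_{0\le i\le k}S(\Delta,i)$. The spaces $V_I^k(\Delta)$: for $I\in S_\Delta$ let $E_I(\Delta)=\{e(\alpha_t)\mid\alpha_t\in\Delta(1),\ \langle I,e(\alpha_t)\rangle=-1\}$ and let $F_I^\perp(\Delta)\subseteq N_{\mathbb R}$ be the real span of $E_I(\Delta)$ ($=0$ if $E_I(\Delta)=\emptyset$). If $I\in S(\Delta,i)$ then $\dim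 F_I^\perp(\Delta)=i$; choose a nonzero $\mathcal E_I(\Delta)\in\wedge^iF_I^\perp(\Delta)\subseteq\wedge^iN_{\mathbb C}$ (unique up to scalar) and put $\mathcal V_I(\Delta)=\rho(\mathcal E_I(\Delta))\in W^i$. Define $W_I^k(\Delta)=\mathbb C\cdot\mathcal V_I(\Delta)\wedge W^{k-i}$ if $0<i\le k$, $W_I^k(\Delta)=W^k$ if $i=0$, and $W_I^k(\Delta)=0$ if $i>k$. Define $V_I^k(\Delta)=\chi^I\cdot W_I^k(\Delta)=\{\chi^I\cdot w\mid w\in W_I^k(\Delta)\}$. Convention: elements of $V_I^k(\Delta)$ are a priori meromorphic $k$-vector fields on $X$, holomorphic on $T$. When such a field extends holomorphically from $T$ to $X$, the same symbol denotes the (unique) extension; equivalently, holomorphic $k$-vector fields on $X$ are identified with their restrictions to the dense open set $T$, and the equalities in the claim are understood under this identification. *)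

(* Defs.v *)
From HB Require Import structures.
From mathcomp Require Import all_boot all_order all_algebra.
From mathcomp Require Import all_classical all_reals all_analysis.
From mathcomp Require Import finmap complex.

Set Implicit Arguments.
Unset Strict Implicit.
Unset Printing Implicit Defensive.

Import Order.TTheory GRing.Theory Num.Theory.
Import numFieldNormedType.Exports.

Local Open Scope classical_set_scope.
Local Open Scope ring_scope.

Section LinearCombinations.
Variables (K : numDomainType) (V : lmodType K).

Definition comb (P : forall m, ('I_m -> K) -> Prop) (A : set V) : set V :=
  [set v | exists m (c : 'I_m -> K) (x : 'I_m -> V),
     [/\ P m c, forall i, A (x i) & v = \sum_i c i *: x i]].

Definition lspan := comb (fun _ _ => True).
Definition cone := comb (fun m c => forall i : 'I_m, 0 <= c i).
Definition aff := comb (fun m c => \sum_(i < m) c i = 1).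

Definition has_dim (H : set V) (d : nat) :=
  exists b : 'I_d -> V,
    (forall v, H v <-> exists c : 'I_d -> K, v = \sum_i c i *: b i) /\
    (forall c : 'I_d -> K, \sum_i c i *: b i = 0 -> forall i, c i = 0).

(* Families indexed by [D] with finitely many nonzero members, the i-th one
   in [F i]. *)
Definition summand_family (T : choiceType) (D : set T) (F : T -> set V)
    (w : T -> V) :=
  (forall i, D i -> F i (w i)) /\ finite_set [set i | D i /\ w i != 0].

Definition is_direct_sum (H : set V) (T : choiceType) (D : set T)
    (F : T -> set V) :=
  (forall v, H v <->
     exists2 w, summand_family D F w & v = \sum_(i \in D) w i) /\
  (forall w w', summand_family D F w -> summand_family D F w' ->
     \sum_(i \in D) w i = \sum_(i \in D) w' i -> forall i, D i -> w i = w' i).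

End LinearCombinations.

(* [u S] is the coefficient of u on e_(s_1) /\ ... /\ e_(s_k), where
   s_1 < ... < s_k are the elements of S. *)
Definition ext (K : fieldType) n := {ffun {set 'I_n} -> K^o}.

Section Exterior.
Variables (K : numFieldType) (n : nat).

Definition inversions (A B : {set 'I_n}) : nat :=
  #|[set p : 'I_n * 'I_n | [&& p.1 \in A, p.2 \in B & (p.2 < p.1)%N]]%SET|.

Definition wedge (u v : ext K n) : ext K n :=
  [ffun S : {set 'I_n} => \sum_(A : {set 'I_n} | A \subset S)
     (-1) ^+ inversions A (S :\: A) * (u A : K) * (v (S :\: A)%SET : K)].

Definition evec (x : 'rV[K]_n) : ext K n :=
  [ffun S => \sum_(i | S == [set i]%SET) x 0 i].

Definition ext1 : ext K n := [ffun S => (S == finset.set0)%:R].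

Definition wedges (s : seq 'rV[K]_n) : ext K n :=
  foldr (fun x u => wedge (evec x) u) ext1 s.

(* The subspace /\^k F of /\ K^n, for F a subspace of K^n. *)
Definition extpow (k : nat) (F : set 'rV[K]_n) : set (ext K n) :=
  lspan [set u | exists2 s : k.-tuple 'rV[K]_n,
                   forall x, x \in (s : seq _) -> F x & u = wedges s].

(* The algebra endomorphism of /\ K^n induced by x |-> x *m A. *)
Definition extmap (A : 'M[K]_n) (u : ext K n) : ext K n :=
  \sum_(S : {set 'I_n}) (u S : K) *: wedges [seq row i A | i <- enum S].

End Exterior.

Definition ext_complex (R : realType) n (u : ext R n) : ext R[i] n :=
  [ffun S => real_complex R (u S)].

(* N = M = Z^n, with the standard pairing. *)

Section Convex.
Variables (R : realType) (n : nat).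
Implicit Types (F P s t : set 'rV[R]_n) (Delta : set (set 'rV[R]_n)).

Definition dot (x y : 'rV[R]_n) : R := \sum_i x 0 i * y 0 i.

Definition toR (m : 'rV[int]_n) : 'rV[R]_n := map_mx intr m.

(* F is a nonempty face of the convex set P.  The linear form u may vanish, so
   P is a face of itself; for a cone, c is necessarily 0. *)
Definition face P F :=
  F !=set0 /\
  exists u c, (forall x, P x -> c <= dot u x) /\
              F = [set x | P x /\ dot u x = c].

Definition affdim F (d : nat) :=
  exists x (A : 'M[R]_(d, n)),
    [/\ row_free A, F x, forall i, F (x + row i A) &
        forall y, F y -> (y - x <= A)%MS].

Definition relint F : set 'rV[R]_n :=
  [set x | F x /\ \forall y \near x, aff F y -> F y].

Definition is_fan Delta :=
  [/\ finite_set Delta,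
      Delta !=set0,
      forall s, Delta s ->
        (exists g : seq 'rV[int]_n, s = cone [set x | x \in map toR g]) /\
        (forall x, s x -> s (- x) -> x = 0),
      forall s t, Delta s -> face s t -> Delta t &
      forall s t, Delta s -> Delta t -> face s (s `&` t) /\ face t (s `&` t)].

(* The cone generated by the rows of A with index in J. *)
Definition row_cone (A : 'M[int]_n) (J : {set 'I_n}) : set 'rV[R]_n :=
  cone [set x | exists2 j, j \in J & x = toR (row j A)].

Definition is_smooth Delta := forall s, Delta s ->
  exists A J, A \in unitmx /\ s = row_cone A J.

Definition rays Delta : set (set 'rV[R]_n) :=
  [set a | Delta a /\ affdim a 1].

(* e generates the monoid of lattice points of a. *)
Definition prim_gen (a : set 'rV[R]_n) (e : 'rV[int]_n) :=
  e != 0 /\ forall v, a (toR v) <-> exists m : nat, v = e *+ m.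

Definition ray_gens Delta : set 'rV[int]_n :=
  [set e | exists2 a, rays Delta a & prim_gen a e].

Definition polytope Delta : set 'rV[R]_n :=
  [set I | forall e, ray_gens Delta e -> -1 <= dot I (toR e)].

Definition faces Delta (d : nat) : set (set 'rV[R]_n) :=
  [set F | face (polytope Delta) F /\ affdim F d].

Definition lattice_pts F : set 'rV[int]_n := [set I | F (toR I)].

Definition card_pts F : nat := #|` fset_set (lattice_pts F)|%fset.

Definition Scodim Delta (i : nat) : set 'rV[int]_n :=
  [set I | (i <= n)%N /\
     exists2 F, faces Delta (n - i) F & lattice_pts (relint F) I].

Definition Sle Delta (k : nat) : set 'rV[int]_n :=
  [set I | exists2 i, (i <= k)%N & Scodim Delta i I].

Definition dual_cone s : set 'rV[int]_n :=
  [set m | forall x, s x -> 0 <= dot (toR m) x].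

Definition perp s : set 'rV[int]_n :=
  [set m | forall x, s x -> dot (toR m) x = 0].

End Convex.

Section ToricVariety.
Variables (R : realType) (n : nat) (Delta : set (set 'rV[R]_n)).
Local Notation C := R[i].

(* The points of U_s are the monoid morphisms s^vee -> C.  For each of them
   there is a unique face t of s such that the morphism is nonzero exactly on
   the elements of t^perp, and it is then determined by t and by its (group
   morphism) restriction to t^perp.  Gluing along the faces, a point of X is a
   pair of a cone t of the fan and of a group morphism t^perp -> C^*, which we
   extend by 0 to the whole of M. *)
Definition is_point (p : set 'rV[R]_n * ('rV[int]_n -> C)) :=
  [/\ Delta p.1,
      p.2 0 = 1,
      forall m m', perp p.1 m -> perp p.1 m' -> p.2 (m + m') = p.2 m * p.2 m' &
      forall m, ~ perp p.1 m -> p.2 m = 0].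

Definition toric := {p | is_point p}.

HB.instance Definition _ := gen_eqMixin toric.
HB.instance Definition _ := gen_choiceMixin toric.

(* For s in the fan, the cones of the fan contained in s are its faces, so that
   this is U_s. *)
Definition affine_open (s : set 'rV[R]_n) : set toric :=
  [set x | (sval x).1 `<=` s].

(* The monoid morphism s^vee -> C given by a point of U_s, extended by 0. *)
Definition restr (s : set 'rV[R]_n) (x : toric) : {ptws 'rV[int]_n -> C^o} :=
  fun m => if `[< dual_cone s m >] then (sval x).2 m else 0.

(* U_s carries the topology of pointwise convergence on s^vee, and a subset of
   X is open if its trace on each U_s is. *)
Definition toric_open (W : set toric) := forall s, Delta s ->
  exists2 O : set {ptws 'rV[int]_n -> C^o}, open O &
    affine_open s `&` W = affine_open s `&` restr s @^-1` O.

Lemma toric_openT : toric_open setT.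
Proof.
by move=> s _; exists setT; [exact: openT | rewrite preimage_setT].
Qed.

Lemma toric_openI (A B : set toric) :
  toric_open A -> toric_open B -> toric_open (A `&` B).
Proof.
move=> oA oB s Ds; have [U oU AU] := oA s Ds; have [V oV BV] := oB s Ds.
exists (U `&` V); first exact: openI.
by rewrite setIIr AU BV preimage_setI [RHS]setIIr.
Qed.

Lemma toric_open_bigU (I : Type) (F : I -> set toric) :
  (forall i, toric_open (F i)) -> toric_open (\bigcup_i F i).
Proof.
move=> oF s Ds.
have /choice [G HG] : forall i, exists O : set {ptws 'rV[int]_n -> C^o},
    open O /\ affine_open s `&` F i = affine_open s `&` restr s @^-1` O.
  by move=> i; have [U ? ?] := oF i s Ds; exists U.
exists (\bigcup_i G i); first by apply: bigcup_open => i _; case: (HG i).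
rewrite preimage_bigcup !setI_bigcupr.
by apply: eq_bigcupr => i _; case: (HG i).
Qed.

HB.instance Definition _ := isOpenTopological.Build toric
  toric_openT toric_openI toric_open_bigU.

End ToricVariety.

Definition in_torus (R : realType) (n : nat) (t : 'rV[R[i]]_n) :=
  [forall j, t 0 j != 0].

Definition torus (R : realType) (n : nat) := {t : 'rV[R[i]]_n | in_torus t}.

Section Torus.
Variables (R : realType) (n : nat).
Local Notation C := R[i].
Local Notation torus := (torus R n).

Lemma tmul_subproof (t s : torus) : in_torus (\row_j (val t 0 j * val s 0 j)).
Proof.
apply/forallP => j; rewrite mxE mulf_neq0 //.
  exact: (forallP (valP t)).
exact: (forallP (valP s)).
Qed.
Definition tmul (t s : torus) : torus :=
  exist (@in_torus R n) _ (tmul_subproof t s).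

Lemma tinv_subproof (t : torus) : in_torus (\row_j (val t 0 j)^-1).
Proof.
by apply/forallP => j; rewrite mxE invr_neq0 //; exact: (forallP (valP t)).
Qed.
Definition tinv (t : torus) : torus :=
  exist (@in_torus R n) _ (tinv_subproof t).

Definition character (m : 'rV[int]_n) (t : torus) : C :=
  \prod_j (val t 0 j) ^ (m 0 j).

(* Multivector fields on T, in the frame d/dt_1, ..., d/dt_n. *)
Definition tfield := torus -> ext C n.

Definition twedge (u v : tfield) : tfield := fun t => wedge (u t) (v t).

Definition torus_push (t : torus) (v : tfield) : tfield :=
  fun s => extmap (diag_mx (val t)) (v (tmul (tinv t) s)).

(* For x in N_C = C^n, rho x = \sum_j x_j t_j d/dt_j, which is the vector field
   sending chi^m to <x, m> chi^m. *)
Definition rho (E : ext C n) : tfield := fun t => extmap (diag_mx (val t)) E.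

Definition Wk (k : nat) : set tfield :=
  [set rho E | E in extpow k [set: 'rV[C]_n]].

End Torus.

Section Fields.
Variables (R : realType) (n : nat) (Delta : set (set 'rV[R]_n)).
Local Notation C := R[i].
Local Notation toric := (toric Delta).
Local Notation torus := (torus R n).
Local Notation tfield := (tfield R n).

(* Let A be an integral basis of N some of whose elements, those with index in
   J, generate a cone s of the fan.  The characters of the dual basis, i.e.,
   the columns of A^-1, are coordinates on U_s, with image C^J * (C^* )^(~ J).
   The chart with A = 1 and J = set0 is the inclusion of T. *)
Definition is_chart (A : 'M[int]_n) (J : {set 'I_n}) :=
  A \in unitmx /\ Delta (row_cone A J).

Definition chart_dom (J : {set 'I_n}) : set 'rV[C]_n :=
  [set z | forall j, j \notin J -> z 0 j != 0].

Definition chart_coord (A : 'M[int]_n) (x : toric) : 'rV[C]_n :=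
  \row_j (sval x).2 (col j (invmx A))^T.

(* The coordinates in the chart (B, K) in terms of those in the chart (A, J);
   on the intersection of the two charts, no coordinate which takes the value
   0 has a negative exponent. *)
Definition transition (A B : 'M[int]_n) (z : 'rV[C]_n) : 'rV[C]_n :=
  \row_k \prod_j (z 0 j) ^ ((A *m invmx B) j k).

(* Complex differentiability at z of the coefficients of f; f is holomorphic on
   an open set if this holds at all its points. *)
Definition holo_at (f : 'rV[C]_n -> ext C n) z := forall S : {set 'I_n},
  differentiable ((fun y => f y S) : 'rV[C]_n -> C^o) z.

(* A holomorphic k-vector field on X, given by its expressions in the charts;
   the values of w A J outside of chart_dom J are irrelevant. *)
Definition is_holo_field (k : nat)
    (w : 'M[int]_n -> {set 'I_n} -> 'rV[C]_n -> ext C n) :=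
  (forall A J, is_chart A J -> forall z, chart_dom J z ->
     extpow k setT (w A J z) /\ holo_at (w A J) z) /\
  (forall A J B K, is_chart A J -> is_chart B K ->
     forall x : toric,
       affine_open (row_cone A J) x -> affine_open (row_cone B K) x ->
     w B K (chart_coord B x) =
       extmap ('J (transition A B) (chart_coord A x)) (w A J (chart_coord A x))).

(* H^0(X, /\^k T_X), its elements being identified with their restrictions to
   T. *)
Definition H0 (k : nat) : set tfield :=
  [set v | exists2 w, is_holo_field k w &
             forall t, v t = w 1%:M finset.set0 (val t)].

Definition weight_space (k : nat) (I : 'rV[int]_n) : set tfield :=
  [set v | H0 k v /\
     forall t : torus, torus_push t v = (fun s => character I t *: v s)].

Definition FIperp (I : 'rV[int]_n) : set 'rV[R]_n :=
  lspan [set x | exists2 e, ray_gens Delta e &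
                   dot (toR R I) (toR R e) = -1 /\ x = toR R e].

(* For I in S(Delta, i), a chosen nonzero element of the line
   /\^i F_I^perp. *)
Definition calE (I : 'rV[int]_n) (i : nat) : ext R n :=
  xget 0 [set E | extpow i (FIperp I) E /\ E != 0].

Definition calV (I : 'rV[int]_n) (i : nat) : tfield :=
  rho (ext_complex (calE I i)).

Definition WI (k : nat) (I : 'rV[int]_n) (i : nat) : set tfield :=
  if i == 0%N then Wk k
  else if (i <= k)%N then
    [set v | exists c : C, exists2 w, Wk (k - i) w &
               v = (fun t => c *: twedge (calV I i) w t)]
  else [set (fun=> 0)].

(* An I in S_Delta belongs to Scodim Delta i for exactly one i. *)
Definition VI (k : nat) (I : 'rV[int]_n) : set tfield :=
  [set v | exists2 i, Scodim Delta i I &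
     exists2 w, WI k I i w & v = (fun t => character I t *: w t)].

End Fields.

(* Main.v *)
Require Import Defs.
From HB Require Import structures.
From mathcomp Require Import all_boot all_order all_algebra.
From mathcomp Require Import complex ring lra zify.
Set Implicit Arguments.
Unset Strict Implicit.
Unset Printing Implicit Defensive.
Import Order.TTheory GRing.Theory Num.Theory.
Local Open Scope ring_scope.

(** A local bound in each of finitely many charts covers X by compactness; read
    on T, it bounds the coefficients of a global field, in the frame of T, by a
    power of 1 + sum_j (|t_j| + |t_j|^-1).  By Liouville's theorem, applied to
    one coordinate after the other, the field is a Laurent polynomial, i.e., a
    finite sum of terms chi^I rho(E_I).  Boundedness along a chart coordinate
    is inherited by each term, since a combination of translates by the torus
    isolates it.  In a chart, the coefficients of chi^I rho(E) are monomials, so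
    that for E <> 0 the term extends to X if and only if, for all ray generators
    e, <I, e> >= -1 and, in case of equality, e /\ E = 0.  For I fixed, these E
    are the multiples of the chosen element of /\^i F_I^perp.

    Following the one-parameter subgroups, compactness also implies that every
    lattice vector lies in a cone of the fan; hence P_Delta has finitely many
    lattice points, each in the relative interior of exactly one face. *)

(** * The exterior algebra *)

Section ExteriorAlgebra.
Variables (K : numFieldType) (n : nat).
Implicit Types (u v w : ext K n) (x y : 'rV[K]_n) (S T A B C : {set 'I_n}).

(** There is no averaging over the compact torus and no power series. Liouville's theorem is stated
    as the vanishing of a divided difference, so that a function of bounded growth satisfies an
    interpolation formula whose nodes, exponents and coefficients depend only on the growth degree.
    It can therefore be applied to one coordinate with the others as parameters: what remains are
    values of the same function at frozen coordinates, and no regularity of Laurent coefficients is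
    at stake. Once the field is a finite sum, its weight components are isolated algebraically.

    Computations on T use the invariant frame t_j d/dt_j, in which a change of charts is a constant
    integer matrix; points of X outside T are reached as limits along a curve lying in T.

    Faces of the polytope are never enumerated: the face of a lattice point I is read off from the
    generators e with <I, e> = -1, and its codimension is their rank. A basis adapted to their span
    turns the conditions e /\ E = 0 into a condition on the support of E, whence the binomial
    coefficients. *)

Definition ebas S : ext K n := [ffun T => (T == S)%:R].

Lemma ext_sumE (I : Type) (r : seq I) (P : pred I) (F : I -> ext K n) S :
  (\sum_(i <- r | P i) F i) S = \sum_(i <- r | P i) F i S.
Proof.
by elim/big_rec2: _ => [|i y1 y2 _ <-]; rewrite !ffunE.
Qed.

Lemma ext_ebas u : u = \sum_S (u S : K) *: ebas S.
Proof.
apply/ffunP => T; rewrite ext_sumE (bigD1 T) //= big1 => [|S neS].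
  by rewrite !ffunE eqxx addr0 /GRing.scale /= mulr1.
by rewrite !ffunE eq_sym (negPf neS) scaler0.
Qed.

Lemma wedgeDl u v w : wedge (u + v) w = wedge u w + wedge v w.
Proof.
apply/ffunP => S; rewrite !ffunE -big_split; apply: eq_bigr => A _ /=.
by rewrite !ffunE; ring.
Qed.

Lemma wedgeDr u v w : wedge w (u + v) = wedge w u + wedge w v.
Proof.
apply/ffunP => S; rewrite !ffunE -big_split; apply: eq_bigr => A _ /=.
by rewrite !ffunE; ring.
Qed.

Lemma wedgeZl (a : K) u w : wedge (a *: u) w = a *: wedge u w.
Proof.
apply/ffunP => S; rewrite !ffunE /GRing.scale /= big_distrr.
by apply: eq_bigr => A _ /=; rewrite !ffunE /GRing.scale /=; ring.
Qed.

Lemma wedgeZr (a : K) u w : wedge w (a *: u) = a *: wedge w u.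
Proof.
apply/ffunP => S; rewrite !ffunE /GRing.scale /= big_distrr.
by apply: eq_bigr => A _ /=; rewrite !ffunE /GRing.scale /=; ring.
Qed.

Lemma wedge0l w : wedge 0 w = 0.
Proof. by rewrite -[X in wedge X _](scale0r (ebas set0)) wedgeZl scale0r. Qed.

Lemma wedge0r w : wedge w 0 = 0.
Proof. by rewrite -[X in wedge _ X](scale0r (ebas set0)) wedgeZr scale0r. Qed.

Lemma wedge_suml (I : Type) (r : seq I) (P : pred I) (F : I -> ext K n) w :
  wedge (\sum_(i <- r | P i) F i) w = \sum_(i <- r | P i) wedge (F i) w.
Proof. exact: (big_morph (fun u => wedge u w) (fun u v => wedgeDl u v w) (wedge0l w)). Qed.

Lemma wedge_sumr (I : Type) (r : seq I) (P : pred I) (F : I -> ext K n) w :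
  wedge w (\sum_(i <- r | P i) F i) = \sum_(i <- r | P i) wedge w (F i).
Proof. exact: (big_morph (wedge w) (fun u v => wedgeDr u v w) (wedge0r w)). Qed.

Lemma wedge_ebas A B : wedge (ebas A) (ebas B) =
  if [disjoint A & B] then (-1) ^+ inversions A B *: ebas (A :|: B) else 0.
Proof.
apply/ffunP => S; rewrite !ffunE.
have [dAB|ndAB] := ifPn; last first.
  rewrite big1 ?ffunE // => A' sA'S; rewrite !ffunE.
  have [->|_] := eqVneq A' A; last by rewrite mulr0 mul0r.
  have [eB|_] := eqVneq (S :\: A) B; last by rewrite mulr0.
  by case/negP: ndAB; rewrite -eB disjoint_sym -setI_eq0 setIDAC setDIl setDv setI0.
rewrite !ffunE; have [->|neS] := eqVneq S (A :|: B).
  rewrite (bigD1 A) ?subsetUl //= big1 => [|A' /andP[_ neA]]; last first.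
    by rewrite !ffunE (negPf neA) mulr0 mul0r.
  have -> : (A :|: B) :\: A = B.
    by rewrite setDUl setDv set0U; apply/setDidPl; rewrite disjoint_sym.
  by rewrite !ffunE !eqxx !mulr1 addr0 /GRing.scale /= mulr1.
rewrite scaler0 big1 // => A' sA'S; rewrite !ffunE.
have [eA|_] := eqVneq A' A; last by rewrite mulr0 mul0r.
have [eB|_] := eqVneq (S :\: A') B; last by rewrite mulr0.
case/eqP: neS; rewrite -eB -eA; apply/setP => i; rewrite !inE.
by case: (boolP (i \in A')) => //= /(subsetP sA'S).
Qed.

Lemma inversionsUl A B C : [disjoint A & B] ->
  inversions (A :|: B) C = (inversions A C + inversions B C)%N.
Proof.
move=> dAB; rewrite /inversions -cardsUI.
rewrite [X in _ = (_ + #|pred_of_set X|)%N](_ : _ = set0) ?cards0 ?addn0.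
  apply: eq_card => p; rewrite !inE.
  by case: (p.1 \in A); case: (p.1 \in B); case: (p.2 \in C); case: (p.2 < p.1)%N.
apply/setP => p; rewrite !inE; have := disjointFr dAB (x := p.1).
by case: (p.1 \in A) => [/(_ isT) ->|]; rewrite ?andbF.
Qed.

Lemma inversionsUr A B C : [disjoint A & B] ->
  inversions C (A :|: B) = (inversions C A + inversions C B)%N.
Proof.
move=> dAB; rewrite /inversions -cardsUI.
rewrite [X in _ = (_ + #|pred_of_set X|)%N](_ : _ = set0) ?cards0 ?addn0.
  apply: eq_card => p; rewrite !inE.
  by case: (p.2 \in A); case: (p.2 \in B); case: (p.1 \in C); case: (p.2 < p.1)%N.
apply/setP => p; rewrite !inE; have := disjointFr dAB (x := p.2).
by case: (p.2 \in A) => [/(_ isT) ->|]; rewrite ?andbF.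
Qed.

Lemma disjointUl A B C :
  [disjoint A :|: B & C] = [disjoint A & C] && [disjoint B & C].
Proof. by rewrite -!setI_eq0 setIUl setU_eq0. Qed.

Lemma disjointUr A B C :
  [disjoint C & A :|: B] = [disjoint C & A] && [disjoint C & B].
Proof. by rewrite -!setI_eq0 setIUr setU_eq0. Qed.

(** For pairwise disjoint sets both signs have exponent inv(A,B) + inv(A,C) + inv(B,C), by
    additivity of [inversions] in each argument. *)
Lemma wedge_ebasA A B C : wedge (wedge (ebas A) (ebas B)) (ebas C) =
  wedge (ebas A) (wedge (ebas B) (ebas C)).
Proof.
rewrite !wedge_ebas.
have [dAB|ndAB] := boolP [disjoint A & B];
    have [dBC|ndBC] := boolP [disjoint B & C]; rewrite ?wedge0l ?wedge0r //.
- rewrite wedgeZl wedgeZr !wedge_ebas disjointUl disjointUr dAB dBC andbT /=.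
  case: ifP => dAC; last by rewrite !scaler0.
  by rewrite !scalerA inversionsUl // inversionsUr // !exprD setUA mulrA mulrC mulrA.
- by rewrite wedgeZl wedge_ebas disjointUl (negPf ndBC) andbF scaler0.
- by rewrite wedgeZr wedge_ebas disjointUr (negPf ndAB) scaler0.
Qed.

Lemma wedgeA u v w : wedge u (wedge v w) = wedge (wedge u v) w.
Proof.
rewrite (ext_ebas u) !wedge_suml; apply: eq_bigr => A _.
rewrite !wedgeZl; congr (_ *: _).
rewrite (ext_ebas v) wedge_sumr !wedge_suml wedge_sumr; apply: eq_bigr => B _.
rewrite wedgeZl !wedgeZr wedgeZl; congr (_ *: _).
rewrite (ext_ebas w) !wedge_sumr; apply: eq_bigr => C _.
by rewrite !wedgeZr wedge_ebasA.
Qed.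

Lemma ext1E : ext1 K n = ebas set0.
Proof. by apply/ffunP => S; rewrite !ffunE. Qed.

Lemma wedge1l u : wedge (ext1 K n) u = u.
Proof.
rewrite [in RHS](ext_ebas u) [in LHS](ext_ebas u) wedge_sumr; apply: eq_bigr => A _.
rewrite wedgeZr ext1E wedge_ebas -setI_eq0 set0I eqxx set0U.
rewrite [inversions _ _](_ : _ = 0%N) ?expr0 ?scale1r //.
by apply: eq_card0 => p; rewrite !inE.
Qed.

Lemma evecE x : evec x = \sum_i x 0 i *: ebas [set i].
Proof.
apply/ffunP => S; rewrite !ffunE ext_sumE [in RHS](bigID (fun i => S == [set i])) /=.
rewrite [X in _ = _ + X]big1 ?addr0 => [|i /negPf eS]; last first.
  by rewrite !ffunE eS scaler0.
by apply: eq_bigr => i eS; rewrite !ffunE eS /GRing.scale /= mulr1.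
Qed.

Lemma evecD x y : evec (x + y) = evec x + evec y.
Proof. by rewrite !evecE -big_split; apply: eq_bigr => i _; rewrite mxE scalerDl. Qed.

Lemma evecZ (a : K) x : evec (a *: x) = a *: evec x.
Proof. by rewrite !evecE scaler_sumr; apply: eq_bigr => i _; rewrite mxE scalerA. Qed.

Lemma evec_delta j : evec (delta_mx 0 j) = ebas [set j].
Proof.
rewrite evecE (bigD1 j) //= big1 => [|i /negPf neij]; rewrite mxE ?eqxx ?neij ?andbF.
  by rewrite scale1r addr0.
by rewrite scale0r.
Qed.

Lemma inversions1 j B : inversions [set j] B = #|[set i in B | (i < j)%N]|.
Proof.
rewrite /inversions -(card_imset (f := fun i : 'I_n => (j, i))); last by move=> ? ? [].
apply: eq_card => -[a b]; rewrite !inE /=.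
apply/and3P/imsetP => [[/eqP -> bB lt]|[c]].
  by exists b; rewrite // inE bB.
by rewrite inE => /andP[cB lt] [-> ->].
Qed.

Lemma wedge_ebas1 j S : wedge (ebas [set j]) (ebas S) =
  if j \in S then 0 else (-1) ^+ #|[set i in S | (i < j)%N]| *: ebas (j |: S).
Proof. by rewrite wedge_ebas disjoints1 inversions1; case: (j \in S). Qed.

Lemma ebas1_anti i j :
  wedge (ebas [set i]) (ebas [set j]) =
  - wedge (ebas [set j]) (ebas [set i]).
Proof.
rewrite !wedge_ebas1 !inE eq_sym.
have [//|neij] := eqVneq i j; first by rewrite oppr0.
have E (a b : 'I_n) :
    #|[set k in [set a] | (k < b)%N]| = (a < b)%N.
  case: ltnP => h.
    rewrite -[RHS]/1%N -(cards1 a); apply: eq_card => k; rewrite !inE.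
    by have [->|] := eqVneq k a; rewrite ?h.
  by apply: eq_card0 => k; rewrite !inE; have [->|] := eqVneq k a; rewrite // ltnNge h.
rewrite !E setUC -scaleNr; congr (_ *: _).
case: (ltngtP i j) => [lt|lt|/val_inj e]; last by rewrite e eqxx in neij.
- by rewrite expr0 expr1 opprK.
- by rewrite expr0 expr1.
Qed.

Lemma evec_anti x y : wedge (evec x) (evec y) = - wedge (evec y) (evec x).
Proof.
rewrite !evecE wedge_suml wedge_sumr -sumrN; apply: eq_bigr => i _.
rewrite wedge_sumr wedge_suml -sumrN; apply: eq_bigr => j _.
by rewrite !(wedgeZl, wedgeZr) ebas1_anti !scalerN !scalerA mulrC.
Qed.

Lemma evec_sq x : wedge (evec x) (evec x) = 0.
Proof.
have := evec_anti x x => /eqP; rewrite -addr_eq0 -mulr2n -scaler_nat scaler_eq0.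
by rewrite pnatr_eq0 /= => /eqP.
Qed.

Lemma wedges_move (s1 s2 : seq 'rV[K]_n) x :
  wedges (s1 ++ x :: s2) = (-1) ^+ size s1 *: wedge (evec x) (wedges (s1 ++ s2)).
Proof.
elim: s1 => [|y s1 IH] /=; first by rewrite expr0 scale1r.
rewrite IH wedgeZr !wedgeA evec_anti -scaleN1r wedgeZl scalerA -exprSr.
by [].
Qed.

Lemma wedges_mem (s : seq 'rV[K]_n) x : x \in s -> wedge (evec x) (wedges s) = 0.
Proof.
case/splitPr => s1 s2; rewrite wedges_move wedgeZr wedgeA evec_sq wedge0l.
by rewrite scaler0.
Qed.

Lemma sorted_enum_set S : sorted ltn [seq val i | i <- enum S].
Proof.
rewrite /enum_mem -enumT /=.
have : subseq [seq val i | i <- [seq x <- enum 'I_n | x \in S]] (iota 0 n).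
  by rewrite -val_enum_ord; apply: map_subseq; exact: filter_subseq.
by move/subseq_sorted; apply; [exact: ltn_trans | exact: iota_ltn_sorted].
Qed.

Lemma mem_filter_enum (p : pred 'I_n) S i :
  (i \in [seq x <- enum S | p x]) = p i && (i \in S).
Proof. by rewrite mem_filter mem_enum. Qed.

Lemma enum_setU1 j S : j \notin S ->
  enum (j |: S) = [seq i : 'I_n <- enum S | (i < j)%N] ++ j :: [seq i : 'I_n <- enum S | (j < i)%N].
Proof.
move=> jS; apply: (inj_map val_inj).
apply: (@irr_sorted_eq _ ltn) => //; first exact: ltn_trans.
- exact: ltnn.
- exact: sorted_enum_set.
- rewrite (sorted_pairwise ltn_trans) map_cat pairwise_cat /=.
  have := sorted_enum_set S; rewrite (sorted_pairwise ltn_trans) !pairwise_map => pS.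
  rewrite !(subseq_pairwise (filter_subseq _ _) pS) /= andbT.
  rewrite all_map allrel_mapl allrel_consr allrel_mapr -andbA; apply/and3P; split.
  - by apply/allP => i; rewrite mem_filter => /andP[].
  - apply/allrelP => a b; rewrite !mem_filter => /andP[lt _] /andP[lt' _].
    exact: ltn_trans lt lt'.
  - by apply/allP => i; rewrite mem_filter => /andP[].
apply: eq_mem_map => i; rewrite mem_enum !inE mem_cat inE !mem_filter_enum.
have [->|ne] := eqVneq i j; first by rewrite orbT.
by case: (ltngtP i j) => [lt|lt|/val_inj e]; rewrite ?orbF //; rewrite e eqxx in ne.
Qed.

Definition rowsw (r : 'I_n -> 'rV[K]_n) S := wedges [seq r i | i <- enum S].

(** The sign rule is that of [wedge_ebas1], for arbitrary vectors in place of the standard basis.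
    This agreement is what makes [extmap] multiplicative. *)
Lemma wedge_rowsw (r : 'I_n -> 'rV[K]_n) j S : wedge (evec (r j)) (rowsw r S) =
  if j \in S then 0
  else (-1) ^+ #|[set i in S | (i < j)%N]| *: rowsw r (j |: S).
Proof.
have [jS|jS] := boolP (j \in S).
  by rewrite wedges_mem // map_f // mem_enum.
rewrite /rowsw enum_setU1 // map_cat map_cons wedges_move size_map.
have -> : size [seq i : 'I_n <- enum S | (i < j)%N] = #|[set i in S | (i < j)%N]|.
  rewrite cardE; apply/perm_size/uniq_perm; [exact/filter_uniq/enum_uniq|exact: enum_uniq|move=> i].
  by rewrite mem_filter !mem_enum inE andbC.
rewrite scalerA -exprD addnn -mul2n exprM sqrrN !expr1n scale1r; congr (wedge _ (wedges _)).
rewrite -map_cat; congr map; apply: (inj_map val_inj).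
apply: (@irr_sorted_eq _ ltn) => //; first exact: ltn_trans.
- exact: ltnn.
- exact: sorted_enum_set.
- rewrite (sorted_pairwise ltn_trans) map_cat pairwise_cat.
  have := sorted_enum_set S; rewrite (sorted_pairwise ltn_trans) !pairwise_map => pS.
  rewrite !(subseq_pairwise (filter_subseq _ _) pS) /= andbT.
  apply/allrelP => _ _ /mapP[i + ->] /mapP[k + ->].
  rewrite !mem_filter => /andP[lt _] /andP[lt' _]; exact: ltn_trans lt lt'.
apply: eq_mem_map => i; rewrite mem_enum mem_cat !mem_filter_enum.
case: (ltngtP i j) => [lt|lt|/val_inj ->]; rewrite ?orbF //=.
exact: negbTE.
Qed.

Lemma rowsw0 r : rowsw r set0 = ext1 K n.
Proof. by rewrite /rowsw enum_set0. Qed.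

(** Inserting an element smaller than all others creates no sign, by [card_below]. *)
Lemma set_ind_min (P : {set 'I_n} -> Prop) : P set0 ->
  (forall j S, j \notin S -> (forall i, i \in S -> (j < i)%N) -> P S -> P (j |: S)) ->
  forall S, P S.
Proof.
move=> P0 PS S; move: {2}#|S| (leqnn #|S|) => m; elim: m S => [|m IH] S.
  by rewrite leqn0 cards_eq0 => /eqP ->.
have [->//|[i0 i0S]] := set_0Vmem S.
have [j jS jmin] := arg_minnP (fun i : 'I_n => i : nat) i0S => le.
rewrite -(setD1K jS); apply: PS => [|i|]; rewrite ?setD11 //.
  rewrite !inE => /andP[ne iS]; rewrite ltn_neqAle jmin // andbT eq_sym.
  by apply: contraNneq ne => /val_inj ->.
by apply: IH; move: le; rewrite (cardsD1 j) (_ : j \in S).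
Qed.

Lemma card_below j S : (forall i, i \in S -> (j < i)%N) ->
  #|[set i in S | (i < j)%N]| = 0%N.
Proof.
move=> H; apply: eq_card0 => i; rewrite !inE; apply/negbTE/negP => /andP[/H].
by rewrite ltnNge => /negP nle lt; apply/nle/ltnW.
Qed.

Lemma rowsw_delta S : rowsw (fun i => delta_mx 0 i) S = ebas S.
Proof.
elim/set_ind_min: S => [|j S jS jmin IH]; first by rewrite rowsw0 ext1E.
have := wedge_rowsw (fun i => delta_mx 0 i) j S.
rewrite IH evec_delta wedge_ebas1 (negPf jS) card_below // expr0 !scale1r.
by move=> <-.
Qed.

Lemma extmapE (M : 'M[K]_n) u : extmap M u = \sum_S (u S : K) *: rowsw (fun i => row i M) S.
Proof. by []. Qed.

Lemma extmap_ebas (M : 'M[K]_n) S : extmap M (ebas S) = rowsw (fun i => row i M) S.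
Proof.
rewrite extmapE (bigD1 S) //= ffunE eqxx scale1r big1 ?addr0 // => T neT.
by rewrite ffunE (negPf neT) scale0r.
Qed.

Lemma extmapD (M : 'M[K]_n) u v : extmap M (u + v) = extmap M u + extmap M v.
Proof. by rewrite !extmapE -big_split; apply: eq_bigr => S _; rewrite ffunE scalerDl. Qed.

Lemma extmapZ (M : 'M[K]_n) (a : K) u : extmap M (a *: u) = a *: extmap M u.
Proof.
by rewrite !extmapE scaler_sumr; apply: eq_bigr => S _; rewrite ffunE scalerA.
Qed.

Lemma extmap0 (M : 'M[K]_n) : extmap M 0 = 0.
Proof. by rewrite -[X in extmap M X](scale0r (0 : ext K n)) extmapZ scale0r. Qed.

Lemma extmap_sum (M : 'M[K]_n) (I : Type) (r : seq I) (P : pred I) (F : I -> ext K n) :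
  extmap M (\sum_(i <- r | P i) F i) = \sum_(i <- r | P i) extmap M (F i).
Proof. exact: (big_morph (extmap M) (extmapD M) (extmap0 M)). Qed.

Lemma extmap_ext1 (M : 'M[K]_n) : extmap M (ext1 K n) = ext1 K n.
Proof. by rewrite ext1E extmap_ebas rowsw0 ext1E. Qed.

Lemma extmap_evecl (M : 'M[K]_n) x u :
  extmap M (wedge (evec x) u) = wedge (evec (x *m M)) (extmap M u).
Proof.
rewrite (ext_ebas u) wedge_sumr !extmap_sum wedge_sumr; apply: eq_bigr => S _.
rewrite !(wedgeZr, extmapZ); congr (_ *: _).
rewrite evecE wedge_suml extmap_sum mulmx_sum_row.
rewrite (big_morph (@evec K n) evecD (_ : _ = 0)); last first.
  by rewrite -(scale0r 0) evecZ scale0r.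
rewrite wedge_suml; apply: eq_bigr => j _.
rewrite evecZ !wedgeZl extmapZ; congr (_ *: _).
rewrite extmap_ebas wedge_rowsw wedge_ebas1; case: ifP => _; first exact: extmap0.
by rewrite extmapZ extmap_ebas.
Qed.

Lemma extmap_wedges (M : 'M[K]_n) (s : seq 'rV[K]_n) :
  extmap M (wedges s) = wedges [seq x *m M | x <- s].
Proof. by elim: s => [|x s IH] /=; rewrite ?extmap_ext1 // extmap_evecl IH. Qed.

Lemma ebas_wedges S : ebas S = wedges [seq delta_mx 0 i | i <- enum S].
Proof. by rewrite -rowsw_delta. Qed.

Lemma extmap_wedge (M : 'M[K]_n) u v :
  extmap M (wedge u v) = wedge (extmap M u) (extmap M v).
Proof.
rewrite (ext_ebas u) wedge_suml !extmap_sum wedge_suml; apply: eq_bigr => S _.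
rewrite !(wedgeZl, extmapZ); congr (_ *: _); rewrite ebas_wedges.
elim: [seq _ | i <- _] => [|x s IH] /=; first by rewrite extmap_ext1 !wedge1l.
by rewrite -wedgeA extmap_evecl IH extmap_evecl wedgeA.
Qed.

Lemma extmapM (M N : 'M[K]_n) u : extmap (M *m N) u = extmap N (extmap M u).
Proof.
rewrite (extmapE M u) extmap_sum extmapE; apply: eq_bigr => S _.
rewrite extmapZ; congr (_ *: _); rewrite /rowsw extmap_wedges -map_comp.
by congr wedges; apply: eq_map => i /=; rewrite row_mul.
Qed.

Lemma extmap1 u : extmap 1%:M u = u.
Proof.
rewrite [RHS]ext_ebas extmapE; apply: eq_bigr => S _; congr (_ *: _).
rewrite ebas_wedges; congr wedges; apply: eq_map => i; exact: row1.
Qed.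

Lemma extmapK (M : 'M[K]_n) : M \in unitmx -> cancel (extmap M) (extmap (invmx M)).
Proof. by move=> uM u; rewrite -extmapM mulmxV // extmap1. Qed.

Lemma extmapVK (M : 'M[K]_n) : M \in unitmx -> cancel (extmap (invmx M)) (extmap M).
Proof. by move=> uM u; rewrite -extmapM mulVmx // extmap1. Qed.

Lemma extmap_diag (d : 'rV[K]_n) u S :
  extmap (diag_mx d) u S = (\prod_(i in S) d 0 i) * (u S : K).
Proof.
have E T : rowsw (fun i => row i (diag_mx d)) T = (\prod_(i in T) d 0 i) *: ebas T.
  elim/set_ind_min: T => [|j T jT jmin IH].
    by rewrite rowsw0 big_set0 scale1r ext1E.
  have := wedge_rowsw (fun i => row i (diag_mx d)) j T.
  rewrite (negPf jT) card_below // expr0 scale1r => <-.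
  rewrite IH big_setU1 //= row_diag_mx evecZ evec_delta wedgeZl wedgeZr.
  by rewrite wedge_ebas1 (negPf jT) card_below // expr0 scale1r scalerA.
rewrite extmapE ext_sumE (bigD1 S) //= E [X in _ + X]big1 ?addr0 => [|T neT].
  by rewrite !ffunE eqxx /GRing.scale /= mulr1 mulrC.
by rewrite E !ffunE eq_sym (negPf neT) !scaler0.
Qed.

(** Membership in [extpow k setT], by [extpowT], in a form that is checked on coefficients. *)
Definition homog (k : nat) u := forall S, u S != 0 -> #|S| = k.

Lemma homogD k u v : homog k u -> homog k v -> homog k (u + v).
Proof.
move=> hu hv S; rewrite ffunE; have [e|/hu //] := eqVneq (u S) 0.
by rewrite e add0r => /hv.
Qed.

Lemma homogZ k (a : K) u : homog k u -> homog k (a *: u).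
Proof. by move=> hu S; rewrite ffunE scaler_eq0 negb_or => /andP[_ /hu]. Qed.

Lemma homog0 k : homog k 0.
Proof. by move=> S; rewrite ffunE eqxx. Qed.

Lemma homog_sum k (I : eqType) (r : seq I) (P : pred I) (F : I -> ext K n) :
  (forall i, i \in r -> P i -> homog k (F i)) -> homog k (\sum_(i <- r | P i) F i).
Proof.
move=> H; rewrite big_seq_cond; apply: big_ind => [|u v|i /andP[]]; [exact: homog0|exact: homogD|exact: H].
Qed.

Lemma homog_ebas S : homog #|S| (ebas S).
Proof. by move=> T; rewrite ffunE; have [->|] := eqVneq T S; rewrite ?eqxx. Qed.

Lemma homog_wedge k l u v : homog k u -> homog l v -> homog (k + l)%N (wedge u v).
Proof.
move=> hu hv; rewrite (ext_ebas u) (ext_ebas v) wedge_suml.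
apply: homog_sum => A _ _; rewrite wedgeZl wedge_sumr.
have [->|/hu eA] := eqVneq (u A) 0; first by rewrite scale0r; exact: homog0.
apply: homogZ; apply: homog_sum => B _ _; rewrite wedgeZr.
have [->|/hv eB] := eqVneq (v B) 0; first by rewrite scale0r; exact: homog0.
apply: homogZ; rewrite wedge_ebas; case: ifP => [dAB|_]; last exact: homog0.
have eU : #|A :|: B| = (#|A| + #|B|)%N by apply/eqP; rewrite (leq_card_setU A B).2.
by rewrite -eA -eB -eU; apply: homogZ; exact: homog_ebas.
Qed.

Lemma homog_evec x : homog 1 (evec x).
Proof.
rewrite evecE; apply: homog_sum => i _ _; apply: homogZ.
by rewrite -(cards1 i); exact: homog_ebas.
Qed.

Lemma homog_wedges (s : seq 'rV[K]_n) : homog (size s) (wedges s).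
Proof.
elim: s => [|x s IH] /=; first by rewrite ext1E -(cards0 'I_n); exact: homog_ebas.
by rewrite -add1n; apply: homog_wedge => //; exact: homog_evec.
Qed.

Lemma homog_extmap k (M : 'M[K]_n) u : homog k u -> homog k (extmap M u).
Proof.
move=> hu; rewrite extmapE; apply: homog_sum => S _ _.
have [->|/hu <-] := eqVneq (u S) 0; first by rewrite scale0r; exact: homog0.
by apply: homogZ; rewrite cardE -(size_map (fun i => row i M)); exact: homog_wedges.
Qed.

(** The basis vectors with j outside S go, up to sign, to distinct basis vectors, and the others go
    to 0. *)
Lemma wedge_delta0 j u :
  wedge (ebas [set j]) u = 0 <-> forall S, u S != 0 -> j \in S.
Proof.
split=> [e0 S|H].
  apply: contraNT => jS; move/ffunP/(_ (j |: S)): e0.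
  rewrite (ext_ebas u) wedge_sumr ext_sumE (bigD1 S) //= big1 ?addr0 => [|T neT].
    rewrite -(ext_ebas u) !wedgeZr wedge_ebas1 (negPf jS) !ffunE eqxx.
    by move/eqP; rewrite !scaler_eq0 signr_eq0 oner_eq0 !orbF.
  rewrite wedgeZr wedge_ebas1; case: ifP => jT; first by rewrite scaler0 ffunE.
  rewrite !ffunE; case: eqVneq => [e|_]; last by rewrite !scaler0.
  case/eqP: neT; apply/setP => i; move/setP/(_ i): e; rewrite !inE.
  by have [->|] := eqVneq i j; rewrite ?jT ?(negPf jS).
rewrite (ext_ebas u) wedge_sumr big1 // => S _; rewrite wedgeZr wedge_ebas1.
by have [->|/H ->] := eqVneq (u S) 0; rewrite ?scale0r ?scaler0.
Qed.

Lemma wedge_row0 (M : 'M[K]_n) j u : M \in unitmx ->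
  wedge (evec (row j M)) u = 0 <->
  forall S, extmap (invmx M) u S != 0 -> j \in S.
Proof.
move=> uM; rewrite -wedge_delta0 -evec_delta -{1}(extmapVK uM u).
rewrite rowE -extmap_evecl; split=> [|->]; last exact: extmap0.
by move/(congr1 (extmap (invmx M))); rewrite extmapK // extmap0.
Qed.

Lemma ebas_factor (Z : {set 'I_n}) u : (forall S, u S != 0 -> Z \subset S) ->
  exists v, u = wedge (ebas Z) v /\ forall k, homog k u -> homog (k - #|Z|)%N v.
Proof.
move=> H.
(* Division by e_Z: removing Z from each S costs the sign of e_Z /\ e_(S \ Z), which squares to
   1. *)
exists (\sum_S ((-1) ^+ inversions Z (S :\: Z) * (u S : K)) *: ebas (S :\: Z)); split.
  rewrite [LHS]ext_ebas wedge_sumr; apply: eq_bigr => S _.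
  have [->|/H ZS] := eqVneq (u S) 0; first by rewrite mulr0 !scale0r wedge0r.
  rewrite wedgeZr wedge_ebas -setI_eq0 setIDA setDIl setDv set0I eqxx.
  rewrite scalerA mulrAC -expr2 sqrr_sign mul1r; congr (_ *: ebas _).
  by apply/setP => i; rewrite !inE; case: (boolP (i \in Z)) => // /(subsetP ZS).
move=> k hu; apply: homog_sum => S _ _.
have [->|nz] := eqVneq (u S) 0; first by rewrite mulr0 scale0r; exact: homog0.
rewrite -(hu _ nz) -(setIidPr (H _ nz)) -cardsD (setIidPr (H _ nz)).
by apply: homogZ; exact: homog_ebas.
Qed.

End ExteriorAlgebra.

From mathcomp Require Import all_classical all_reals all_analysis.
From mathcomp Require Import finmap.
Import numFieldNormedType.Exports.
Local Open Scope classical_set_scope.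
Local Open Scope ring_scope.

(** * Linear spans and exterior powers of subspaces *)

Section LinearSpan.
Variables (K : numDomainType) (V : lmodType K).
Implicit Types A B : set V.

Lemma lspan_sum A (I : Type) (r : seq I) (P : pred I) (c : I -> K) (x : I -> V) :
  (forall i, P i -> A (x i)) -> lspan A (\sum_(i <- r | P i) c i *: x i).
Proof.
move=> Ax; rewrite -big_filter.
have Ax' : forall j, A (x (tnth (in_tuple (seq.filter P r)) j)).
  by move=> j; apply: Ax; move: j; apply/all_tnthP; exact: filter_all.
exists (size (seq.filter P r)), (fun j => c (tnth (in_tuple (seq.filter P r)) j)),
  (fun j => x (tnth (in_tuple (seq.filter P r)) j)); split=> //.
by rewrite (big_tnth _ _ (seq.filter P r)).
Qed.

Lemma lspan_ind A (P : V -> Prop) : P 0 -> (forall u v, P u -> P v -> P (u + v)) ->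
  (forall (c : K) u, P u -> P (c *: u)) -> (forall u, A u -> P u) ->
  forall u, lspan A u -> P u.
Proof.
move=> P0 PD PZ PA _ [m [c [x [_ Ax ->]]]]; apply: big_ind => // i _.
exact/PZ/PA/Ax.
Qed.

Lemma sub_lspan A u : A u -> lspan A u.
Proof.
move=> Au; exists 1%N, (fun=> 1), (fun=> u); split=> //.
by rewrite big_ord1 scale1r.
Qed.

Lemma lspanZ A (c : K) u : lspan A u -> lspan A (c *: u).
Proof.
move=> [m [d [x [_ Ax ->]]]]; rewrite scaler_sumr.
by exists m, (fun i => c * d i), x; split=> //; apply: eq_bigr => i _; rewrite scalerA.
Qed.

End LinearSpan.

Section ExteriorPowers.
Variables (K : numFieldType) (n : nat).
Implicit Types (u v w : ext K n) (x y : 'rV[K]_n) (Z S T : {set 'I_n}).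

Lemma extpowT k u : extpow k setT u <-> homog k u.
Proof.
split.
  apply: (lspan_ind (P := homog k)); [exact: homog0|exact: homogD|exact: homogZ|].
  by move=> _ [s _ ->]; rewrite -{1}(size_tuple s); exact: homog_wedges.
move=> hu; rewrite (ext_ebas u) (bigID (fun S : {set 'I_n} => #|S| == k)) /= addrC big1.
  rewrite add0r; apply: lspan_sum => S /eqP cS.
  have sz : size [seq delta_mx 0 j : 'rV[K]_n | j <- enum S] == k.
    by rewrite size_map -cardE cS.
  by exists (Tuple sz) => //; exact: ebas_wedges.
move=> S; have [->|/hu ->] := eqVneq (u S) 0; first by rewrite scale0r.
by rewrite eqxx.
Qed.

Definition rows_span (M : 'M[K]_n) Z : set 'rV[K]_n :=
  [set x | exists2 y : 'rV[K]_n, x = y *m M & forall j, j \notin Z -> y 0 j = 0].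

(** In the basis of the rows of M, a product of #|Z| vectors supported on Z is homogeneous of degree
    #|Z| with support in subsets of Z, so only Z itself can occur. *)
Lemma extpow_line (M : 'M[K]_n) Z u :
  extpow #|Z| (rows_span M Z) u <-> exists c : K, u = c *: extmap M (ebas K Z).
Proof.
split.
  apply: (lspan_ind (P := fun u => exists c : K, u = c *: extmap M (ebas K Z))).
  - by exists 0; rewrite scale0r.
  - by move=> _ _ [a ->] [b ->]; exists (a + b); rewrite scalerDl.
  - by move=> c _ [a ->]; exists (c * a); rewrite scalerA.
  move=> _ [s sP ->].
  suff [ys [-> sz yP]] : exists ys : seq 'rV[K]_n,
      [/\ (s : seq _) = [seq y *m M | y <- ys], size ys = #|Z| &
         forall S, wedges ys S != 0 -> S \subset Z].
    rewrite -extmap_wedges (ext_ebas (wedges ys)) (bigD1 Z) //= big1 ?addr0.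
      by exists (wedges ys Z); rewrite extmapZ.
    move=> S neS; have [->|nz] := eqVneq (wedges ys S) 0; first by rewrite scale0r.
    case/eqP: neS; apply/eqP; rewrite eqEcard yP //= -sz.
    by rewrite (homog_wedges nz).
  suff H : forall r : seq 'rV[K]_n, (forall x, x \in r -> rows_span M Z x) ->
      exists ys : seq 'rV[K]_n, [/\ r = [seq y *m M | y <- ys], size ys = size r &
         forall S, wedges ys S != 0 -> S \subset Z].
    have [ys [e sz yP]] := H (tval s) sP.
    by exists ys; split=> //; rewrite sz size_tuple.
  elim=> [|x r IH] {}sP.
    exists [::]; split=> // S; rewrite /= ffunE.
    by have [->|] := eqVneq S finset.set0; rewrite ?eqxx // finset.sub0set.
  have [|ys [-> szy yP]] := IH; first by move=> z zr; apply: sP; rewrite inE zr orbT.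
  have [y ey yZ] := sP x (mem_head _ _).
  exists (y :: ys); split => /=; [by rewrite ey|by rewrite szy size_map|].
  move=> S; apply: contraNT => /fintype.subsetPn [j jS jZ].
  rewrite evecE wedge_suml ext_sumE big1 // => i _; rewrite wedgeZl ffunE.
  have [iZ|/yZ ->] := boolP (i \in Z); last by rewrite scale0r.
  rewrite (ext_ebas (wedges ys)) wedge_sumr ext_sumE big1 ?scaler0 // => T _.
  rewrite wedgeZr wedge_ebas1; have [->|nz] := eqVneq (wedges ys T) 0.
    by rewrite scale0r ffunE.
  case: ifP => _; first by rewrite scaler0 ffunE.
  rewrite !ffunE; case: eqVneq => [e|_]; last by rewrite !scaler0.
  move: jS; rewrite e !inE => /orP[/eqP ji|/(fintype.subsetP (yP _ nz))].
    by rewrite ji iZ in jZ.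
  by rewrite (negPf jZ).
move=> [c ->]; apply: lspanZ; apply: sub_lspan.
have sz : size [seq row j M | j <- enum Z] == #|Z| by rewrite size_map -cardE.
exists (Tuple sz); last by rewrite extmap_ebas.
move=> x /mapP [j]; rewrite mem_enum => jZ ->.
exists (delta_mx 0 j); first by rewrite -rowE.
by move=> k kZ; rewrite mxE eqxx /=; case: eqVneq kZ => // ->; rewrite jZ.
Qed.

Lemma ebas_neq0 Z : ebas K Z != 0.
Proof.
apply/eqP => /ffunP/(_ Z); rewrite !ffunE eqxx => /eqP; rewrite oner_eq0 //.
Qed.

Lemma card_supersets Z k : (#|Z| <= k)%N ->
  #|[set S : {set 'I_n} | (Z \subset S) && (#|S| == k)]%SET| =
  'C(n - #|Z|, k - #|Z|).
Proof.
move=> le.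
have <- : #|~: Z| = (n - #|Z|)%N by rewrite cardsCs finset.setCK card_ord.
rewrite -cards_draws -[RHS](card_in_imset (f := fun B : {set 'I_n} => (Z :|: B)%SET)).
  apply: eq_card => S; rewrite !inE; apply/andP/imsetP => [[ZS /eqP cS]|[B + ->]].
    exists (S :\: Z)%SET; last first.
      apply/finset.setP => i; rewrite !inE.
      by case: (boolP (i \in Z)) => // /(fintype.subsetP ZS).
    by rewrite !inE cardsD (finset.setIidPr ZS) cS eqxx andbT finset.setDE finset.subsetIr.
  rewrite !inE => /andP[BZ /eqP cB]; rewrite finset.subsetUl; split=> //.
  rewrite cardsU cB [(Z :&: B)%SET](_ : _ = finset.set0) ?cards0 ?subn0 ?subnKC //.
  by apply/eqP; rewrite finset.setI_eq0 disjoint_sym finset.disjoints_subset.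
move=> B B'; rewrite !inE => /andP[BZ _] /andP[B'Z _] /finset.setP e.
apply/finset.setP => i; have := e i; rewrite !inE.
move/fintype.subsetP/(_ i): BZ; move/fintype.subsetP/(_ i): B'Z; rewrite !inE.
by case: (i \in Z) => //=; case: (i \in B) => [_ /(_ isT)|/[swap] _]; case: (i \in B') => // /(_ isT).
Qed.

End ExteriorPowers.

Section Complexify.
Variables (R : realType) (n : nat).
Local Notation C := R[i].

Lemma ext_complex_wedge (u v : ext R n) :
  ext_complex (wedge u v) = wedge (ext_complex u) (ext_complex v).
Proof.
apply/ffunP => S; rewrite !ffunE rmorph_sum; apply: eq_bigr => A _.
by rewrite !ffunE !rmorphM rmorphXn rmorphN1.
Qed.

Lemma ext_complex_evec (x : 'rV[R]_n) :
  ext_complex (evec x) = evec (map_mx (real_complex R) x).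
Proof.
apply/ffunP => S; rewrite !ffunE rmorph_sum; apply: eq_bigr => A _.
by rewrite mxE.
Qed.

Lemma ext_complex_extmap_ebas (M : 'M[R]_n) Z (c : R) :
  ext_complex (c *: extmap M (ebas R Z)) =
  (c%:C)%C *: extmap (map_mx (real_complex R) M) (ebas C Z).
Proof.
have -> : ext_complex (c *: extmap M (ebas R Z)) =
    (c%:C)%C *: ext_complex (extmap M (ebas R Z)).
  by apply/ffunP => S; rewrite !ffunE rmorphM.
congr (_ *: _); rewrite !extmap_ebas /rowsw; elim: (enum Z) => [|j s IH] /=.
  by apply/ffunP => S; rewrite !ffunE; case: eqP => _; rewrite ?rmorph0 ?rmorph1.
by rewrite ext_complex_wedge IH ext_complex_evec map_row.
Qed.

End Complexify.

(** * Cauchy's theorem on rectangles *)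

Section ComplexModulus.
Variable R : realType.
Local Notation C := R[i].
Implicit Types (z w : C) (x y : R).
Local Notation Re := complex.Re.
Local Notation Im := complex.Im.

(** The norm on C takes its values in C; the estimates below are carried out in R. *)
Definition cabs z : R := Num.sqrt (Re z ^+ 2 + Im z ^+ 2).

Lemma normC_cabs z : `|z| = ((cabs z)%:C)%C.
Proof. exact: normc_def. Qed.

Lemma cabs_ge0 z : 0 <= cabs z. Proof. exact: sqrtr_ge0. Qed.

Lemma cabsM z w : cabs (z * w) = cabs z * cabs w.
Proof. by apply: (@complexI R); rewrite rmorphM /= -!normC_cabs normrM. Qed.

Lemma cabsX z n : cabs (z ^+ n) = cabs z ^+ n.
Proof. by apply: (@complexI R); rewrite rmorphXn /= -!normC_cabs normrX. Qed.

Lemma cabsV z : cabs z^-1 = (cabs z)^-1.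
Proof. by apply: (@complexI R); rewrite fmorphV /= -!normC_cabs normfV. Qed.

Lemma ler_cabsD z w : cabs (z + w) <= cabs z + cabs w.
Proof. by rewrite -lecR rmorphD /= -!normC_cabs ler_normD. Qed.

Lemma cabs0 : cabs 0 = 0.
Proof. by apply: (@complexI R); rewrite -normC_cabs normr0. Qed.

Lemma cabs1 : cabs 1 = 1.
Proof. by apply: (@complexI R); rewrite -normC_cabs normr1. Qed.

Lemma cabsN z : cabs (- z) = cabs z.
Proof. by apply: (@complexI R); rewrite -!normC_cabs normrN. Qed.

Lemma cabs_eq0 z : (cabs z == 0) = (z == 0).
Proof. by rewrite -(normr_eq0 z) normC_cabs (inj_eq (@complexI R)). Qed.

Lemma cabs_gt0 z : (0 < cabs z) = (z != 0).
Proof. by rewrite lt_def cabs_ge0 andbT cabs_eq0. Qed.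

Lemma cabs_real x : cabs (x%:C)%C = `|x|.
Proof. by rewrite /cabs /= expr0n addr0 sqrtr_sqr. Qed.

Lemma cabs_i : cabs 'i%C = 1.
Proof. by rewrite /cabs /= expr0n add0r expr1n sqrtr1. Qed.

Lemma cabs_Re z : `|Re z| <= cabs z.
Proof. by rewrite -sqrtr_sqr ler_sqrt ?lerDl ?sqr_ge0 // addr_ge0 ?sqr_ge0. Qed.

Lemma cabs_Im z : `|Im z| <= cabs z.
Proof. by rewrite -sqrtr_sqr ler_sqrt ?lerDr ?sqr_ge0 // addr_ge0 ?sqr_ge0. Qed.

Lemma cabs_le z : cabs z <= `|Re z| + `|Im z|.
Proof.
rewrite {1}(complexE z); apply: (le_trans (ler_cabsD _ _)).
by rewrite cabsM cabs_i mul1r !cabs_real.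
Qed.

Lemma ler_cabsB z w : cabs z - cabs w <= cabs (z - w).
Proof. by rewrite lerBlDr -{1}(subrK w z) ler_cabsD. Qed.

Lemma cabs_sum (I : Type) (r : seq I) (P : pred I) (F : I -> C) :
  cabs (\sum_(i <- r | P i) F i) <= \sum_(i <- r | P i) cabs (F i).
Proof.
elim/big_rec2: _ => [|i x z _ le]; first by rewrite cabs0.
by apply: (le_trans (ler_cabsD _ _)); rewrite lerD2l.
Qed.

Lemma cabs_prod (I : Type) (r : seq I) (P : pred I) (F : I -> C) :
  cabs (\prod_(i <- r | P i) F i) = \prod_(i <- r | P i) cabs (F i).
Proof. exact: (big_morph cabs cabsM cabs1). Qed.

End ComplexModulus.

(** * Integrals over segments of complex-valued functions *)

Section LineIntegrals.
Variable R : realType.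
Local Notation C := R[i].
Local Notation mu := (@lebesgue_measure R).
Local Notation Re := complex.Re.
Local Notation Im := complex.Im.
Implicit Types (f g : R -> R) (a b c : R).

Definition RI a b f : R := (\int[mu]_(x in `[a, b]) f x)%R.

Lemma RI_integrable a b f : continuous f -> mu.-integrable `[a, b] (EFin \o f).
Proof.
move=> cf; apply: continuous_compact_integrable; first exact: segment_compact.
exact: continuous_subspaceT.
Qed.

Lemma RI_cat a b c f : continuous f -> a <= b -> b <= c ->
  RI a c f = RI a b f + RI b c f.
Proof.
move=> cf ab bc; have := @Rintegral_itvB R f (BLeft a) (BRight c) b.
move=> /(_ (RI_integrable a c cf)); rewrite !bnd_simp => /(_ ab bc) e.
rewrite /RI -(@Rintegral_itv_obnd_cbnd R b (BRight c)) -?e ?subrKC //.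
apply: (@integrableS _ _ _ mu `[a, c]) => //; last exact: RI_integrable.
apply: subset_itv; rewrite bnd_simp //.
Qed.

Lemma RID a b f g : continuous f -> continuous g ->
  RI a b (fun x => f x + g x) = RI a b f + RI a b g.
Proof. by move=> cf cg; rewrite /RI RintegralD //; exact: RI_integrable. Qed.

Lemma RIZ a b c f : continuous f -> RI a b (fun x => c * f x) = c * RI a b f.
Proof. by move=> cf; rewrite /RI RintegralZl //; exact: RI_integrable. Qed.

Lemma RI_cst a b c : a <= b -> RI a b (fun=> c) = c * (b - a).
Proof.
move=> ab; rewrite /RI Rintegral_cst //.
rewrite [X in fine X](_ : _ = (if (a%:E < b%:E)%E then (b%:E - a%:E)%E else 0%E)); last exact: lebesgue_measure_itv.
by rewrite lte_fin; case: ltP => //= ba; rewrite (@le_anti _ _ a b) ?ab // subrr.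
Qed.

Lemma RI_le a b f g : continuous f -> continuous g ->
  (forall x, a <= x <= b -> f x <= g x) -> RI a b f <= RI a b g.
Proof.
move=> cf cg le; apply: le_Rintegral => [|||x /=]; last by rewrite in_itv /= => /le.
- by [].
- exact: RI_integrable.
- exact: RI_integrable.
Qed.

Lemma RI_bound a b M f : a <= b -> continuous f ->
  (forall x, a <= x <= b -> `|f x| <= M) -> `|RI a b f| <= M * (b - a).
Proof.
move=> ab cf H; rewrite ler_norml; apply/andP; split.
  rewrite -mulNr -RI_cst //; apply: RI_le => //; first exact: cst_continuous.
  by move=> x /H; rewrite ler_norml => /andP[].
rewrite -RI_cst //; apply: RI_le => //; first exact: cst_continuous.
by move=> x /H; rewrite ler_norml => /andP[].
Qed.

Implicit Types (F G : R -> C) (k : C).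

Definition ccont F := continuous (fun x => Re (F x)) /\ continuous (fun x => Im (F x)).

Lemma ccontD F G : ccont F -> ccont G -> ccont (fun x => F x + G x).
Proof.
move=> [rF iF] [rG iG]; split=> x.
  rewrite (_ : (fun _ => _) = (fun x => Re (F x) + Re (G x))).
    by apply: cvgD; [exact: rF|exact: rG].
  by apply/funext => y; rewrite raddfD.
rewrite (_ : (fun _ => _) = (fun x => Im (F x) + Im (G x))).
  by apply: cvgD; [exact: iF|exact: iG].
by apply/funext => y; rewrite raddfD.
Qed.

Lemma cReM k (z : C) : Re (k * z) = Re k * Re z + (- Im k) * Im z.
Proof. by case: k z => [a b] [c d] /=; rewrite mulNr. Qed.

Lemma cImM k (z : C) : Im (k * z) = Re k * Im z + Im k * Re z.
Proof. by case: k z => [a b] [c d]. Qed.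

Lemma continuousZ (c : R) f : continuous f -> continuous (fun x => c * f x).
Proof. by move=> cf x; apply: cvgM; [exact: cvg_cst|exact: cf]. Qed.

Lemma ccontZ k F : ccont F -> ccont (fun x => k * F x).
Proof.
move=> [rF iF]; split=> x.
  rewrite (_ : (fun _ => _) = (fun x => Re k * Re (F x) + (- Im k) * Im (F x))).
    by apply: cvgD; exact: continuousZ.
  by apply/funext => y; rewrite cReM.
rewrite (_ : (fun _ => _) = (fun x => Re k * Im (F x) + Im k * Re (F x))).
  by apply: cvgD; exact: continuousZ.
by apply/funext => y; rewrite cImM.
Qed.

Lemma ccont_cst k : ccont (fun=> k).
Proof. by split; exact: cst_continuous. Qed.

Definition J a b F : C := ((RI a b (fun x => Re (F x))) +i* (RI a b (fun x => Im (F x))))%C.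

Lemma JD a b F G : ccont F -> ccont G ->
  J a b (fun x => F x + G x) = J a b F + J a b G.
Proof.
move=> [rF iF] [rG iG]; apply/eqP; rewrite eq_complex /= -!RID //.
by apply/andP; split; apply/eqP; congr RI; apply/funext => x; rewrite raddfD.
Qed.

Lemma JZ a b k F : ccont F -> J a b (fun x => k * F x) = k * J a b F.
Proof.
move=> [rF iF]; rewrite /J; case: k => p q.
apply/eqP; rewrite eq_complex /=; apply/andP; split; apply/eqP.
  rewrite -mulNr -!RIZ // -RID; [|exact: continuousZ..].
  by congr RI; apply/funext => x; rewrite cReM.
rewrite -!RIZ // -RID; [|exact: continuousZ..].
by congr RI; apply/funext => x; rewrite cImM.
Qed.

Lemma J_cat a b c F : ccont F -> a <= b -> b <= c -> J a c F = J a b F + J b c F.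
Proof. by move=> [rF iF] ab bc; rewrite /J !(RI_cat _ ab bc). Qed.

Lemma J_cst a b k : a <= b -> J a b (fun=> k) = k * ((b - a)%:C)%C.
Proof.
move=> ab; rewrite /J !RI_cst //; apply/eqP; rewrite eq_complex; case: k => p q /=.
by apply/andP; split; apply/eqP; ring.
Qed.

(** The real and imaginary parts are bounded separately, hence the factor 2; sharp constants do not
    matter in what follows. *)
Lemma J_bound a b M F : a <= b -> ccont F ->
  (forall x, a <= x <= b -> cabs (F x) <= M) -> cabs (J a b F) <= 2 * M * (b - a).
Proof.
move=> ab [rF iF] H; apply: (le_trans (cabs_le _)); rewrite -mulrA mulr_natl mulr2n.
by apply: lerD; apply: RI_bound => // x /H; apply: le_trans; [exact: cabs_Re|exact: cabs_Im].
Qed.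

End LineIntegrals.

Section Goursat.
Variable R : realType.
Local Notation C := R[i].
Local Notation Re := complex.Re.
Local Notation Im := complex.Im.
Implicit Types (G F : C -> C) (x y : R).

Local Notation pt x y := (x +i* y)%C.

(** The counterclockwise boundary integral: the bottom side minus the top side, plus i times the
    right side minus the left side. *)
Definition rint G x0 x1 y0 y1 : C :=
  J x0 x1 (fun x => G (pt x y0) - G (pt x y1)) +
  'i%C * J y0 y1 (fun y => G (pt x1 y) - G (pt x0 y)).

Definition hcont G y := ccont (fun x => G (pt x y)).
Definition vcont G x := ccont (fun y => G (pt x y)).
Definition bcont G x0 x1 y0 y1 :=
  [/\ hcont G y0, hcont G y1, vcont G x0 & vcont G x1].
Definition sepcont G := (forall y, hcont G y) /\ (forall x, vcont G x).

Lemma sepcont_bcont G x0 x1 y0 y1 : sepcont G -> bcont G x0 x1 y0 y1.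
Proof. by move=> [h v]; split. Qed.

Lemma ccontB (f g : R -> C) : ccont f -> ccont g -> ccont (fun x => f x - g x).
Proof.
move=> cf cg; rewrite (_ : (fun _ => _) = (fun x => f x + (-1) * g x)).
  by apply: ccontD => //; exact: ccontZ.
by apply/funext => x; rewrite mulN1r.
Qed.

Lemma bcontZ k G x0 x1 y0 y1 : bcont G x0 x1 y0 y1 ->
  bcont (fun z => k * G z) x0 x1 y0 y1.
Proof. by move=> [h0 h1 v0 v1]; split; rewrite /hcont /vcont; apply: ccontZ. Qed.

Lemma bcontD F G x0 x1 y0 y1 : bcont F x0 x1 y0 y1 -> bcont G x0 x1 y0 y1 ->
  bcont (fun z => F z + G z) x0 x1 y0 y1.
Proof.
move=> [h0 h1 v0 v1] [h0' h1' v0' v1'].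
by split; rewrite /hcont /vcont; apply: ccontD.
Qed.

Lemma rintD F G x0 x1 y0 y1 : bcont F x0 x1 y0 y1 -> bcont G x0 x1 y0 y1 ->
  rint (fun z => F z + G z) x0 x1 y0 y1 = rint F x0 x1 y0 y1 + rint G x0 x1 y0 y1.
Proof.
move=> [h0 h1 v0 v1] [h0' h1' v0' v1']; rewrite /rint.
rewrite addrACA -mulrDr -!JD; [|exact: ccontB..].
congr (J _ _ _ + 'i%C * J _ _ _); apply/funext => t; ring.
Qed.

Lemma rintZ k G x0 x1 y0 y1 : bcont G x0 x1 y0 y1 ->
  rint (fun z => k * G z) x0 x1 y0 y1 = k * rint G x0 x1 y0 y1.
Proof.
move=> [h0 h1 v0 v1]; rewrite /rint mulrDr mulrCA -(JZ _ _ k (ccontB h0 h1)) -(JZ _ _ k (ccontB v1 v0)).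
congr (J _ _ _ + 'i%C * J _ _ _); apply/funext => t; ring.
Qed.

Lemma rint_catx G x0 x1 x2 y0 y1 : sepcont G -> x0 <= x1 -> x1 <= x2 ->
  rint G x0 x2 y0 y1 = rint G x0 x1 y0 y1 + rint G x1 x2 y0 y1.
Proof.
move=> [hG vG] le1 le2; rewrite /rint addrACA -mulrDr -(J_cat (ccontB (hG y0) (hG y1)) le1 le2).
rewrite -(JD _ _ (ccontB (vG x1) (vG x0)) (ccontB (vG x2) (vG x1))).
by congr (_ + 'i%C * J _ _ _); apply/funext => t; ring.
Qed.

Lemma rint_caty G x0 x1 y0 y1 y2 : sepcont G -> y0 <= y1 -> y1 <= y2 ->
  rint G x0 x1 y0 y2 = rint G x0 x1 y0 y1 + rint G x0 x1 y1 y2.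
Proof.
move=> [hG vG] le1 le2; rewrite /rint addrACA -mulrDr -(J_cat (ccontB (vG x1) (vG x0)) le1 le2).
rewrite -(JD _ _ (ccontB (hG y0) (hG y1)) (ccontB (hG y1) (hG y2))).
by congr (J _ _ _ + _); apply/funext => t; ring.
Qed.

Lemma rint_affine (a b : C) x0 x1 y0 y1 : x0 <= x1 -> y0 <= y1 ->
  rint (fun z => a + b * z) x0 x1 y0 y1 = 0.
Proof.
move=> lex ley; rewrite /rint.
rewrite (_ : (fun x => _ - _) = (fun=> b * 'i%C * ((y0 - y1)%:C)%C)); last first.
  apply/funext => x; case: a b => [a1 a2] [p q]; apply/eqP; rewrite eq_complex /=.
  by apply/andP; split; apply/eqP; ring.
rewrite [X in 'i%C * J _ _ X](_ : _ = (fun=> b * ((x1 - x0)%:C)%C)); last first.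
  apply/funext => x; case: a b => [a1 a2] [p q]; apply/eqP; rewrite eq_complex /=.
  by apply/andP; split; apply/eqP; ring.
rewrite !J_cst //; case: b => p q; apply/eqP; rewrite eq_complex /=.
by apply/andP; split; apply/eqP; ring.
Qed.

Lemma bcont_affine (a b : C) x0 x1 y0 y1 : bcont (fun z => a + b * z) x0 x1 y0 y1.
Proof.
have h c : ccont (fun x => pt x c).
  by split => x /=; [exact: cvg_id|exact: cvg_cst].
have v c : ccont (fun y => pt c y).
  by split => x /=; [exact: cvg_cst|exact: cvg_id].
split; apply: ccontD; first [exact: ccont_cst | exact: ccontZ].
Qed.

Lemma rint_bound G M x0 x1 y0 y1 : bcont G x0 x1 y0 y1 -> x0 <= x1 -> y0 <= y1 ->
  (forall x y, x0 <= x <= x1 -> y0 <= y <= y1 ->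
     (x == x0) || (x == x1) || (y == y0) || (y == y1) -> cabs (G (pt x y)) <= M) ->
  cabs (rint G x0 x1 y0 y1) <= 4 * M * ((x1 - x0) + (y1 - y0)).
Proof.
move=> [h0 h1 v0 v1] lex ley H; apply: (le_trans (ler_cabsD _ _)).
rewrite cabsM cabs_i mul1r mulrDr (_ : 4 * M = 2 * (M + M)); last by ring.
apply: lerD; apply: J_bound => //; try exact: ccontB.
  move=> x xP; apply: (le_trans (ler_cabsD _ _)); rewrite cabsN.
  by apply: lerD; apply: H; rewrite ?eqxx ?orbT ?lexx ?ley.
move=> x xP; apply: (le_trans (ler_cabsD _ _)); rewrite cabsN.
by apply: lerD; apply: H; rewrite ?eqxx ?orbT ?lexx ?lex.
Qed.

(** The derivative with real moduli and without division, so that z = p needs no exception. *)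
Definition cder G p (c : C) := forall e : R, 0 < e -> exists2 d : R, 0 < d &
  forall z, cabs (z - p) < d -> cabs (G z - G p - c * (z - p)) <= e * cabs (z - p).
Definition cdiff G p := exists c, cder G p c.

Lemma rint_halfx G x0 x1 y0 y1 (e : R) : sepcont G -> x0 <= x1 ->
  e <= cabs (rint G x0 x1 y0 y1) ->
  exists a b, [/\ x0 <= a, b <= x1, b - a = (x1 - x0) / 2 & e / 2 <= cabs (rint G a b y0 y1)].
Proof.
move=> sG le01; pose m := (x0 + x1) / 2.
have le0 : x0 <= m by rewrite /m; lra.
have le1 : m <= x1 by rewrite /m; lra.
rewrite (rint_catx y0 y1 sG le0 le1) => le.
have := le_trans le (ler_cabsD _ _).
have [h _|h le'] := leP (e / 2) (cabs (rint G x0 m y0 y1)).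
  by exists x0, m; split=> //; rewrite /m; lra.
by exists m, x1; split=> //; [rewrite /m; lra | lra].
Qed.

Lemma rint_halfy G x0 x1 y0 y1 (e : R) : sepcont G -> y0 <= y1 ->
  e <= cabs (rint G x0 x1 y0 y1) ->
  exists a b, [/\ y0 <= a, b <= y1, b - a = (y1 - y0) / 2 & e / 2 <= cabs (rint G x0 x1 a b)].
Proof.
move=> sG le01; pose m := (y0 + y1) / 2.
have le0 : y0 <= m by rewrite /m; lra.
have le1 : m <= y1 by rewrite /m; lra.
rewrite (rint_caty x0 x1 sG le0 le1) => le.
have := le_trans le (ler_cabsD _ _).
have [h _|h le'] := leP (e / 2) (cabs (rint G x0 x1 y0 m)).
  by exists y0, m; split=> //; rewrite /m; lra.
by exists m, y1; split=> //; [rewrite /m; lra | lra].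
Qed.

Lemma nested_point (a b : nat -> R) :
  (forall n, a n <= a n.+1) -> (forall n, b n.+1 <= b n) -> (forall n, a n <= b n) ->
  exists p, forall n, a n <= p <= b n.
Proof.
move=> ha hb hab.
have ma m n : (m <= n)%N -> a m <= a n.
  by move=> le; rewrite -(subnK le); elim: (n - m)%N => //= k IH; rewrite addSn (le_trans IH).
have mb m n : (m <= n)%N -> b n <= b m.
  by move=> le; rewrite -(subnK le); elim: (n - m)%N => //= k IH; rewrite addSn (le_trans _ IH).
have ub n : ubound (range a) (b n).
  move=> _ [m _ <-]; have [le|lt] := leqP m n.
    exact: (le_trans (ma _ _ le)).
  by apply: (le_trans (hab m)); apply: mb; exact: ltnW.
have ne : range a !=set0 by exists (a 0%N); exists 0%N.
exists (sup (range a)) => n; apply/andP; split.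
  by apply: ub_le_sup; [exists (b 0%N); exact: ub | exists n].
by apply: ge_sup.
Qed.

(** Bisection in both directions keeps a quarter of the integral, while near the limit point G
    differs from an affine function by o(diameter), and the perimeter halves at each stage. *)
Lemma goursat G x0 x1 y0 y1 : sepcont G -> x0 <= x1 -> y0 <= y1 ->
  (forall x y, x0 <= x <= x1 -> y0 <= y <= y1 -> cdiff G (pt x y)) ->
  rint G x0 x1 y0 y1 = 0.
Proof.
move=> sG lex ley dG; apply/eqP; rewrite -cabs_eq0; apply/eqP/le_anti.
rewrite cabs_ge0 andbT leNgt; apply/negP => eta0.
set eta := cabs _ in eta0.
(* A rectangle is coded by ((x0, x1), y0), y1. The ordering assumptions stand inside the existential
   so that [next] is total; ill-ordered rectangles get the value (0, 0, 0, 0). *)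
have /choice [next nextP] : forall q : R * R * R * R, exists q' : R * R * R * R,
    q.1.1.1 <= q.1.1.2 -> q.1.2 <= q.2 ->
    [/\ q.1.1.1 <= q'.1.1.1 /\ q'.1.1.2 <= q.1.1.2, q.1.2 <= q'.1.2 /\ q'.2 <= q.2,
       q'.1.1.2 - q'.1.1.1 = (q.1.1.2 - q.1.1.1) / 2,
       q'.2 - q'.1.2 = (q.2 - q.1.2) / 2 &
       cabs (rint G q.1.1.1 q.1.1.2 q.1.2 q.2) / 4 <=
       cabs (rint G q'.1.1.1 q'.1.1.2 q'.1.2 q'.2)].
  move=> [[[a b] c] d] /=; have [leab|nab] := boolP (a <= b); last by exists (0, 0, 0, 0) => /= ab.
  have [lecd|ncd] := boolP (c <= d); last by exists (0, 0, 0, 0) => /= _ cd.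
  have [a' [b' [? ? ? h]]] := rint_halfx sG leab (lexx (cabs (rint G a b c d))).
  have [c' [d' [? ? ? h']]] := rint_halfy sG lecd h.
  by exists (a', b', c', d') => /= _ _; split=> //; move: h'; lra.
pose q n := iter n next (x0, x1, y0, y1).
pose a n := (q n).1.1.1; pose b n := (q n).1.1.2.
pose c n := (q n).1.2; pose d n := (q n).2.
have qP n : [/\ b n - a n = (x1 - x0) / 2 ^+ n, d n - c n = (y1 - y0) / 2 ^+ n,
    eta / 4 ^+ n <= cabs (rint G (a n) (b n) (c n) (d n)) & a n <= b n /\ c n <= d n].
  elim: n => [|n [e1 e2 e3 [e4 e5]]]; first by rewrite !expr0 !divr1.
  have [_ _ f1 f2 f3] := nextP (q n) e4 e5.
  have g1 : b n.+1 - a n.+1 = (x1 - x0) / 2 ^+ n.+1.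
    by rewrite [LHS]f1 -/(b n) -/(a n) e1 exprSr invfM mulrA.
  have g2 : d n.+1 - c n.+1 = (y1 - y0) / 2 ^+ n.+1.
    by rewrite [LHS]f2 -/(d n) -/(c n) e2 exprSr invfM mulrA.
  split=> //.
    by apply: (le_trans _ f3); rewrite exprSr invfM mulrA ler_pM2r ?invr_gt0 ?ltr0n.
  by rewrite -(subr_ge0 (a _)) -(subr_ge0 (c _)) g1 g2; split;
    rewrite divr_ge0 ?exprn_ge0 ?subr_ge0 // ler0n.
have step n : [/\ a n <= a n.+1, b n.+1 <= b n, c n <= c n.+1 & d n.+1 <= d n].
  by have [_ _ _ [e4 e5]] := qP n; have [[? ?] [? ?] _ _ _] := nextP (q n) e4 e5.
have [px pxP] : exists p, forall n, a n <= p <= b n.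
  by apply: nested_point => n; [case: (step n)|case: (step n)|case: (qP n) => _ _ _ []].
have [py pyP] : exists p, forall n, c n <= p <= d n.
  by apply: nested_point => n; [case: (step n)|case: (step n)|case: (qP n) => _ _ _ []].
have [k kP] := dG px py (pxP 0%N) (pyP 0%N).
pose L := (x1 - x0) + (y1 - y0).
have L0 : 0 <= L by rewrite addr_ge0 ?subr_ge0.
(* This gives 4 e L^2 <= eta / 2; the summand 1 covers the degenerate rectangles, for which L =
   0. *)
pose e := eta / (8 * (L + 1) ^+ 2).
have L10 : 0 < (L + 1) ^+ 2 by rewrite exprn_gt0 // ltr_wpDl.
have e0 : 0 < e by rewrite divr_gt0 // mulr_gt0.
have [dl dl0 dlP] := kP e e0.
have [n nP] : exists n, L / 2 ^+ n < dl.
  have [n nP] : exists n : nat, L / dl < n%:R.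
    exists (Num.truncn (L / dl)).+1; exact: truncnS_gt.
  exists n; rewrite ltr_pdivrMr ?exprn_gt0 // mulrC -ltr_pdivrMr //.
  apply: (lt_le_trans nP); rewrite -natrX ler_nat; exact/ltnW/ltn_expl.
have [e1 e2 e3 [e4 e5]] := qP n.
have bd x y : a n <= x <= b n -> c n <= y <= d n -> cabs (pt x y - pt px py) <= L / 2 ^+ n.
  move=> /andP[h1 h2] /andP[h3 h4]; apply: (le_trans (cabs_le _)); rewrite /L mulrDl -e1 -e2 /=.
  have /andP[? ?] := pxP n; have /andP[? ?] := pyP n.
  by apply: lerD; rewrite ler_norml; lra.
(* Adding an affine function does not change the integral; this one turns G into G z - G p - k (z -
   p), the remainder at the limit point p. *)
pose A z := (k * pt px py - G (pt px py)) + (- k) * z.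
have eR : rint G (a n) (b n) (c n) (d n) = rint (fun z => G z + A z) (a n) (b n) (c n) (d n).
  rewrite rintD ?rint_affine ?addr0 //; [exact: sepcont_bcont|exact: bcont_affine].
move: e3; rewrite eR; apply/negP; rewrite -ltNge.
have le1 : cabs (rint (fun z => G z + A z) (a n) (b n) (c n) (d n)) <=
    4 * (e * (L / 2 ^+ n)) * ((b n - a n) + (d n - c n)).
  apply: rint_bound => //.
    by apply: bcontD; [exact: sepcont_bcont|exact: bcont_affine].
  move=> x y xP yP _.
  have -> : G (pt x y) + A (pt x y) = G (pt x y) - G (pt px py) - k * (pt x y - pt px py).
    by rewrite /A; ring.
  have le := bd _ _ xP yP; apply: (le_trans (dlP _ _)); first exact: le_lt_trans le nP.
  by rewrite ler_pM2l.
apply: (le_lt_trans le1); rewrite e1 e2 -mulrDl -/L.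
have -> : 4 * (e * (L / 2 ^+ n)) * (L / 2 ^+ n) = (4 * e * L ^+ 2) / 4 ^+ n.
  have -> : 4 ^+ n = 2 ^+ n * 2 ^+ n :> R by rewrite -exprMn; congr (_ ^+ _); ring.
  have : 2 ^+ n != 0 :> R by rewrite expf_neq0.
  by move: (2 ^+ n) => t t0; field.
rewrite ltr_pM2r ?invr_gt0 ?exprn_gt0 // /e.
have -> : 4 * (eta / (8 * (L + 1) ^+ 2)) * L ^+ 2 = (eta / 2) * (L ^+ 2 / (L + 1) ^+ 2).
  by field; rewrite lt0r_neq0 // ltr_wpDl.
apply: (@le_lt_trans _ _ (eta / 2 * 1)); last by lra.
rewrite ler_pM2l ?divr_gt0 // ler_pdivrMr // mul1r lerXn2r ?nnegrE //; lra.
Qed.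

(** [goursat] kills the four rectangles around a small square centred at a; on the boundary of the
    square the integral is at most a constant times M and its side. *)
Lemma rint_removable G (a : C) (r M : R) x0 x1 y0 y1 : sepcont G ->
  x0 < Re a < x1 -> y0 < Im a < y1 -> 0 < r ->
  (forall z, cabs (z - a) <= r -> cabs (G z) <= M) ->
  (forall z, z != a -> cdiff G z) -> rint G x0 x1 y0 y1 = 0.
Proof.
move=> sG /andP[ax0 ax1] /andP[ay0 ay1] r0 bG dG.
apply/eqP; rewrite -cabs_eq0; apply/eqP/le_anti; rewrite cabs_ge0 andbT.
apply/ler_addgt0Pl => e e0; rewrite addr0.
have M0 : 0 <= M by apply: le_trans (cabs_ge0 (G a)) (bG a _); rewrite subrr cabs0 ltW.
(* Half the side of the square: it must fit into the rectangle and, since |x - Re a| + |y - Im a| <=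
   2 s, into the disc of radius r; the last bound makes 4 M * 4 s at most e. *)
pose s := Num.min (Num.min (Num.min (Re a - x0) (x1 - Re a)) (Num.min (Im a - y0) (y1 - Im a)))
   (Num.min (r / 2) (e / (16 * (M + 1)))).
have M1 : 0 < 16 * (M + 1) by lra.
have s0 : 0 < s by rewrite /s !lt_min !subr_gt0 ax0 ax1 ay0 ay1 !divr_gt0.
have [s1 s2 s3 s4] : [/\ s <= Re a - x0, s <= x1 - Re a, s <= Im a - y0 & s <= y1 - Im a].
  by rewrite /s !ge_min !lexx !orbT.
have [s5 s6] : s <= r / 2 /\ s <= e / (16 * (M + 1)) by rewrite /s !ge_min !lexx !orbT.
pose xa := Re a - s; pose xb := Re a + s; pose ya := Im a - s; pose yb := Im a + s.
rewrite (@rint_catx G x0 xa x1) ?(@rint_catx G xa xb x1) //; try by rewrite /xa /xb; lra.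
rewrite (@rint_caty G xa xb y0 ya y1) ?(@rint_caty G xa xb ya yb y1) //; try by rewrite /ya /yb; lra.
have nea x y : (x < Re a) || (Re a < x) || (y < Im a) || (Im a < y) -> cdiff G (pt x y).
  move=> H; apply: dG; apply/eqP => ea; move: H; rewrite -ea /= !ltxx //.
rewrite (@goursat G x0 xa) //; try (by rewrite /xa; lra);
  last by move=> x y /andP[_ xP] _; apply: nea; rewrite (le_lt_trans xP) // /xa; lra.
rewrite (@goursat G xb x1) //; try (by rewrite /xb; lra);
  last by move=> x y /andP[xP _] _; apply: nea; rewrite (lt_le_trans _ xP) ?orbT // /xb; lra.
rewrite (@goursat G xa xb y0 ya) //; try (by rewrite /xa /xb /ya; lra);
  last by move=> x y _ /andP[_ xP]; apply: nea; rewrite (le_lt_trans xP) ?orbT // /ya; lra.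
rewrite (@goursat G xa xb yb y1) //; try (by rewrite /xa /xb /yb; lra);
  last by move=> x y _ /andP[xP _]; apply: nea; rewrite (lt_le_trans _ xP) ?orbT // /yb; lra.
rewrite add0r addr0 add0r addr0.
apply: (le_trans (@rint_bound G M _ _ _ _ (sepcont_bcont _ _ _ _ sG) _ _ _)); try by rewrite /xa /xb /ya /yb; lra.
  move=> x y xP yP _; apply: bG; apply: (le_trans (cabs_le _)) => /=.
  rewrite /xa /xb /ya /yb in xP yP.
  have hx : `|x - Re a| <= s by rewrite ler_norml; lra.
  have hy : `|y - Im a| <= s by rewrite ler_norml; lra.
  have -> : Re (pt x y - a) = x - Re a by case: (a).
  have -> : Im (pt x y - a) = y - Im a by case: (a).
  apply: (le_trans (lerD hx hy)); lra.
rewrite (_ : xb - xa + (yb - ya) = 4 * s); last by rewrite /xa /xb /ya /yb; ring.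
apply: (@le_trans _ _ (16 * (M + 1) * s)); last by rewrite mulrC -ler_pdivlMr.
have := ltW s0; nra.
Qed.

End Goursat.

(** * Liouville's theorem and Laurent polynomials *)

Section ComplexDerivative.
Variable R : realType.
Local Notation C := R[i].
Local Notation Re := complex.Re.
Local Notation Im := complex.Im.
Local Notation pt x y := (x +i* y)%C.
Implicit Types (f g : C -> C) (p z : C).

Definition cderivable f p := derivable (f : C^o -> C^o) (p : C^o) (1 : C^o).

Lemma cgt0P (e : C) : 0 < e -> exists2 x : R, 0 < x & e = (x%:C)%C.
Proof.
move=> e0; have er := RRe_real (gtr0_real e0); exists (Re e); last by rewrite er.
by rewrite -ltcR er.
Qed.

(** Connects [cder] with the derivative on the normed space [C^o], from which the product and
    quotient rules are taken. *)
Lemma cderP f p c : cder f p c <->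
  (fun h : C^o => h^-1 *: ((f : C^o -> C^o) (h *: (1 : C^o) + p) - f p)) @ (0 : C^o)^' --> (c : C^o).
Proof.
split=> [cP|].
  apply/cvgrPdist_le => e /cgt0P [x x0 ->].
  have [d d0 dP] := cP x x0.
  have d0' : 0 < (d%:C)%C :> C by rewrite ltcR.
  near=> h.
  have hn0 : h != 0 by near: h; exact: nbhs_dnbhs_neq.
  have hd : `|h| < (d%:C)%C by near: h; exact: dnbhs0_lt.
  have := dP (h + p); rewrite addrK => /(_ _) le.
  rewrite normC_cabs ltcR in hd; have {le} := le hd; rewrite /= -[X in cabs X]opprB cabsN => le.
  rewrite normC_cabs lecR.
  have -> : c - h^-1 *: (f (h *: 1 + p) - f p) = h^-1 * (c * h - (f (h + p) - f p)).
    by rewrite [h *: 1]mulr1 [RHS]mulrBr mulrCA mulVf // mulr1.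
  by rewrite cabsM cabsV mulrC ler_pdivrMr ?cabs_gt0.
move=> /cvgrPdist_le cP x x0.
have x0' : 0 < (x%:C)%C :> C by rewrite ltcR.
have := cP _ x0'; rewrite /dnbhs near_withinE => /nbhs_normP [_ /cgt0P [d d0 ->] dP].
exists d => // z zd; have [->|nz] := eqVneq z p.
  by rewrite !subrr mulr0 subrr cabs0 mulr0.
have := dP (z - p); rewrite /= sub0r normrN normC_cabs ltcR => /(_ zd).
rewrite subr_eq0 => /(_ nz); rewrite normC_cabs lecR.
have -> : c - (z - p)^-1 *: (f ((z - p) *: 1 + p) - f p) = - ((z - p)^-1 * (f z - f p - c * (z - p))).
  rewrite [(z - p) *: 1]mulr1 subrK [in RHS]mulrBr [_ * (c * _)]mulrCA.
  by rewrite mulVf ?subr_eq0 // mulr1 opprB.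
by rewrite cabsN cabsM cabsV mulrC ler_pdivrMr // cabs_gt0 subr_eq0.
Unshelve. all: by end_near.
Qed.

Lemma cder_is_derive f p c : cder f p c <->
  is_derive (p : C^o) (1 : C^o) (f : C^o -> C^o) c.
Proof.
rewrite cderP; split=> [h|[df e]]; last by rewrite -e; exact: df.
by apply: DeriveDef; [apply/cvg_ex; exists c|apply/cvg_lim].
Qed.

Lemma cdiffP f p : cdiff f p <-> cderivable f p.
Proof.
split=> [[c /cderP h]|/cvg_ex [c h]]; first by apply/cvg_ex; exists c.
by exists c; apply/cderP.
Qed.

Lemma cdiff_local f g p (d : R) : 0 < d -> (forall z, cabs (z - p) < d -> f z = g z) ->
  cdiff f p -> cdiff g p.
Proof.
move=> d0 fg [c cP]; exists c => e e0; have [d' d'0 dP] := cP e e0.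
exists (Num.min d d') => [|z]; first by rewrite lt_min d0 d'0.
rewrite lt_min => /andP[zd zd']; rewrite -!fg ?subrr ?cabs0 //; exact: dP.
Qed.

Lemma cdiffM f g p : cdiff f p -> cdiff g p -> cdiff (fun z => f z * g z) p.
Proof.
move=> /cdiffP df /cdiffP dg; apply/cdiffP.
exact: (derivableM (f := f : C^o -> C^o) (g := g : C^o -> C^o) df dg).
Qed.

Lemma cdiffD f g p : cdiff f p -> cdiff g p -> cdiff (fun z => f z + g z) p.
Proof.
move=> /cdiffP df /cdiffP dg; apply/cdiffP.
exact: (derivableD (f := f : C^o -> C^o) (g := g : C^o -> C^o) df dg).
Qed.

Lemma cdiffV f p : f p != 0 -> cdiff f p -> cdiff (fun z => (f z)^-1) p.
Proof.
move=> nz /cdiffP df; apply/cdiffP.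
exact: (derivableV (f := f : C^o -> C^o) nz df).
Qed.

Lemma cdiff_cst c p : cdiff (fun=> c) p.
Proof. by exists 0 => e e0; exists 1 => // z _; rewrite mul0r !subrr cabs0 mulr_ge0 ?cabs_ge0 // ltW. Qed.

Lemma cdiff_id p : cdiff id p.
Proof. by exists 1 => e e0; exists 1 => // z _; rewrite mul1r !subrr cabs0 mulr_ge0 ?cabs_ge0 // ltW. Qed.

Lemma cdiffX f n p : cdiff f p -> cdiff (fun z => f z ^+ n) p.
Proof.
move=> df; elim: n => [|n IH].
  by rewrite (_ : (fun _ => _) = (fun=> 1)); [exact: cdiff_cst|apply/funext => z].
rewrite (_ : (fun _ => _) = (fun z => f z * f z ^+ n)); first exact: cdiffM.
by apply/funext => z; rewrite exprS.
Qed.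

Lemma cdiff_sum (I : Type) (r : seq I) (P : pred I) (F : I -> C -> C) p :
  (forall i, P i -> cdiff (F i) p) -> cdiff (fun z => \sum_(i <- r | P i) F i z) p.
Proof.
move=> dF; elim: r => [|i r IH].
  by rewrite (_ : (fun _ => _) = (fun=> 0)); [exact: cdiff_cst|apply/funext => z; rewrite big_nil].
have [Pi|Pi] := boolP (P i); last first.
  by rewrite (_ : (fun _ => _) = (fun z => \sum_(i <- r | P i) F i z)) //; apply/funext => z;
    rewrite big_cons (negPf Pi).
rewrite (_ : (fun _ => _) = (fun z => F i z + \sum_(i <- r | P i) F i z)).
  by apply: cdiffD => //; exact: dF.
by apply/funext => z; rewrite big_cons Pi.
Qed.

Lemma cdiff_horner (q : {poly C}) p : cdiff (fun z => q.[z]) p.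
Proof.
rewrite (_ : (fun _ => _) = (fun z => \sum_(i < size q) q`_i * z ^+ i)).
  by apply: cdiff_sum => i _; apply: cdiffM; [exact: cdiff_cst|apply: cdiffX; exact: cdiff_id].
by apply/funext => z; rewrite horner_coef.
Qed.

Definition econt f p := forall e : R, 0 < e -> exists2 d : R, 0 < d &
  forall z, cabs (z - p) < d -> cabs (f z - f p) <= e.

Lemma cdiff_econt f p : cdiff f p -> econt f p.
Proof.
move=> [c cP] e e0; have [d d0 dP] := cP 1 ltr01.
have k0 : 0 < cabs c + 1 by rewrite ltr_wpDl ?cabs_ge0.
exists (Num.min d (e / (cabs c + 1))) => [|z]; first by rewrite lt_min d0 divr_gt0.
rewrite lt_min => /andP[/dP le1]; rewrite ltr_pdivlMr // => le2.
have -> : f z - f p = (f z - f p - c * (z - p)) + c * (z - p) by ring.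
apply: (le_trans (ler_cabsD _ _)); rewrite cabsM.
move: le1 le2; have := cabs_ge0 (z - p); nra.
Qed.

Lemma econt_sepcont f : (forall p, econt f p) -> sepcont f.
Proof.
have cE (g : R -> R) : (forall x e, 0 < e -> exists2 d : R, 0 < d &
    forall y, `|y - x| < d -> `|g y - g x| <= e) -> continuous g.
  move=> H x; apply/cvgrPdist_le => e e0; have [d d0 dP] := H x e e0.
  near=> y; rewrite distrC; apply: dP; rewrite distrC; near: y.
  exact: cvgr_dist_lt.
move=> cf; split=> c; split; apply: cE => x e e0.
- have [d d0 dP] := cf (pt x c) e e0; exists d => // y yd.
  rewrite -raddfB; apply: (le_trans (cabs_Re _)); apply: dP.
  have -> : pt y c - pt x c = ((y - x)%:C)%C by apply/eqP; rewrite eq_complex /= subrr !eqxx.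
  by rewrite cabs_real.
- have [d d0 dP] := cf (pt x c) e e0; exists d => // y yd.
  rewrite -raddfB; apply: (le_trans (cabs_Im _)); apply: dP.
  have -> : pt y c - pt x c = ((y - x)%:C)%C by apply/eqP; rewrite eq_complex /= subrr !eqxx.
  by rewrite cabs_real.
- have [d d0 dP] := cf (pt c x) e e0; exists d => // y yd.
  rewrite -raddfB; apply: (le_trans (cabs_Re _)); apply: dP.
  have -> : pt c y - pt c x = 'i%C * ((y - x)%:C)%C.
    by apply/eqP; rewrite eq_complex /=; apply/andP; split; apply/eqP; ring.
  by rewrite cabsM cabs_i mul1r cabs_real.
- have [d d0 dP] := cf (pt c x) e e0; exists d => // y yd.
  rewrite -raddfB; apply: (le_trans (cabs_Im _)); apply: dP.
  have -> : pt c y - pt c x = 'i%C * ((y - x)%:C)%C.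
    by apply/eqP; rewrite eq_complex /=; apply/andP; split; apply/eqP; ring.
  by rewrite cabsM cabs_i mul1r cabs_real.
Unshelve. all: by end_near.
Qed.

Definition slope f (a k : C) z := if z == a then k else (f z - f a) / (z - a).

Lemma slope_econt f a : (forall p, cdiff f p) -> exists k, forall p, econt (slope f a k) p /\
  (p != a -> cdiff (slope f a k) p).
Proof.
move=> df; have [k kP] := df a; exists k => p.
have [->|nep] := eqVneq p a.
  split=> // e e0; have [d d0 dP] := kP e e0; exists d => // z zd.
  rewrite /slope eqxx; case: eqVneq => [_|nez]; first by rewrite subrr cabs0 ltW.
  have -> : (f z - f a) / (z - a) - k = (f z - f a - k * (z - a)) / (z - a).
    by field; rewrite subr_eq0.
  by rewrite cabsM cabsV ler_pdivrMr ?cabs_gt0 ?subr_eq0 //; exact: dP.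
have ds : cdiff (slope f a k) p.
  apply: (@cdiff_local (fun z => (f z - f a) / (z - a)) _ _ (cabs (p - a))).
  - by rewrite cabs_gt0 subr_eq0.
  - move=> z; rewrite /slope; case: eqVneq => // ->.
    by rewrite -opprB cabsN ltxx.
  apply: cdiffM; first by apply: cdiffD => //; exact: cdiff_cst.
  apply: cdiffV; first by rewrite subr_eq0.
  by apply: cdiffD; [exact: cdiff_id|exact: cdiff_cst].
by split=> //; exact: cdiff_econt.
Qed.

(** With the derivative as its value at a, the difference quotient is continuous everywhere, hence
    bounded near a, and differentiable elsewhere: [rint_removable] applies. *)
Lemma rint_slope f a : (forall p, cdiff f p) -> exists k, sepcont (slope f a k) /\
  forall x0 x1 y0 y1, x0 < Re a < x1 -> y0 < Im a < y1 -> rint (slope f a k) x0 x1 y0 y1 = 0.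
Proof.
move=> /(slope_econt a) [k kP]; exists k.
have sc : sepcont (slope f a k) by apply: econt_sepcont => p; case: (kP p).
split=> // x0 x1 y0 y1 xa ya.
have [d d0 dP] := (kP a).1 1 ltr01.
apply: (@rint_removable _ _ a (d / 2) (cabs (slope f a k a) + 1)) => //; first by rewrite divr_gt0.
  move=> z zd; rewrite -lerBlDl; apply: (le_trans (ler_cabsB _ _)).
  by apply: dP; apply: (le_lt_trans zd); lra.
by move=> z; case: (kP z).
Qed.

Lemma invc_pt (x y : R) : x ^+ 2 + y ^+ 2 != 0 ->
  (pt x y)^-1 = pt (x / (x ^+ 2 + y ^+ 2)) (- y / (x ^+ 2 + y ^+ 2)).
Proof.
move=> nz; have nz' : pt x y != 0.
  apply: contraNneq nz => /eqP; rewrite eq_complex /= => /andP[/eqP -> /eqP ->].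
  by rewrite expr0n addr0.
apply: (mulfI nz'); rewrite divff //; apply/eqP; rewrite eq_complex /=.
by apply/andP; split; apply/eqP; field.
Qed.

Lemma sqr_sum_gt0 (x y : R) : y != 0 -> 0 < x ^+ 2 + y ^+ 2.
Proof. by move=> ny; rewrite ltr_wpDl ?sqr_ge0 // exprn_even_gt0. Qed.

Lemma continuous_sqr_sum_inv (c : R) : c != 0 -> continuous (fun x : R => (x ^+ 2 + c ^+ 2)^-1).
Proof.
move=> nc x; apply: cvgV; first by rewrite gt_eqF ?sqr_sum_gt0.
apply: cvgD; last exact: cvg_cst.
by rewrite (_ : (fun _ => _) = (fun x : R => x * x)) //; apply: cvgM; exact: cvg_id.
Qed.

Lemma bcont_inv (r : R) : 0 < r -> bcont (fun z => z^-1) (- r) r (- r) r.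
Proof.
move=> r0; have h (c : R) : c != 0 -> ccont (fun x => (pt x c)^-1).
  move=> nc; rewrite (_ : (fun _ => _) =
      (fun x => pt (x * (x ^+ 2 + c ^+ 2)^-1) (- c * (x ^+ 2 + c ^+ 2)^-1))); last first.
    by apply/funext => x; rewrite invc_pt // gt_eqF ?sqr_sum_gt0.
  split=> x /=; apply: cvgM; first [exact: cvg_id|exact: cvg_cst|exact: continuous_sqr_sum_inv].
have v (c : R) : c != 0 -> ccont (fun y => (pt c y)^-1).
  move=> nc; rewrite (_ : (fun _ => _) =
      (fun y => pt (c * (y ^+ 2 + c ^+ 2)^-1) (- y * (y ^+ 2 + c ^+ 2)^-1))); last first.
    by apply/funext => x; rewrite invc_pt addrC // gt_eqF ?sqr_sum_gt0.
  split=> x /=; apply: cvgM; first [exact: cvg_cst|exact: continuous_sqr_sum_inv|idtac].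
  apply: cvgN; exact: cvg_id.
by split; [apply: h|apply: h|apply: v|apply: v]; rewrite ?oppr_eq0 gt_eqF.
Qed.

(* On each of the four sides the integrand has imaginary part at least [1 / (2 r)]. *)
Lemma rint_inv_ge (r : R) : 0 < r -> 4 <= cabs (rint (fun z => z^-1) (- r) r (- r) r).
Proof.
move=> r0; apply: le_trans (le_trans (ler_norm _) (cabs_Im _)).
have nr : r != 0 by rewrite gt_eqF.
have lb (f : R -> R) : f = (fun x => 2 * r * (x ^+ 2 + r ^+ 2)^-1) -> 2 <= RI (- r) r f.
  move=> ->; apply: (@le_trans _ _ (RI (- r) r (fun=> r^-1))).
    rewrite RI_cst; last by lra.
    by rewrite (_ : r^-1 * (r - - r) = 2) //; field.
  apply: RI_le; first exact: cst_continuous.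
    by move=> x; apply: cvgM; [exact: cvg_cst|exact: continuous_sqr_sum_inv].
  move=> x /andP[xa xb]; rewrite ler_pdivlMr ?sqr_sum_gt0 // ler_pdivrMl //.
  have : 0 <= (r - x) * (x + r) by rewrite mulr_ge0 //; lra.
  nra.
have -> : (4 : R) = 2 + 2 by ring.
have ImD (u v : C) : Im (u + 'i%C * v) = Im u + Re v.
  by case: u v => [a b] [a' b'] /=; ring.
rewrite /rint ImD; apply: lerD; apply: lb; apply/funext => x.
  rewrite !invc_pt ?gt_eqF ?sqr_sum_gt0 ?oppr_eq0 //= sqrrN opprK; field.
  by rewrite gt_eqF ?sqr_sum_gt0.
rewrite !invc_pt /= ?sqrrN 1?[r ^+ 2 + _]addrC ?gt_eqF ?sqr_sum_gt0 ?oppr_eq0 //=; field.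
by rewrite gt_eqF ?sqr_sum_gt0.
Qed.

Lemma bcont_sum (I : Type) (r : seq I) (F : I -> C -> C) x0 x1 y0 y1 :
  (forall i, sepcont (F i)) ->
  bcont (fun z => \sum_(i <- r) F i z) x0 x1 y0 y1 /\
  rint (fun z => \sum_(i <- r) F i z) x0 x1 y0 y1 = \sum_(i <- r) rint (F i) x0 x1 y0 y1.
Proof.
move=> cF; elim: r => [|i r [IH1 IH2]].
  rewrite big_nil (_ : (fun _ => _) = (fun z => 0 * 0)); last first.
    by apply/funext => z; rewrite big_nil mulr0.
  have b0 : bcont (fun _ : C => 0 : C) x0 x1 y0 y1 by split; exact: ccont_cst.
  by split; [exact: bcontZ|rewrite (rintZ 0 b0) mul0r].
rewrite big_cons -IH2 (_ : (fun _ => _) = (fun z => F i z + \sum_(i <- r) F i z)); last first.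
  by apply/funext => z; rewrite big_cons.
have bi := sepcont_bcont x0 x1 y0 y1 (cF i).
by split; [exact: bcontD|exact: rintD].
Qed.

Lemma partial_fractions (m : nat) (a : 'I_m.+1 -> C) (z : C) : injective a ->
  (forall i, z != a i) ->
  \sum_i (\prod_(j | j != i) (a i - a j))^-1 / (z - a i) = (\prod_i (z - a i))^-1.
Proof.
move=> ia nz.
pose q i : {poly C} := \prod_(j | j != i) ('X - (a j)%:P).
have sq i : (size (q i) <= m.+1)%N.
  rewrite /q -big_filter size_prod_XsubC ltnS -ltnS.
  rewrite [X in (X < _)%N](_ : _ = #|predC1 i|); last by rewrite -sum1_size big_filter sum1_card.
  by rewrite cardC1 card_ord.
have qE i : (q i).[a i] != 0.
  rewrite horner_prod; apply/prodf_neq0 => j nji; rewrite hornerXsubC subr_eq0.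
  by rewrite (inj_eq ia) eq_sym.
have cE i : \prod_(j | j != i) (a i - a j) = (q i).[a i].
  by rewrite horner_prod; apply: eq_bigr => j _; rewrite hornerXsubC.
(* The Lagrange interpolation of the constant 1, minus 1: it has degree at most m and the m + 1
   roots a_i. Evaluating it at z and dividing by prod (z - a_i) gives the claim. *)
pose p : {poly C} := \sum_i (q i).[a i]^-1 *: q i - 1.
have p0 : p = 0.
  apply: (@roots_geq_poly_eq0 _ _ [seq a i | i <- enum 'I_m.+1]).
  - apply/allP => _ /mapP[k _ ->]; rewrite /root hornerD hornerN hornerC horner_sum.
    rewrite (bigD1 k) //= hornerZ mulVf // big1 ?addr0 ?subrr // => j njk.
    rewrite hornerZ [X in _ * X](_ : _ = 0) ?mulr0 // /q horner_prod.
    by rewrite (bigD1 k) ?(eq_sym k) //= hornerXsubC subrr mul0r.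
  - by rewrite map_inj_uniq // enum_uniq.
  - rewrite size_map size_enum_ord; apply: (leq_trans (size_polyD _ _)).
    rewrite geq_max size_polyN size_polyC oner_eq0 andbT.
    apply: (leq_trans (size_sum _ _ _)); apply/bigmax_leqP => i _.
    exact: (leq_trans (size_scale_leq _ _)).
have : p.[z] = 0 by rewrite p0 horner0.
rewrite hornerD hornerN hornerC horner_sum => /eqP; rewrite subr_eq0 => /eqP e.
have nzp : \prod_i (z - a i) != 0.
  by apply/prodf_neq0 => i _; rewrite subr_eq0.
apply: (mulfI nzp); rewrite divff // -[RHS]e big_distrr; apply: eq_bigr => i _ /=.
have nzi : z - a i != 0 by rewrite subr_eq0.
have -> : ((q i).[a i]^-1 *: q i).[z] = (q i).[a i]^-1 * \prod_(j | j != i) (z - a j).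
  by rewrite hornerZ [(q i).[z]]horner_prod; congr (_ * _); apply: eq_bigr => j _; rewrite hornerXsubC.
rewrite cE (bigD1 i) //=; move: (\prod_(_ | _) _) => P.
by field; rewrite nzi qE.
Qed.

(* The boundary integral over a square of side 2r of
   sum_i c_i (f z - f (a i)) / (z - a i) vanishes; there this sum is
   O(r^-2) - S / z, where S is the divided difference. *)
Lemma liouville_divided_difference (f : C -> C) (M : R) (m : nat) (a : 'I_m.+2 -> C) :
  (forall p, cdiff f p) -> (forall z, cabs (f z) <= M * (1 + cabs z) ^+ m) ->
  injective a ->
  \sum_i (\prod_(j | j != i) (a i - a j))^-1 * f (a i) = 0.
Proof.
move=> df bf ia; set S := \sum_i _.
pose c i := (\prod_(j | j != i) (a i - a j))^-1.
have /choice [k kP] := fun i => rint_slope (a i) df.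
pose A := 1 + \sum_i cabs (a i).
have A1 : 1 <= A by rewrite lerDl sumr_ge0 // => i _; exact: cabs_ge0.
have leA i : cabs (a i) <= A.
  rewrite /A (bigD1 i) //=; have : 0 <= \sum_(j | j != i) cabs (a j).
    by rewrite sumr_ge0 // => j _; exact: cabs_ge0.
  by have := cabs_ge0 (a i); lra.
have M0 : 0 <= M.
  by have := le_trans (cabs_ge0 _) (bf 0); rewrite cabs0 addr0 expr1n mulr1.
pose B := \sum_i cabs (c i * f (a i)) * A.
have B0 : 0 <= B by rewrite sumr_ge0 // => i _; rewrite mulr_ge0 ?cabs_ge0 // (le_trans ler01).
(* On the square 1 + |z| <= 2 |z| and |z - a_i| >= |z| / 2. The first summand bounds |z|^2 |f z /
   prod (z - a_i)|; the second bounds |z|^2 times the sum of the terms c_i f(a_i) a_i / (z (z -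
   a_i)). *)
pose K := M * 2 ^+ m * 2 ^+ m.+2 + 2 * B.
have K0 : 0 <= K by rewrite /K addr_ge0 // mulr_ge0 ?exprn_ge0 // mulr_ge0 ?exprn_ge0.
pose H z := \sum_i c i * slope f (a i) (k i) z.
have sl i : sepcont (fun z => c i * slope f (a i) (k i) z).
  have [[h v] _] := kP i; split => t; [apply: ccontZ; exact: h|apply: ccontZ; exact: v].
have key r : 2 * A < r -> cabs S * r <= 4 * K.
  move=> ltr; have r0 : 0 < r by lra.
  have [bH eH] := bcont_sum (index_enum 'I_m.+2) (- r) r (- r) r sl.
  have H0 : rint H (- r) r (- r) r = 0.
    rewrite [LHS]eH big1 // => i _; have [sc rc] := kP i.
    rewrite (rintZ _ (sepcont_bcont _ _ _ _ sc)) rc ?mulr0 //.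
      by have := leA i; have := cabs_Re (a i); rewrite ler_norml => /andP[] *; apply/andP; split; lra.
    by have := leA i; have := cabs_Im (a i); rewrite ler_norml => /andP[] *; apply/andP; split; lra.
  have bI := bcont_inv r0.
  have eT : rint (fun z => H z + S * z^-1) (- r) r (- r) r = S * rint (fun z => z^-1) (- r) r (- r) r.
    by rewrite rintD ?H0 ?add0r ?rintZ //; exact: bcontZ.
  have bT : cabs (rint (fun z => H z + S * z^-1) (- r) r (- r) r) <=
      4 * (K / r ^+ 2) * ((r - - r) + (r - - r)).
    apply: rint_bound; try lra; first by apply: bcontD => //; exact: bcontZ.
    move=> x y xP yP bd; set z := pt x y.
    have zr : r <= cabs z.
      have [h1 h2] := (cabs_Re z, cabs_Im z).
      case/orP: bd => [/orP[/orP[]|]|] /eqP e; rewrite /z /= e ?normrN in h1 h2 *;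
        rewrite (gtr0_norm r0) in h1 h2; by [exact: h1|exact: h2].
    have z0 : z != 0 by rewrite -cabs_gt0; lra.
    have dz i : cabs z / 2 <= cabs (z - a i).
      by apply: le_trans (ler_cabsB _ _); have := leA i; lra.
    have dz0 i : z != a i.
      by rewrite -subr_eq0 -cabs_gt0; apply: lt_le_trans (dz i); lra.
    have -> : H z + S * z^-1 = f z * (\prod_i (z - a i))^-1 -
        \sum_i c i * f (a i) * (a i / (z * (z - a i))).
      rewrite -partial_fractions // mulr_suml mulr_sumr -sumrB -big_split.
      apply: eq_bigr => i _ /=; rewrite /slope (negPf (dz0 i)) -/(c i).
      by field; rewrite z0 subr_eq0 dz0.
    have cz0 : 0 < cabs z by lra.
    have cz1 : 1 <= cabs z by lra.
    apply: (@le_trans _ _ (K / cabs z ^+ 2)); last first.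
      by rewrite ler_wpM2l // lef_pV2 ?posrE ?exprn_gt0 // lerXn2r ?nnegrE // ltW.
    apply: (le_trans (ler_cabsD _ _)); rewrite cabsN mulrDl; apply: lerD.
      rewrite cabsM cabsV cabs_prod.
      have lp : (cabs z / 2) ^+ m.+2 <= \prod_i cabs (z - a i).
        rewrite -[X in _ ^+ X](card_ord m.+2) -prodr_const; apply: ler_prod => i _.
        by rewrite dz andbT divr_ge0 // ltW.
      have p0 : 0 < (cabs z / 2) ^+ m.+2 by rewrite exprn_gt0 ?divr_gt0.
      rewrite ler_pdivrMr ?(lt_le_trans p0) //; apply: (le_trans (bf z)).
      apply: (@le_trans _ _ (M * (2 * cabs z) ^+ m)).
        by rewrite ler_wpM2l // lerXn2r ?nnegrE //; lra.
      have q0 : 0 <= M * 2 ^+ m * 2 ^+ m.+2 / cabs z ^+ 2.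
        by rewrite divr_ge0 ?exprn_ge0 ?cabs_ge0 // mulr_ge0 ?exprn_ge0 // mulr_ge0 ?exprn_ge0.
      apply: le_trans; last by apply: ler_wpM2l lp.
      rewrite exprMn expr_div_n le_eqVlt; apply/orP; left; apply/eqP.
      have : 2 ^+ m.+2 != 0 :> R by rewrite expf_neq0.
      move: (2 ^+ m.+2) => t t0; rewrite -[m.+2]addn2 exprD; field.
      by rewrite t0 gt_eqF.
    apply: (le_trans (cabs_sum _ _ _)); rewrite /B mulr_sumr mulr_suml; apply: ler_sum => i _.
    rewrite cabsM mulrCA -!mulrA; apply: ler_wpM2l; first exact: cabs_ge0.
    rewrite cabsM cabsV cabsM mulrCA; apply: ler_pM; rewrite ?cabs_ge0 ?invr_ge0 ?mulr_ge0 ?cabs_ge0 ?leA //.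
    rewrite invfM expr2 invfM mulrCA ler_pM2l ?invr_gt0 // -(invrK 2) -invfM.
    rewrite lef_pV2 ?posrE ?mulr_gt0 ?invr_gt0 //; first by rewrite mulrC.
    by rewrite cabs_gt0 subr_eq0.
  have := le_trans _ bT; rewrite eT cabsM => /(_ (cabs S * 4)).
  rewrite ler_wpM2l ?cabs_ge0 ?rint_inv_ge // => /(_ isT).
  rewrite (_ : 4 * (K / r ^+ 2) * _ = 4 * (4 * K) / r); last by field; rewrite gt_eqF.
  by rewrite ler_pdivlMr // mulrAC mulrC ler_pM2l.
apply/eqP; rewrite -cabs_eq0; apply/eqP/le_anti; rewrite cabs_ge0 andbT leNgt; apply/negP => S0.
(* Large enough for [key] to apply and for its conclusion to fail. *)
pose r := 2 * A + 1 + 4 * K / cabs S.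
have : 4 * K / cabs S < r by rewrite /r; lra.
rewrite ltr_pdivrMr // [r * _]mulrC ltNge key // /r.
have : 0 <= 4 * K / cabs S by rewrite divr_ge0 ?mulr_ge0 // ltW.
lra.
Qed.

End ComplexDerivative.

Section LaurentInterpolation.
Variable R : realType.
Local Notation C := R[i].
Implicit Types (f g : C -> C) (p z : C).

Definition lagr m (b : 'I_m.+1 -> C) (j : 'I_m.+1) : {poly C} :=
  (\prod_(k | k != j) (b j - b k))^-1 *: \prod_(k | k != j) ('X - (b k)%:P).

Lemma size_lagr m (b : 'I_m.+1 -> C) j : (size (lagr b j) <= m.+1)%N.
Proof.
apply: (leq_trans (size_scale_leq _ _)).
rewrite -big_filter size_prod_XsubC ltnS -ltnS.
rewrite [X in (X < _)%N](_ : _ = #|predC1 j|); last by rewrite -sum1_size big_filter sum1_card.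
by rewrite cardC1 card_ord.
Qed.

Lemma lagr_delta m (b : 'I_m.+1 -> C) i j : injective b -> (lagr b j).[b i] = (i == j)%:R.
Proof.
move=> ib; rewrite hornerZ horner_prod; have [->|ne] := eqVneq i j.
  under [X in _ * X]eq_bigr => k _ do rewrite hornerXsubC.
  rewrite mulVf //; apply/prodf_neq0 => k nk; rewrite subr_eq0 (inj_eq ib).
  by rewrite eq_sym.
by rewrite [X in _ * X](bigD1 i ne) /= hornerXsubC subrr mul0r mulr0.
Qed.

Lemma horner_growth m (q : {poly C}) : (size q <= m.+1)%N ->
  exists M : R, forall z, cabs q.[z] <= M * (1 + cabs z) ^+ m.
Proof.
move=> sq; exists (\sum_(i < size q) cabs q`_i) => z; rewrite horner_coef.
apply: (le_trans (cabs_sum _ _ _)); rewrite mulr_suml; apply: ler_sum => i _.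
rewrite cabsM cabsX; apply: ler_wpM2l; first exact: cabs_ge0.
apply: (@le_trans _ _ ((1 + cabs z) ^+ i)).
  by rewrite lerXn2r ?nnegrE ?addr_ge0 ?cabs_ge0 // lerDr.
apply: ler_weXn2l; first by rewrite lerDl cabs_ge0.
by rewrite -ltnS (leq_trans (ltn_ord i)).
Qed.

(** Subtracting the Lagrange interpolation leaves a function of the same growth that vanishes at the
    m + 1 nodes. In its divided difference at the nodes and z only the term at z survives, so its
    value there is 0. *)
Lemma growth_interpolation f (M : R) m (b : 'I_m.+1 -> C) : injective b ->
  (forall p, cdiff f p) -> (forall z, cabs (f z) <= M * (1 + cabs z) ^+ m) ->
  forall z, f z = \sum_j f (b j) * (lagr b j).[z].
Proof.
move=> ib df bf z; pose q := \sum_j f (b j) *: lagr b j.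
have qE w : q.[w] = \sum_j f (b j) * (lagr b j).[w].
  by rewrite horner_sum; apply: eq_bigr => j _; rewrite hornerZ.
rewrite -qE; pose h w := f w + (- q).[w].
have hb j : h (b j) = 0.
  rewrite /h hornerN qE (bigD1 j) //= lagr_delta // eqxx mulr1 big1 ?addr0 ?subrr //.
  by move=> k nk; rewrite lagr_delta // eq_sym (negPf nk) mulr0.
suff : h z = 0 by rewrite /h hornerN => /eqP; rewrite subr_eq0 => /eqP.
have [[j ->]//|nz] := pselect (exists j, z = b j).
have [N NP] : exists N : R, forall w, cabs (- q).[w] <= N * (1 + cabs w) ^+ m.
  apply: horner_growth; rewrite size_polyN; apply: (leq_trans (size_sum _ _ _)).
  by apply/bigmax_leqP => i _; apply: (leq_trans (size_scale_leq _ _)); exact: size_lagr.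
pose a (i : 'I_m.+2) := if unlift ord0 i is Some j then b j else z.
have ia : injective a.
  move=> i j; rewrite /a; case: unliftP => [i' ->|->]; case: unliftP => [j' ->|->] //.
  - by move=> /ib ->.
  - by move=> e; case: nz; exists i'.
  - by move=> e; case: nz; exists j'.
have aE i : a (lift ord0 i) = b i by rewrite /a liftK.
have a0 : a ord0 = z by rewrite /a unlift_none.
have dh p : cdiff h p by apply: cdiffD => //; exact: cdiff_horner.
have bh w : cabs (h w) <= (M + N) * (1 + cabs w) ^+ m.
  by apply: (le_trans (ler_cabsD _ _)); rewrite mulrDl lerD.
have := liouville_divided_difference dh bh ia.
rewrite big_ord_recl => /eqP; rewrite [X in _ + X == _]big1 ?addr0 => [|i _]; last first.
  by rewrite aE hb mulr0.
rewrite [h _](congr1 h a0) mulf_eq0 invr_eq0.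
have /negPf -> : \prod_(j | j != ord0) (a ord0 - a j) != 0.
  by apply/prodf_neq0 => k nk; rewrite subr_eq0 (inj_eq ia) eq_sym.
by move/eqP.
Qed.

(* Multiplying by z^(d+2) removes the singularity at 0. *)
Lemma laurent_interpolation (d : nat) : exists s : seq (C * int * C),
  (forall q, q \in s -> q.2 != 0) /\
  forall g, (forall z, z != 0 -> cdiff g z) ->
    (exists M : R, forall z, z != 0 -> cabs (g z) <= M * (1 + cabs z + cabs z^-1) ^+ d) ->
  forall z, z != 0 -> g z = \sum_(q <- s) q.1.1 * z ^ q.1.2 * g q.2.
Proof.
(* The function w^(d+2) g w is O(|w|^2) at 0 and of growth degree D = 2d + 2. It takes D + 1 nodes;
   1, ..., D + 1 are distinct and nonzero. *)
pose D := (d + d).+2; pose b (j : 'I_D.+1) : C := (j.+1)%:R.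
have ib : injective b.
  by move=> i j /eqP; rewrite /b eqr_nat eqSS => /eqP /val_inj.
have nb j : b j != 0 by rewrite pnatr_eq0.
pose e (l : nat) : int := l%:Z - d.+2%:Z.
exists [seq (b q.1 ^+ d.+2 * (lagr b q.1)`_q.2, e q.2, b q.1) |
   q <- [seq (j, nat_of_ord l) | j <- enum 'I_D.+1, l <- enum 'I_D.+1]].
split=> [_ /mapP[q _ ->]|g dg [M bg] z z0]; first exact: nb.
have M0 : 0 <= M.
  have := le_trans (cabs_ge0 _) (bg 1 (oner_neq0 _)); rewrite pmulr_lge0 // exprn_gt0 //.
  by rewrite !ltr_wpDr ?cabs_ge0.
pose f w := w ^+ d.+2 * g w.
have bd w : w != 0 -> cabs (f w) <= M * cabs w ^+ 2 * (1 + cabs w) ^+ (d + d).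
  move=> w0; rewrite /f cabsM cabsX -addn2 exprD -mulrA.
  have cw : 0 < cabs w by rewrite cabs_gt0.
  apply: (@le_trans _ _ (cabs w ^+ d * (cabs w ^+ 2 * (M * (1 + cabs w + cabs w^-1) ^+ d)))).
    by rewrite !ler_wpM2l ?exprn_ge0 ?cabs_ge0 // bg.
  rewrite [X in _ <= X](_ : _ = cabs w ^+ 2 * M * (1 + cabs w) ^+ (d + d)); last by ring.
  rewrite [X in X <= _](_ : _ = cabs w ^+ 2 * M * (cabs w * (1 + cabs w + cabs w^-1)) ^+ d).
    apply: ler_wpM2l; first by rewrite mulr_ge0 ?exprn_ge0 ?cabs_ge0.
    rewrite addnn -mul2n exprM lerXn2r ?nnegrE ?exprn_ge0 ?mulr_ge0 ?addr_ge0 ?cabs_ge0 //.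
    by rewrite cabsV !mulrDr mulfV ?gt_eqF //; nra.
  by rewrite exprMn; ring.
have df p : cdiff f p.
  have [->|p0] := eqVneq p 0; last first.
    by apply: cdiffM; [apply: cdiffX; exact: cdiff_id|exact: dg].
  (* The derivative at 0 is 0, since |f w| <= M 2^(2d) |w|^2 for |w| < 1; adding 1 keeps K
     positive. *)
  exists 0 => x x0; pose K := M * 2 ^+ (d + d) + 1.
  have K0 : 0 < K by rewrite ltr_wpDl // mulr_ge0 // exprn_ge0.
  exists (Num.min 1 (x / K)) => [|w]; first by rewrite lt_min ltr01 divr_gt0.
  rewrite subr0 mul0r subr0 {2}/f expr0n /= mul0r subr0 lt_min => /andP[w1 wx].
  have [->|w0] := eqVneq w 0; first by rewrite /f expr0n /= mul0r cabs0 mulr0.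
  apply: (le_trans (bd _ w0)).
  have cw := cabs_ge0 w.
  have : (1 + cabs w) ^+ (d + d) <= 2 ^+ (d + d) by rewrite lerXn2r ?nnegrE //; lra.
  rewrite ltr_pdivlMr // in wx; move: wx; rewrite /K.
  have : 0 <= (1 + cabs w) ^+ (d + d) by rewrite exprn_ge0 // addr_ge0.
  move: (_ ^+ (d + d)) (2 ^+ (d + d)) => s t s0 wx st.
  rewrite expr2; apply: (@le_trans _ _ (M * (cabs w * cabs w) * t)).
    by rewrite ler_wpM2l // !mulr_ge0.
  nra.
have bf w : cabs (f w) <= M * (1 + cabs w) ^+ D.
  have [->|w0] := eqVneq w 0.
    by rewrite /f expr0n /= mul0r cabs0 mulr_ge0 // exprn_ge0 // addr_ge0 ?cabs_ge0.
  apply: (le_trans (bd _ w0)); rewrite -[X in _ <= _ * _ ^+ X]addn2 [X in _ <= _ * X]exprD -mulrA ler_wpM2l // mulrC.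
  rewrite ler_wpM2l ?exprn_ge0 ?addr_ge0 ?cabs_ge0 // lerXn2r ?nnegrE ?addr_ge0 ?cabs_ge0 //.
  by rewrite lerDr.
have := growth_interpolation ib df bf z; rewrite /f => fz.
have zd : z ^+ d.+2 != 0 by rewrite expf_neq0.
apply: (mulfI zd); rewrite fz big_map big_allpairs_dep /= mulr_sumr.
rewrite big_enum; apply: eq_bigr => j _.
rewrite big_enum /= mulr_sumr (horner_coef_wide _ (size_lagr b j)) mulr_sumr.
apply: eq_bigr => l _; rewrite /e expfzDr // -exprnN -exprnP; field.
exact: zd.
Qed.

End LaurentInterpolation.

(** * Points and characters of the torus *)

Section TorusCharacters.
Variables (R : realType) (n : nat).
Local Notation C := R[i].
Local Notation torus := (torus R n).
Implicit Types (t s : torus) (m : 'rV[int]_n).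

Lemma torus_neq0 t j : val t 0 j != 0.
Proof. exact: (forallP (valP t)). Qed.

Lemma torus_ext t s : (forall j, val t 0 j = val s 0 j) -> t = s.
Proof. by move=> e; apply/val_inj/rowP. Qed.

Lemma mkt_subproof (f : 'I_n -> C) : in_torus (\row_j (if f j == 0 then 1 else f j)).
Proof. by apply/forallP => j; rewrite mxE; case: ifPn => // _; exact: oner_neq0. Qed.

(** Replacing zeros by 1 makes every family of coordinates a point of T, so that nonvanishing is
    needed only when a coordinate is read, in [mktE]. *)
Definition mkt (f : 'I_n -> C) : torus := exist (@in_torus R n) _ (mkt_subproof f).

Lemma mktE f j : f j != 0 -> val (mkt f) 0 j = f j.
Proof. by rewrite mxE => /negPf ->. Qed.

Arguments mkt : simpl never.

Definition tone : torus := mkt (fun=> 1).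

Lemma toneE j : val tone 0 j = 1.
Proof. by rewrite mktE // oner_neq0. Qed.

Definition tset t (i : 'I_n) (z : C) : torus := mkt (fun j => if j == i then z else val t 0 j).

Lemma tsetE t i z j : z != 0 -> val (tset t i z) 0 j = if j == i then z else val t 0 j.
Proof. by move=> z0; rewrite mktE //; case: ifP => // _; exact: torus_neq0. Qed.

Arguments tset : simpl never.

Lemma tset_id t i : tset t i (val t 0 i) = t.
Proof. by apply: torus_ext => j; rewrite tsetE ?torus_neq0 //; case: eqVneq => // ->. Qed.

Lemma tmulE t s j : val (tmul t s) 0 j = val t 0 j * val s 0 j.
Proof. by rewrite mxE. Qed.

Lemma tinvE t j : val (tinv t) 0 j = (val t 0 j)^-1.
Proof. by rewrite mxE. Qed.

Lemma tmulC t s : tmul t s = tmul s t.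
Proof. by apply: torus_ext => j; rewrite !tmulE mulrC. Qed.

Lemma character_neq0 m t : character m t != 0.
Proof. by apply/prodf_neq0 => j _; rewrite expfz_neq0 // torus_neq0. Qed.

Lemma characterD m m' t : character (m + m') t = character m t * character m' t.
Proof.
rewrite /character -big_split; apply: eq_bigr => j _ /=.
by rewrite mxE expfzDr // torus_neq0.
Qed.

Lemma character0 t : character 0 t = 1.
Proof. by rewrite /character big1 // => j _; rewrite mxE expr0z. Qed.

Lemma characterN m t : character (- m) t = (character m t)^-1.
Proof.
apply: (mulfI (character_neq0 m t)); rewrite divff ?character_neq0 //.
by rewrite -characterD subrr character0.
Qed.

Lemma characterM m t s : character m (tmul t s) = character m t * character m s.
Proof.
rewrite /character -big_split; apply: eq_bigr => j _ /=.
by rewrite mxE exprzMl // unitfE torus_neq0.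
Qed.

Lemma character1 m : character m tone = 1.
Proof. by rewrite /character big1 // => j _; rewrite toneE exp1rz. Qed.

Lemma characterV m t : character m (tinv t) = (character m t)^-1.
Proof.
apply: (mulfI (character_neq0 m t)); rewrite divff ?character_neq0 // -characterM.
rewrite (_ : tmul t (tinv t) = tone) ?character1 //.
by apply: torus_ext => j; rewrite tmulE tinvE toneE divff // torus_neq0.
Qed.

Lemma character_tset m i z : z != 0 -> character m (tset tone i z) = z ^ (m 0 i).
Proof.
move=> z0; rewrite /character (bigD1 i) // tsetE // eqxx big1 => [|j /negPf nj].
  exact: mulr1.
by rewrite tsetE // nj toneE exp1rz.
Qed.

Lemma cabs_exprz (z : C) (k : int) : cabs (z ^ k) = cabs z ^ k.
Proof. by case: k => k; [exact: cabsX|rewrite [LHS]cabsV cabsX]. Qed.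

Lemma character_sep m m' : m != m' -> exists s, character m s != character m' s.
Proof.
move=> ne; have [i ni] : exists i, m 0 i != m' 0 i.
  apply/existsP; apply: contraR ne => /existsPn H; apply/eqP/rowP => i.
  by have := H i; rewrite negbK => /eqP.
(* The modulus of 2^k determines k. *)
exists (tset tone i 2); rewrite !character_tset // ?pnatr_eq0 //.
apply: contraNneq ni => /(congr1 (@cabs R)); rewrite !cabs_exprz.
have -> : cabs (2 : C) = 2 by rewrite -(rmorph_nat (real_complex R)) cabs_real normr_nat.
by move=> e; apply/eqP; apply: (ieexprIz _ _ e); rewrite ?ltr0n // (eqr_nat R 2 1).
Qed.

(** Induction on the number of characters: f(s t) - chi^m'(s) f(t) loses the term m' and multiplies
    the term m by a nonzero scalar when s separates m and m'. It is applied to homogeneity, to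
    boundedness along a coordinate, and to vanishing. *)
Lemma isotypic_extraction (V : lmodType C) (P : (torus -> V) -> Prop) :
  (forall f g, P f -> P g -> P (fun t => f t + g t)) ->
  (forall (a : C) f, P f -> P (fun t => a *: f t)) ->
  (forall s f, P f -> P (fun t => f (tmul s t))) ->
  forall (B : seq 'rV[int]_n) (c : 'rV[int]_n -> V), uniq B ->
  P (fun t => \sum_(m <- B) character m t *: c m) ->
  forall m, m \in B -> P (fun t => character m t *: c m).
Proof.
move=> PD PZ PT B; move: {2}(size B) (leqnn (size B)) => k.
elim: k B => [|k IH] B szB c uB PB m mB; first by case: B szB mB {uB PB}.
have [[m' m'B nm]|none] := pselect (exists2 m', m' \in B & m' != m); last first.
  rewrite (_ : (fun _ => _) = (fun t => \sum_(m <- B) character m t *: c m)) //.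
  apply/funext => t; rewrite (big_rem m) //= big_seq big1 ?addr0 // => m'.
  rewrite mem_rem_uniq // inE => /andP[nm m'B]; case: none.
  by exists m'.
have [s ns] := character_sep nm.
(* The coefficients of that combination, normalised so that the one at m is unchanged and the one at
   m' is 0. *)
pose c' q := ((character q s - character m' s) / (character m s - character m' s)) *: c q.
have d0 : character m s - character m' s != 0 by rewrite subr_eq0 eq_sym.
have -> : (fun t => character m t *: c m) = (fun t => character m t *: c' m).
  by apply/funext => t; rewrite /c' divff // scale1r.
apply: (IH (rem m' B)); rewrite ?rem_uniq ?mem_rem_uniq ?inE 1?eq_sym ?nm //.
  by rewrite size_rem //; case: (B) szB m'B.
have := PZ (character m s - character m' s)^-1 _ (PD _ _ (PT s _ PB) (PZ (- character m' s) _ PB)).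
congr P; apply/funext => t; rewrite scaler_sumr -big_split scaler_sumr /=.
rewrite (big_rem m') //= [X in X + _](_ : _ = 0) ?add0r.
  apply: eq_bigr => q _; rewrite /c' characterM !scalerA -scalerDl scalerA.
  by congr (_ *: _); field.
by rewrite characterM !scalerA -scalerDl scalerA mulNr subrr mulr0 scale0r.
Qed.

Lemma character_sum_collect (V : lmodType C) (s : seq (V * 'rV[int]_n)) :
  exists2 B : seq 'rV[int]_n, uniq B & exists c : 'rV[int]_n -> V, forall t,
    \sum_(q <- s) character q.2 t *: q.1 = \sum_(m <- B) character m t *: c m.
Proof.
exists (undup [seq q.2 | q <- s]); first exact: undup_uniq.
exists (fun m => \sum_(q <- s | q.2 == m) q.1) => t.
under [RHS]eq_bigr => m _ do rewrite scaler_sumr.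
rewrite (exchange_big_dep predT) //= big_seq [RHS]big_seq; apply: eq_bigr => q qs.
rewrite big_mkcond (bigD1_seq q.2) ?undup_uniq ?mem_undup ?map_f //= eqxx big1 ?addr0 //.
by move=> m nm; rewrite eq_sym (negPf nm).
Qed.

End TorusCharacters.

Section TorusLaurent.
Variables (R : realType) (n : nat).
Local Notation C := R[i].
Local Notation torus := (torus R n).
Implicit Types (t s b : torus) (F : torus -> C).

(** A size function, at least 1, that bounds each |t_j| and |t_j|^-1, and hence, up to a power,
    every character. *)
Definition tnorm t : R := 1 + \sum_j (cabs (val t 0 j) + cabs (val t 0 j)^-1).

Lemma tnorm_ge1 t : 1 <= tnorm t.
Proof. by rewrite lerDl sumr_ge0 // => j _; rewrite addr_ge0 ?cabs_ge0. Qed.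

Lemma tnorm_ge0 t : 0 <= tnorm t.
Proof. exact: le_trans (tnorm_ge1 t). Qed.

Lemma tnorm_tset t i z : z != 0 -> tnorm (tset t i z) <= tnorm t * (1 + cabs z + cabs z^-1).
Proof.
move=> z0; apply: (@le_trans _ _ (tnorm t + (cabs z + cabs z^-1))).
  rewrite /tnorm -addrA lerD2l (bigD1 i) //= tsetE // eqxx addrC.
  rewrite (eq_bigr (fun j => cabs (val t 0 j) + cabs (val t 0 j)^-1)); last first.
    by move=> j /negPf nj; rewrite tsetE // nj.
  by rewrite lerD2r [in leRHS](bigD1 i) //= lerDr addr_ge0 ?cabs_ge0.
have := tnorm_ge1 t; have := cabs_ge0 z; have := cabs_ge0 z^-1; nra.
Qed.

Definition mix (k : nat) b t : torus :=
  mkt (fun j : 'I_n => if (j < k)%N then val b 0 j else val t 0 j).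

Lemma mixE k b t j : val (mix k b t) 0 j = if (j < k)%N then val b 0 j else val t 0 j.
Proof. by rewrite mktE //; case: ifP => _; exact: torus_neq0. Qed.

Lemma mix_tset (k : 'I_n) b t z : z != 0 ->
  tset (mix k b t) k z = mix k.+1 (tset b k z) t.
Proof.
move=> z0; apply: torus_ext => j; rewrite tsetE // !mixE tsetE // ltnS.
have [->|ne] := eqVneq j k; first by rewrite leqnn.
by rewrite [(j <= k)%N]leq_eqVlt val_eqE (negPf ne).
Qed.

(* Laurent interpolation in one coordinate after the other. *)
Lemma torus_laurent F (M : R) (d : nat) :
  (forall t i z, z != 0 -> cdiff (fun w => F (tset t i w)) z) ->
  (forall t, cabs (F t) <= M * tnorm t ^+ d) ->
  exists s : seq (C * 'rV[int]_n), forall t, F t = \sum_(q <- s) q.1 * character q.2 t.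
Proof.
move=> dF bF; have [s1 [s1n s1P]] := laurent_interpolation R d.
(* After k stages the first k coordinates of the argument of F are frozen at nodes. As the list [s1]
   does not depend on the function interpolated, the new coefficients are constants. *)
suff H k : (k <= n)%N -> exists s : seq (C * 'rV[int]_n * torus), forall t,
    F t = \sum_(q <- s) q.1.1 * character q.1.2 t * F (mix k q.2 t).
  have [s sP] := H n (leqnn n).
  exists [seq (q.1.1 * F q.2, q.1.2) | q <- s] => t; rewrite sP big_map /=.
  apply: eq_bigr => q _; rewrite mulrAC; congr (_ * F _ * _).
  by apply: torus_ext => j; rewrite mixE ltn_ord.
elim: k => [_|k IH kn].
  exists [:: (1, 0, tone R n)] => t; rewrite big_seq1 /= character0 !mul1r; congr F.
  by apply: torus_ext => j; rewrite mixE.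
have [s sP] := IH (ltnW kn); pose k' := Ordinal kn.
exists [seq (q.1.1 * r.1.1, q.1.2 + r.1.2 *: delta_mx 0 k', tset q.2 k' r.2) | q <- s, r <- s1] => t.
rewrite sP big_allpairs_dep /=; apply: eq_bigr => q _.
have M0 : 0 <= M.
  have := le_trans (cabs_ge0 _) (bF t); rewrite pmulr_lge0 // exprn_gt0 //.
  exact: lt_le_trans (tnorm_ge1 t).
pose u := mix k q.2 t.
have -> : F (mix k q.2 t) = F (tset u k' (val t 0 k')).
  by rewrite (_ : val t 0 k' = val u 0 k') ?tset_id // mixE ltnn.
rewrite (s1P (fun w => F (tset u k' w))) ?torus_neq0 //; first last.
  (* This bound varies with t through u, which is harmless: [s1] depends on d only, not on the
     bound. *)
  exists (M * tnorm u ^+ d) => z z0; apply: (le_trans (bF _)).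
  rewrite -mulrA ler_wpM2l // -exprMn lerXn2r ?nnegrE ?tnorm_tset //.
    exact: tnorm_ge0.
  by rewrite mulr_ge0 ?tnorm_ge0 // !addr_ge0 ?cabs_ge0.
  by move=> z z0; exact: dF.
rewrite mulr_sumr big_seq [RHS]big_seq; apply: eq_bigr => r rs.
rewrite [tset u _ _](@mix_tset k' q.2 t _ (s1n _ rs)) characterD -!mulrA; congr (_ * _).
rewrite mulrCA; congr (_ * (_ * _)); congr (_ * _).
rewrite /character (bigD1 k') //= !mxE !eqxx mulr1 big1 ?mulr1 // => j nj.
by rewrite !mxE eqxx (negPf nj) mulr0 expr0z.
Qed.

End TorusLaurent.

Section TorusFields.
Variables (R : realType) (n : nat).
Local Notation C := R[i].
Local Notation torus := (torus R n).
Implicit Types (t s : torus) (E : ext C n) (v : tfield R n).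

Definition ind (S : {set 'I_n}) : 'rV[int]_n := \row_j (j \in S)%:Z.

Lemma character_ind (S : {set 'I_n}) t : character (ind S) t = \prod_(i in S) val t 0 i.
Proof.
rewrite /character [RHS]big_mkcond; apply: eq_bigr => j _; rewrite mxE.
by case: (j \in S); rewrite ?expr1z ?expr0z.
Qed.

Lemma rhoE E t S : rho E t S = character (ind S) t * (E S : C).
Proof. by rewrite /rho extmap_diag character_ind. Qed.

Lemma rho_ebas S t : rho (ebas C S) t = character (ind S) t *: ebas C S.
Proof.
apply/ffunP => T; rewrite rhoE !ffunE; case: eqVneq => [->//|_].
by rewrite mulr0 /GRing.scale /= mulr0.
Qed.

Lemma rhoD E E' t : rho (E + E') t = rho E t + rho E' t.
Proof. exact: extmapD. Qed.

Lemma rhoZ (a : C) E t : rho (a *: E) t = a *: rho E t.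
Proof. exact: extmapZ. Qed.

Lemma twedge_rho E E' t : twedge (rho E) (rho E') t = rho (wedge E E') t.
Proof. by rewrite /twedge /rho extmap_wedge. Qed.

Lemma tfield_laurent v (M : R) (d : nat) :
  (forall S t i z, z != 0 -> cdiff (fun w => v (tset t i w) S) z) ->
  (forall S t, cabs (v t S) <= M * tnorm t ^+ d) ->
  exists2 B : seq 'rV[int]_n, uniq B & exists E : 'rV[int]_n -> ext C n, forall t,
    v t = \sum_(m <- B) character m t *: rho (E m) t.
Proof.
move=> dv bv.
have /choice [s sP] : forall S, exists s : seq (C * 'rV[int]_n), forall t,
    v t S = \sum_(q <- s) q.1 * character q.2 t.
  by move=> S; apply: torus_laurent (dv S) (bv S).
(* The frame vector indexed by T is chi^(- ind T) rho(e_T), which shifts the exponents when passing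
   to the invariant frame. *)
pose s' := flatten [seq [seq (q.1 *: ebas C T, q.2 - ind T) | q <- s T] | T <- enum {set 'I_n}].
have [B uB [E EP]] := character_sum_collect s'.
exists B => //; exists E => t.
have lin : rho (\sum_(q <- s') character q.2 t *: q.1) t =
    \sum_(m <- B) character m t *: rho (E m) t.
  rewrite EP; elim: (B) => [|m B' IH]; first by rewrite !big_nil; exact: extmap0.
  by rewrite !big_cons rhoD rhoZ IH.
rewrite -lin /s' big_flatten big_map big_enum /= /rho extmap_sum -/(rho _ _).
rewrite [LHS]ext_ebas; apply: eq_bigr => S _.
rewrite big_map extmap_sum sP scaler_suml; apply: eq_bigr => q _ /=.
rewrite !extmapZ -/(rho _ _) rho_ebas !scalerA characterD characterN; congr (_ *: _).
by field; exact: character_neq0.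
Qed.

End TorusFields.

(** * Cones and charts of the fan *)

Section LatticeCones.
Variables (R : realType) (n : nat).
Local Notation C := R[i].
Implicit Types (m v : 'rV[int]_n) (A B : 'M[int]_n) (J K : {set 'I_n}) (x y u : 'rV[R]_n).

Definition ip m v : int := \sum_i m 0 i * v 0 i.

Lemma dot_toR m v : dot (toR R m) (toR R v) = (ip m v)%:~R.
Proof. by rewrite /dot /ip rmorph_sum; apply: eq_bigr => i _; rewrite !mxE rmorphM. Qed.

Lemma toRD m v : toR R (m + v) = toR R m + toR R v.
Proof. exact: raddfD. Qed.

Lemma toR_inj : injective (@toR R n).
Proof.
move=> m v /rowP e; apply/rowP => i; have := e i; rewrite !mxE.
exact: intr_inj.
Qed.

Lemma ipDl m m' v : ip (m + m') v = ip m v + ip m' v.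
Proof. by rewrite /ip -big_split; apply: eq_bigr => i _; rewrite mxE mulrDl. Qed.

Lemma ip_suml (I : Type) (r : seq I) (P : pred I) (F : I -> 'rV[int]_n) v :
  ip (\sum_(i <- r | P i) F i) v = \sum_(i <- r | P i) ip (F i) v.
Proof.
apply: (big_morph (ip^~ v) (fun a b => ipDl a b v)).
by rewrite /ip big1 // => i _; rewrite mxE mul0r.
Qed.

Lemma ipMn m v (k : nat) : ip (m *+ k) v = ip m v *+ k.
Proof.
elim: k => [|k IH]; last by rewrite !mulrS ipDl IH.
by rewrite !mulr0n /ip big1 // => i _; rewrite mxE mul0r.
Qed.

Lemma dotC x y : dot x y = dot y x.
Proof. by apply: eq_bigr => i _; rewrite mulrC. Qed.

Lemma dotDl x y u : dot (x + y) u = dot x u + dot y u.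
Proof. by rewrite /dot -big_split; apply: eq_bigr => i _; rewrite mxE mulrDl. Qed.

Lemma dotZl (a : R) x u : dot (a *: x) u = a * dot x u.
Proof. by rewrite /dot mulr_sumr; apply: eq_bigr => i _; rewrite mxE mulrA. Qed.

Lemma dot0l u : dot (0 : 'rV[R]_n) u = 0.
Proof. by rewrite /dot big1 // => i _; rewrite mxE mul0r. Qed.

Lemma dotDr x y u : dot u (x + y) = dot u x + dot u y.
Proof. by rewrite dotC dotDl !(dotC u). Qed.

Lemma dotZr (a : R) x u : dot u (a *: x) = a * dot u x.
Proof. by rewrite dotC dotZl dotC. Qed.

Lemma dot0r u : dot u (0 : 'rV[R]_n) = 0.
Proof. by rewrite dotC dot0l. Qed.

Lemma dotNl x u : dot (- x) u = - dot x u.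
Proof. by rewrite -scaleN1r dotZl mulN1r. Qed.

Lemma dotNr x u : dot u (- x) = - dot u x.
Proof. by rewrite dotC dotNl dotC. Qed.

Lemma dot_suml (I : Type) (r : seq I) (P : pred I) (F : I -> 'rV[R]_n) u :
  dot (\sum_(i <- r | P i) F i) u = \sum_(i <- r | P i) dot (F i) u.
Proof. by elim/big_rec2: _ => [|i a b _ <-]; rewrite ?dot0l // dotDl. Qed.

Lemma dot_sumr (I : Type) (r : seq I) (P : pred I) (F : I -> 'rV[R]_n) u :
  dot u (\sum_(i <- r | P i) F i) = \sum_(i <- r | P i) dot u (F i).
Proof. by elim/big_rec2: _ => [|i a b _ <-]; rewrite ?dot0r // dotDr. Qed.

Lemma cone_sum (S : set 'rV[R]_n) (I : Type) (r : seq I) (P : pred I) (c : I -> R)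
    (X : I -> 'rV[R]_n) :
  (forall i, P i -> 0 <= c i) -> (forall i, P i -> S (X i)) ->
  cone S (\sum_(i <- r | P i) c i *: X i).
Proof.
move=> c0 Sx; rewrite -big_filter.
have H (Q : I -> Prop) : (forall i, P i -> Q i) ->
    forall j, Q (tnth (in_tuple (seq.filter P r)) j).
  by move=> PQ j; apply: PQ; move: j; apply/all_tnthP; exact: filter_all.
exists (size (seq.filter P r)), (fun j => c (tnth (in_tuple (seq.filter P r)) j)),
  (fun j => X (tnth (in_tuple (seq.filter P r)) j)); split.
- exact: (H (fun i => 0 <= c i)).
- exact: (H (fun i => S (X i))).
- by rewrite (big_tnth _ _ (seq.filter P r)).
Qed.

Definition Rmx A : 'M[R]_n := map_mx intr A.

Lemma RmxM A B : Rmx (A *m B) = Rmx A *m Rmx B.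
Proof. exact: map_mxM. Qed.

Lemma Rmx1 : Rmx 1%:M = 1%:M.
Proof. exact: map_mx1. Qed.

Definition dualb A j : 'rV[int]_n := (col j (invmx A))^T.

Definition crd A x : 'rV[R]_n := x *m Rmx (invmx A).

Lemma crdE A x j : crd A x 0 j = dot (toR R (dualb A j)) x.
Proof. by rewrite mxE; apply: eq_bigr => i _; rewrite !mxE mulrC. Qed.

Lemma crdK A x : A \in unitmx -> crd A x *m Rmx A = x.
Proof. by move=> uA; rewrite /crd -mulmxA -RmxM mulVmx // Rmx1 mulmx1. Qed.

Lemma crd_toR A v : crd A (toR R v) = toR R (v *m invmx A).
Proof. by rewrite /crd /Rmx /toR map_mxM. Qed.

Lemma crd_row A j : A \in unitmx -> crd A (toR R (row j A)) = delta_mx 0 j.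
Proof.
move=> uA; rewrite crd_toR -row_mul mulmxV // row1 /toR.
by apply/matrixP => i k; rewrite !mxE; case: (_ && _).
Qed.

Lemma crd_sum A x : A \in unitmx -> x = \sum_j crd A x 0 j *: toR R (row j A).
Proof.
move=> uA; rewrite -[LHS](crdK x uA) mulmx_sum_row; apply: eq_bigr => j _.
by congr (_ *: _); rewrite /Rmx /toR map_row.
Qed.

Lemma ip_dualb A B j k : ip (dualb B k) (row j A) = (A *m invmx B) j k.
Proof. by rewrite mxE; apply: eq_bigr => i _; rewrite !mxE mulrC. Qed.

Lemma ip_dualb1 A j k : A \in unitmx -> ip (dualb A k) (row j A) = (j == k)%:Z.
Proof. by move=> uA; rewrite ip_dualb mulmxV // !mxE; case: eqP. Qed.

Lemma dualb_sum A m : A \in unitmx -> m = \sum_j ip m (row j A) *: dualb A j.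
Proof.
move=> uA; apply/rowP => k.
have -> : m = m *m A^T *m (invmx A)^T.
  by rewrite -mulmxA -trmx_mul mulVmx // trmx1 mulmx1.
rewrite mxE summxE; apply: eq_bigr => j _; rewrite !mxE; congr (_ * _).
have -> : m *m A^T *m (invmx A)^T = m.
  by rewrite -mulmxA -trmx_mul mulVmx // trmx1 mulmx1.
by apply: eq_bigr => i _; rewrite !mxE.
Qed.

Lemma row_coneE A J x : A \in unitmx ->
  row_cone A J x <-> forall j, 0 <= crd A x 0 j /\ (j \notin J -> crd A x 0 j = 0).
Proof.
move=> uA; split=> [[m [c [X [c0 Xin ->]]]] j|H].
  have e i : crd A (c i *: X i) 0 j = c i * (crd A (X i) 0 j).
    by rewrite /crd -scalemxAl mxE.
  have -> : crd A (\sum_i c i *: X i) 0 j = \sum_i c i * crd A (X i) 0 j.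
    by rewrite /crd mulmx_suml summxE; apply: eq_bigr => i _; rewrite -e.
  split=> [|jJ].
    apply: sumr_ge0 => i _; have [k kJ ->] := Xin i.
    by rewrite crd_row // mxE mulr_ge0 // ler0n.
  rewrite big1 // => i _; have [k kJ ->] := Xin i.
  rewrite crd_row // mxE eqxx /=; case: eqVneq => [e'|_]; last by rewrite mulr0.
  by rewrite e' kJ in jJ.
rewrite (crd_sum x uA) (bigID (mem J)) /= addrC big1 ?add0r.
  apply: cone_sum => j jJ; first by case: (H j).
  by exists j.
by move=> j jJ; rewrite (H j).2 // scale0r.
Qed.

Lemma row_cone0 A J : A \in unitmx -> row_cone A J (0 : 'rV[R]_n).
Proof. by move=> uA; apply/row_coneE => // j; rewrite /crd mul0mx mxE. Qed.

Lemma row_cone_row A J j : A \in unitmx -> j \in J -> row_cone A J (toR R (row j A)).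
Proof.
move=> uA jJ; apply/row_coneE => // k; rewrite crd_row // mxE eqxx /=; split=> [|kJ].
  exact: ler0n.
by case: eqVneq kJ => // ->; rewrite jJ.
Qed.

Lemma row_cone_set0 A : A \in unitmx -> row_cone A finset.set0 = [set (0 : 'rV[R]_n)].
Proof.
move=> uA; apply/seteqP; split=> x /=; last by move=> ->; exact: row_cone0.
move=> /(row_coneE _ _ uA) H; rewrite (crd_sum x uA) big1 // => j _.
by rewrite (H j).2 ?scale0r // inE.
Qed.

(** The supporting form is the sum of the dual basis vectors with index in J but not in J'. *)
Lemma face_row_cone A J J' : A \in unitmx -> J' \subset J ->
  face (row_cone A J : set 'rV[R]_n) (row_cone A J').
Proof.
move=> uA sJ; split; first by exists 0; exact: row_cone0.
exists (\sum_(j in J :\: J') toR R (dualb A j)), 0.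
have dE x : dot (\sum_(j in J :\: J') toR R (dualb A j)) x = \sum_(j in J :\: J') crd A x 0 j.
  by rewrite dot_suml; apply: eq_bigr => j _; rewrite crdE.
split=> [x /(row_coneE _ _ uA) H|].
  by rewrite dE sumr_ge0 // => j _; case: (H j).
apply/seteqP; split=> x /=.
  move=> /(row_coneE _ _ uA) H; split.
    apply/row_coneE => // j; have [h1 h2] := H j; split=> // jJ; apply: h2.
    by apply: contra jJ; exact: (fintype.subsetP sJ).
  by rewrite dE big1 // => j; rewrite inE => /andP[jJ _]; rewrite (H j).2.
move=> [/(row_coneE _ _ uA) H]; rewrite dE => /eqP; rewrite psumr_eq0 => [|j _]; last by case: (H j).
move=> /allP e; apply/row_coneE => // j; split=> [|jJ']; first by case: (H j).
have [jJ|jJ] := boolP (j \in J); last by rewrite (H j).2.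
have := e j (mem_index_enum _); rewrite inE jJ jJ' /= => /eqP //.
Qed.

Lemma face_row_coneE A J (F : set 'rV[R]_n) : A \in unitmx ->
  face (row_cone A J) F -> exists2 J' : {set 'I_n}, J' \subset J & F = row_cone A J'.
Proof.
move=> uA [[x0 Fx0] [u [c [uc eF]]]].
have cle0 : c <= 0 by have := uc _ (row_cone0 J uA); rewrite dot0r.
(* The origin gives c <= 0, and doubling a point of the face gives c <= 2 c. *)
have c0 : c = 0.
  apply/le_anti; rewrite cle0 /=; move: Fx0; rewrite eF => -[/(row_coneE _ _ uA) H e].
  have : row_cone A J (2 *: x0).
    apply/row_coneE => // j; rewrite /crd -scalemxAl mxE; have [h1 h2] := H j; split.
      by rewrite mulr_ge0.
    by move=> jJ; rewrite [crd A x0 0 j]h2 // mulr0.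
  by move/uc; rewrite dotZr e; lra.
have uJ j : j \in J -> 0 <= dot u (toR R (row j A)).
  by move=> jJ; rewrite -c0; apply/uc/row_cone_row.
exists [set j in J | dot u (toR R (row j A)) == 0]%SET.
  by apply/fintype.subsetP => j; rewrite inE => /andP[].
have du x : row_cone A J x ->
    dot u x = \sum_(j in J) crd A x 0 j * dot u (toR R (row j A)).
  move=> /(row_coneE _ _ uA) H; rewrite {1}(crd_sum x uA) dot_sumr.
  rewrite [RHS]big_mkcond; apply: eq_bigr => j _; rewrite dotZr.
  by case: (boolP (j \in J)) => // jJ; rewrite (H j).2 // mul0r.
rewrite eF c0; apply/seteqP; split=> x /=.
  move=> [xJ]; rewrite du // => /eqP; move/(row_coneE _ _ uA): xJ => H.
  rewrite psumr_eq0 => [/allP e|j jJ]; last by rewrite mulr_ge0 ?uJ //; case: (H j).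
  apply/row_coneE => // j; split=> [|]; first by case: (H j).
  rewrite inE negb_and => /orP[jJ|nz]; first by rewrite (H j).2.
  have [jJ|jJ] := boolP (j \in J); last by rewrite (H j).2.
  have := e j (mem_index_enum _); rewrite jJ /= mulf_eq0 (negPf nz) orbF => /eqP //.
move=> /(row_coneE _ _ uA) H.
have xJ : row_cone A J x.
  apply/row_coneE => // j; have [h1 h2] := H j; split=> // jJ; apply: h2.
  by rewrite inE (negPf jJ).
split=> //; rewrite du // big1 // => j jJ.
have [e|ne] := eqVneq (dot u (toR R (row j A))) 0; first by rewrite e mulr0.
by rewrite (H j).2 ?mul0r // inE jJ.
Qed.

Lemma perp_row_cone A J m : A \in unitmx ->
  perp (row_cone A J : set 'rV[R]_n) m <-> forall j, j \in J -> ip m (row j A) = 0.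
Proof.
move=> uA; split=> [H j jJ|H x /(row_coneE _ _ uA) xP].
  by have := H _ (row_cone_row uA jJ); rewrite dot_toR => /eqP; rewrite intr_eq0 => /eqP.
rewrite (crd_sum x uA) dot_sumr big1 // => j _; rewrite dotZr dot_toR.
have [/H ->|/(proj2 (xP j)) ->] := boolP (j \in J); first by rewrite mulr0.
by rewrite mul0r.
Qed.

Lemma dual_row_cone A J m : A \in unitmx ->
  dual_cone (row_cone A J : set 'rV[R]_n) m <-> forall j, j \in J -> 0 <= ip m (row j A).
Proof.
move=> uA; split=> [H j jJ|H x /(row_coneE _ _ uA) xP].
  by have := H _ (row_cone_row uA jJ); rewrite dot_toR ler0z.
rewrite (crd_sum x uA) dot_sumr sumr_ge0 // => j _; rewrite dotZr dot_toR.
have [jJ|/(proj2 (xP j)) ->] := boolP (j \in J); last by rewrite mul0r.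
by rewrite mulr_ge0 ?ler0z ?H //; case: (xP j).
Qed.

Lemma prim_gen_uniq (a : set 'rV[R]_n) v v' : prim_gen a v -> prim_gen a v' -> v = v'.
Proof.
move=> [nz H] [nz' H'].
have [m e] : exists m : nat, v = v' *+ m by apply/H'/H; exists 1%N; rewrite mulr1n.
have [m' e'] : exists m : nat, v' = v *+ m by apply/H/H'; exists 1%N; rewrite mulr1n.
have [k nk] : exists k, v 0 k != 0.
  apply/existsP; apply: contraR nz => /existsPn h; apply/eqP/rowP => k.
  by have := h k; rewrite negbK mxE => /eqP.
have : v 0 k = v 0 k *+ (m' * m) by rewrite {1}e e' -mulrnA mulmxnE.
rewrite -mulr_natr -[X in X = _]mulr1 => /(mulfI nk) /eqP; rewrite eq_sym (eqr_nat _ _ 1).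
by rewrite muln_eq1 => /andP[_ /eqP m1]; rewrite e m1 mulr1n.
Qed.

Lemma row_neq0 A j : A \in unitmx -> row j A != 0.
Proof.
move=> uA; apply/eqP => e; have := ip_dualb1 j j uA; rewrite e eqxx /ip big1 //.
by move=> i _; rewrite [X in _ * X]mxE mulr0.
Qed.

Lemma prim_gen_row A j : A \in unitmx ->
  prim_gen (row_cone A [set j]%SET : set 'rV[R]_n) (row j A).
Proof.
move=> uA; split; first exact: row_neq0.
move=> v; rewrite row_coneE //; split=> [H|[m ->] k].
  have := (H j).1; rewrite crd_toR mxE ler0z; case e : (_ 0 j) => [m|//] _; exists m.
  rewrite -[LHS](mulmxKV uA) mulmx_sum_row (bigD1 j) //= big1 ?addr0 => [|k nk].
    by rewrite e -scaler_nat natz.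
  have := (H k).2; rewrite inE nk => /(_ isT); rewrite crd_toR mxE => /eqP.
  by rewrite intr_eq0 => /eqP ->; rewrite scale0r.
have -> : toR R (row j A *+ m) = m%:R *: toR R (row j A).
  by rewrite scaler_nat /toR raddfMn.
rewrite /crd -scalemxAl -/(crd _ _) crd_row // !mxE eqxx /= inE.
case: (k == j); rewrite ?mulr1 ?mulr0; split=> //; exact: ler0n.
Qed.

End LatticeCones.

Section FanCharts.
Variables (R : realType) (n : nat) (Delta : set (set 'rV[R]_n)).
Hypotheses (fan_Delta : is_fan Delta) (smooth_X : is_smooth Delta).
Local Notation C := R[i].
Local Notation toric := (toric Delta).
Local Notation torus := (torus R n).
Implicit Types (A B : 'M[int]_n) (J K : {set 'I_n}) (m : 'rV[int]_n) (x : toric) (t : torus).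

Lemma fan_chart s : Delta s -> exists A J, is_chart Delta A J /\ s = row_cone A J.
Proof.
move=> Ds; have [A [J [uA es]]] := smooth_X Ds.
by exists A, J; split=> //; split=> //; rewrite -es.
Qed.

Lemma chart_sub A J J' : is_chart Delta A J -> J' \subset J -> is_chart Delta A J'.
Proof.
move=> [uA DA] sJ; split=> //; have [_ _ _ faceD _] := fan_Delta.
by apply: faceD DA _; exact: face_row_cone.
Qed.

(** With no generators, every basis A describes the same cone, the origin, which is a face of any
    cone of the fan. *)
Lemma chart_zero A : A \in unitmx -> is_chart Delta A finset.set0.
Proof.
move=> uA; split=> //; have [_ [s Ds] _ _ _] := fan_Delta.
have [B [K [cB _]]] := fan_chart Ds.
have [uB DB] := chart_sub cB (finset.sub0set _).
by rewrite row_cone_set0 // in DB *; rewrite row_cone_set0.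
Qed.

Lemma chart1 : is_chart Delta 1%:M finset.set0.
Proof. by apply: chart_zero; rewrite unitmx1. Qed.

(** A cone of dimension 1 in the fan has exactly one generator: two rows of an invertible matrix do
    not fit in one line, and without generators the cone is a point. That row is then the primitive
    generator. *)
Lemma ray_gensP e : ray_gens Delta e <->
  exists A J j, [/\ is_chart Delta A J, j \in J & e = row j A].
Proof.
split=> [[a [Da [x [D [rD ax axD aD]]]] pe]|[A [J [j [cA jJ ->]]]]].
  have [A [J [[uA DA] ea]]] := fan_chart Da.
  have memD v : a v -> (v <= D)%MS.
    move=> av; have h0 : a 0 by rewrite ea; exact: row_cone0.
    have -> : v = (v - x) - (0 - x) by rewrite opprB addrA subrK subr0.
    apply: addmx_sub; first exact: aD.
    by rewrite eqmx_opp; exact: aD.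
  have cJ : #|J| = 1%N.
    apply/eqP; rewrite eqn_leq; apply/andP; split.
      rewrite leqNgt; apply/negP => /card_gt1P [j [k [jJ kJ njk]]].
      have hj : (toR R (row j A) <= D)%MS by apply: memD; rewrite ea; exact: row_cone_row.
      have hk : (toR R (row k A) <= D)%MS by apply: memD; rewrite ea; exact: row_cone_row.
      have [cj ej] := submxP hj; have [ck ek] := submxP hk.
      have eqD (c : 'M[R]_1) : c *m D = c 0 0 *: D.
        by rewrite {1}[c]mx11_scalar mul_scalar_mx.
      have := congr1 (crd A) ej; have := congr1 (crd A) ek.
      rewrite !crd_row // !eqD /crd -!scalemxAl => ek' ej'.
      have f1 := congr1 (fun u : 'rV[R]_n => u 0 j) ej'.
      have f2 := congr1 (fun u : 'rV[R]_n => u 0 j) ek'.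
      have f3 := congr1 (fun u : 'rV[R]_n => u 0 k) ek'.
      have f4 := congr1 (fun u : 'rV[R]_n => u 0 k) ej'.
      rewrite !mxE !eqxx /= (negPf njk) eq_sym ?(negPf njk) /= in f1 f2 f3 f4.
      move/eqP: f2; rewrite eq_sym mulf_eq0 => /orP[/eqP h|/eqP h].
        by move/eqP: f3; rewrite h mul0r oner_eq0.
      by move/eqP: f1; rewrite h mulr0 oner_eq0.
    rewrite card_gt0; apply/negP => /eqP J0.
    rewrite J0 row_cone_set0 // in ea; have := axD 0; have := ax.
    rewrite ea /= => -> ; rewrite add0r => r0.
    by have := rD; rewrite /row_free (_ : D = 0) ?mxrank0 //; apply/row_matrixP => i; rewrite ord1 r0 row0.
  have /cards1P [j eJ] : #|J| == 1%N by rewrite cJ.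
  exists A, J, j; split=> //; first by rewrite eJ inE.
  apply: (prim_gen_uniq pe); rewrite ea eJ; exact: prim_gen_row.
have [uA DA] : is_chart Delta A [set j]%SET by apply: chart_sub cA _; rewrite finset.sub1set.
exists (row_cone A [set j]%SET); last exact: prim_gen_row.
split=> //; exists 0, (toR R (row j A)); split.
- rewrite /row_free eqn_leq rank_leq_row /= lt0n mxrank_eq0.
  by apply: contra_neq (row_neq0 j uA) => e0; apply: (@toR_inj R); rewrite e0 /toR map_mx0.
- exact: row_cone0.
- by move=> i; rewrite add0r row_id; apply: row_cone_row => //; rewrite inE.
move=> y /(row_coneE _ _ uA) H; rewrite subr0 (crd_sum y uA) (bigD1 j) //= big1 ?addr0.
  exact: scalemx_sub.
by move=> k nk; rewrite (H k).2 ?scale0r // inE.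
Qed.

Lemma ray_gens_finite : finite_set (ray_gens Delta).
Proof.
have [finD _ _ _ _] := fan_Delta.
have : finite_set ((fun a => xget 0 [set e | prim_gen a e]) @` rays Delta).
  apply: finite_image; apply: sub_finite_set finD => a [] //.
apply: sub_finite_set => e [a ra pe]; exists a => //.
by apply: (prim_gen_uniq _ pe); case: xgetP => [e' _ //|/(_ e)]; case.
Qed.

Lemma ray_gens_in A J j : is_chart Delta A J -> j \in J -> ray_gens Delta (row j A).
Proof. by move=> cA jJ; apply/ray_gensP; exists A, J, j. Qed.

(** By the intersection axiom a cone of the fan contained in another one is a face of it, and the
    faces of a smooth cone are generated by subsets of its generators. *)
Lemma point_cone x A J : is_chart Delta A J -> affine_open (row_cone A J) x ->
  exists2 J' : {set 'I_n}, J' \subset J & (sval x).1 = row_cone A J'.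
Proof.
move=> [uA DA] xU; have [Dx _ _ _] := svalP x; have [_ _ _ _ meet] := fan_Delta.
apply: (face_row_coneE uA); have [_] := meet _ _ Dx DA.
by rewrite setIidl.
Qed.

Lemma point_chart x : exists A J, [/\ is_chart Delta A J, (sval x).1 = row_cone A J &
  affine_open (row_cone A J) x].
Proof.
have [Dx _ _ _] := svalP x; have [A [J [cA e]]] := fan_chart Dx.
by exists A, J; split=> //; rewrite /affine_open /= e.
Qed.

Lemma perpN s m : perp s m -> @perp R n s (- m).
Proof. by move=> H y /H e; rewrite /toR raddfN dotNl; move: e; rewrite /toR => ->; rewrite oppr0. Qed.

Lemma perpD s m m' : perp s m -> perp s m' -> @perp R n s (m + m').
Proof. by move=> H H' y sy; rewrite toRD dotDl H // H' // addr0. Qed.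

Lemma point_neq0 x m : ((sval x).2 m != 0) <-> perp (sval x).1 m.
Proof.
have [Dx x0 xM xn] := svalP x; split=> [nz|p].
  by apply: contrapT => /xn e; rewrite e eqxx in nz.
apply/eqP => e; have := xM m (- m) p (perpN p).
by rewrite subrr x0 e mul0r => /eqP; rewrite oner_eq0.
Qed.

Lemma point_exp x m (k : int) : perp (sval x).1 m -> (sval x).2 (k *: m) = (sval x).2 m ^ k.
Proof.
have [Dx x0 xM xn] := svalP x => p.
have E (m' : 'rV[int]_n) (j : nat) : perp (sval x).1 m' ->
    perp (sval x).1 (m' *+ j) /\ (sval x).2 (m' *+ j) = (sval x).2 m' ^+ j.
  move=> p'; elim: j => [|j [IH1 IH2]].
    rewrite mulr0n expr0; split=> // y _; by rewrite /toR raddf0 dot0l.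
  by rewrite mulrS exprS xM // IH2; split=> //; exact: perpD.
case: k => k; first by rewrite -{1}[Posz k]natz scaler_nat (E _ _ p).2.
rewrite NegzE -exprnN scaleNr -[Posz k.+1]natz scaler_nat.
have [p1 e1] := E m k.+1 p; apply: (mulfI (x := (sval x).2 (m *+ k.+1))).
  exact/point_neq0.
by rewrite -xM //; [rewrite subrr x0 e1 divff // -e1; exact/point_neq0|exact: perpN].
Qed.

Lemma point_sum x (I : Type) (r : seq I) (P : pred I) (F : I -> 'rV[int]_n) :
  (forall i, P i -> perp (sval x).1 (F i)) ->
  (sval x).2 (\sum_(i <- r | P i) F i) = \prod_(i <- r | P i) (sval x).2 (F i).
Proof.
have [Dx x0 xM xn] := svalP x => p.
suff [_ ->//] : perp (sval x).1 (\sum_(i <- r | P i) F i) /\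
  (sval x).2 (\sum_(i <- r | P i) F i) = \prod_(i <- r | P i) (sval x).2 (F i).
elim/big_rec2: _ => [|i a b Pi [IH1 IH2]].
  by rewrite x0; split=> // y _; rewrite /toR raddf0 dot0l.
have pi := p _ Pi; rewrite xM // IH2; split=> //; exact: perpD.
Qed.

Lemma chart_coordE A x j : chart_coord A x 0 j = (sval x).2 (dualb A j).
Proof. by rewrite mxE. Qed.

Lemma perp_dualb A J j : A \in unitmx ->
  perp (row_cone A J : set 'rV[R]_n) (dualb A j) <-> j \notin J.
Proof.
move=> uA; rewrite perp_row_cone //; split=> [H|jJ k kJ].
  by apply/negP => /H; rewrite ip_dualb1 // eqxx.
by rewrite ip_dualb1 //; case: eqVneq kJ jJ => // -> ->.
Qed.

Lemma coord_neq0 A J' x j : A \in unitmx -> (sval x).1 = row_cone A J' ->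
  (chart_coord A x 0 j != 0) = (j \notin J').
Proof.
move=> uA e; rewrite chart_coordE; apply/idP/idP.
  by move/point_neq0; rewrite e => /(perp_dualb _ _ uA).
by move=> jJ; apply/point_neq0; rewrite e; exact/(perp_dualb _ _ uA).
Qed.

Lemma coord_dom A J x : is_chart Delta A J -> affine_open (row_cone A J) x ->
  chart_dom J (chart_coord A x).
Proof.
move=> cA xU j jJ; have [J' sJ e] := point_cone cA xU.
rewrite (coord_neq0 _ _ e); last by case: cA.
by apply: contra jJ; exact: (fintype.subsetP sJ).
Qed.

(** The coordinates that vanish at x are those with index in J'; there the exponent is 0 because m
    is orthogonal to the cone of x, and 0^0 = 1. *)
Lemma point_coord A J x m : is_chart Delta A J -> affine_open (row_cone A J) x ->
  perp (sval x).1 m ->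
  (sval x).2 m = \prod_j (chart_coord A x 0 j) ^ (ip m (row j A)).
Proof.
move=> cA xU p; have [J' sJ e] := point_cone cA xU; have [uA _] := cA.
rewrite {1}(dualb_sum m uA).
have pJ j : j \in J' -> ip m (row j A) = 0.
  by move: p; rewrite e => /(perp_row_cone _ _ _ uA); apply.
have pd j : j \notin J' -> perp (sval x).1 (dualb A j).
  by rewrite e => /(perp_dualb _ _ uA).
rewrite point_sum => [|j _]; last first.
  have [/pJ ->|/pd h] := boolP (j \in J').
    by rewrite scale0r => y _; rewrite /toR raddf0 dot0l.
  move=> y xy; rewrite (_ : toR R _ = (ip m (row j A))%:~R *: toR R (dualb A j)).
    by rewrite dotZl h // mulr0.
  by apply/rowP => i; rewrite !mxE rmorphM.
apply: eq_bigr => j _; have [/pJ ->|/pd h] := boolP (j \in J').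
  by rewrite scale0r expr0z; case: (svalP x).
by rewrite point_exp // chart_coordE.
Qed.

(** If the j-th coordinate vanishes at x, then row j of A lies in the cone of x, hence in the cone
    of the second chart, where its coordinates are nonnegative. *)
Lemma exp_ge0_at_zero A J B K x j k : is_chart Delta A J -> is_chart Delta B K ->
  affine_open (row_cone A J) x -> affine_open (row_cone B K) x ->
  chart_coord A x 0 j = 0 -> 0 <= (A *m invmx B) j k.
Proof.
move=> cA cB xA xB e0; have [J' sJ e] := point_cone cA xA.
have [uA _] := cA; have [uB _] := cB.
have jJ' : j \in J' by apply: contraTT (erefl true) => h; rewrite -(coord_neq0 _ uA e) e0 eqxx in h.
have : row_cone B K (toR R (row j A)) by apply: xB; rewrite e; exact: row_cone_row.
move/(row_coneE _ _ uB)/(_ k) => -[+ _].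
by rewrite crdE dot_toR ler0z ip_dualb.
Qed.

(** If [dualb B k] is not orthogonal to the cone of x, both sides are 0: on the right, some
    vanishing coordinate occurs with a nonzero exponent. *)
Lemma coord_transition A J B K x : is_chart Delta A J -> is_chart Delta B K ->
  affine_open (row_cone A J) x -> affine_open (row_cone B K) x ->
  chart_coord B x = transition A B (chart_coord A x).
Proof.
move=> cA cB xA xB; apply/rowP => k; rewrite [RHS]mxE chart_coordE.
have [uA _] := cA; have [J' sJ e] := point_cone cA xA.
have [p|np] := pselect (perp (sval x).1 (dualb B k)).
  by rewrite (point_coord cA xA p); apply: eq_bigr => j _; rewrite ip_dualb.
have [_ _ _ xn] := svalP x; rewrite xn //.
have [j jJ' nz] : exists2 j, j \in J' & ip (dualb B k) (row j A) != 0.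
  apply: contrapT => H; apply: np; rewrite e; apply/(perp_row_cone _ _ _ uA) => j jJ'.
  by apply/eqP/negP => /negP h; apply: H; exists j.
rewrite (bigD1 j) //= -ip_dualb (_ : chart_coord A x 0 j = 0).
  by rewrite exp0rz (negPf nz) mul0r.
by apply/eqP; apply: contraTT jJ' => h; rewrite -(coord_neq0 _ uA e).
Qed.

Lemma torus_point_subproof t :
  is_point Delta (row_cone 1%:M finset.set0, fun m => character m t).
Proof.
split=> /=; first by case: chart1.
- exact: character0.
- by move=> m m' _ _; exact: characterD.
- move=> m []; rewrite row_cone_set0 ?unitmx1 // => y ->; exact: dot0r.
Qed.

Definition torus_point t : toric := exist _ _ (torus_point_subproof t).

Lemma torus_point_open t A J : is_chart Delta A J -> affine_open (row_cone A J) (torus_point t).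
Proof.
move=> [uA _]; rewrite /affine_open /= row_cone_set0 ?unitmx1 // => y ->.
exact: row_cone0.
Qed.

Definition tcoord A t : torus := mkt (fun j => character (dualb A j) t).

Lemma tcoordE A t j : val (tcoord A t) 0 j = character (dualb A j) t.
Proof. by rewrite mktE // character_neq0. Qed.

Lemma torus_point_coord A t : chart_coord A (torus_point t) = val (tcoord A t).
Proof. by apply/rowP => j; rewrite tcoordE chart_coordE. Qed.

Lemma torus_point_coord1 t : chart_coord 1%:M (torus_point t) = val t.
Proof.
apply/rowP => j; rewrite chart_coordE /= /character (bigD1 j) //= big1 => [|k nk].
  by rewrite !mxE invmx1 mxE eqxx expr1z mulr1.
by rewrite !mxE invmx1 mxE (negPf nk) expr0z.
Qed.

End FanCharts.

(** * The topology of X in the charts, and finite covers *)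

Section ChartTopology.
Variables (R : realType) (n : nat) (Delta : set (set 'rV[R]_n)).
Hypotheses (fan_Delta : is_fan Delta) (smooth_X : is_smooth Delta).
Local Notation C := R[i].
Local Notation toric := (toric Delta).
Local Notation torus := (torus R n).
Implicit Types (A B : 'M[int]_n) (J K : {set 'I_n}) (m : 'rV[int]_n) (x : toric) (t : torus).

Definition chart_ball A J (z : 'rV[C]_n) (d : R) : set toric :=
  [set y | affine_open (row_cone A J) y /\
     forall j, cabs (chart_coord A y 0 j - z 0 j) < d].

(** The shape that a coordinate ball takes in another affine open set, where the coordinates become
    fractions with a power of one monomial as denominator. *)
Lemma open_ratio_ball (I : finType) (a : I -> 'rV[int]_n) m (N : nat) (z : I -> C) (d : R) :
  open [set g : {ptws 'rV[int]_n -> C^o} | g m != 0 /\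
    forall j, cabs (g (a j) / (g m) ^+ N - z j) < d].
Proof.
rewrite openE => g [gm gd].
have ev (k : 'rV[int]_n) : (fun f : {ptws 'rV[int]_n -> C^o} => f k : C^o) @ nbhs g --> (g k : C^o).
  exact: (@proj_continuous _ (fun _ => C^o) k g).
have r j : (fun f : {ptws 'rV[int]_n -> C^o} => (f (a j) / (f m) ^+ N : C^o)) @ nbhs g -->
    (g (a j) / (g m) ^+ N : C^o).
  apply: cvgM; first exact: ev.
  apply: cvgV; first by rewrite expf_neq0.
  elim: (N) => [|N' IH].
    rewrite (_ : (fun _ => _) = (fun=> 1)); first exact: cvg_cst.
    by apply/funext => f; rewrite expr0.
  rewrite (_ : (fun _ => _) = (fun f : {ptws 'rV[int]_n -> C^o} => f m * (f m) ^+ N')).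
    by rewrite exprS; apply: cvgM; [exact: ev|exact: IH].
  by apply/funext => f; rewrite exprS.
have h1 : \forall f \near g, f m != 0.
  have /cvgrPdist_lt/(_ `|g m|) := ev m; rewrite normr_gt0 => /(_ gm).
  apply: filterS => f; apply: contraTneq => ->.
  by rewrite subr0 ltxx.
have h2 : \forall f \near g, forall j, cabs (f (a j) / (f m) ^+ N - z j) < d.
  suff h j : nbhs g [set f | cabs (f (a j) / (f m) ^+ N - z j) < d] by exact: (@filter_forall _ I _ _ (nbhs_filter g) h).
  pose e := d - cabs (g (a j) / (g m) ^+ N - z j).
  have e0 : 0 < (e%:C)%C :> C by rewrite ltcR subr_gt0.
  have /cvgrPdist_lt/(_ _ e0) := r j; apply: filterS => f.
  rewrite normC_cabs ltcR /e -cabsN opprB => h.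
  rewrite /= -(subrK (g (a j) / g m ^+ N) (f (a j) / f m ^+ N)) -addrA.
  by apply: (le_lt_trans (ler_cabsD _ _)); rewrite -ltrBrDr.
by near=> f; split; [near: f; exact: h1|near: f; exact: h2].
Unshelve. all: by end_near.
Qed.

(* Near the face [row_cone B K'] common to both cones, [m] is invertible and a
   multiple of it clears the denominators of the coordinates of the chart [A]. *)
Lemma chart_ball_open A J z d : is_chart Delta A J -> open (chart_ball A J z d).
Proof.
move=> cA; have [uA DA] := cA; move=> s Ds.
have [B [K [cB es]]] := fan_chart smooth_X Ds; have [uB DB] := cB.
have [_ _ _ _ meet] := fan_Delta.
have [f1 _] := meet _ _ Ds DA.
have [K' sK eT] : exists2 K' : {set 'I_n}, K' \subset K & s `&` row_cone A J = row_cone B K'.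
  by apply: (face_row_coneE uB); rewrite -es.
pose m := \sum_(k in K :\: K') dualb B k.
pose N := (\sum_j \sum_k `|ip (dualb A j) (row k B)|)%N.
have ipm k : ip m (row k B) = (k \in K :\: K')%:Z.
  rewrite /m ip_suml (eq_bigr (fun i => (k == i)%:Z)) => [|i _]; last exact: ip_dualb1.
  rewrite big_mkcond (bigD1 k) //= eqxx big1 ?addr0 => [|i nk]; first by case: ifP.
  by rewrite eq_sym (negPf nk) if_same.
have dm : dual_cone s m.
  by rewrite es; apply/dual_row_cone => // k kK; rewrite ipm; case: (_ \in _).
have dj j : dual_cone s (dualb A j + m *+ N).
  rewrite es; apply/dual_row_cone => // k kK; rewrite ipDl ipMn ipm inE kK andbT.
  have [kK'|kK'] := boolP (k \in K').
    have : row_cone B K' (toR R (row k B)) by exact: row_cone_row.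
    rewrite -eT => -[_ /(row_coneE _ _ uA)/(_ j) [+ _]].
    by rewrite crdE dot_toR ler0z mul0rn addr0.
  rewrite /= natz; have : (`|ip (dualb A j) (row k B)| <= N)%N.
    by rewrite /N (bigD1 j) //= (bigD1 k) //= -addnA leq_addr.
  by lia.
exists [set g : {ptws 'rV[int]_n -> C^o} | g m != 0 /\
    forall j, cabs (g (dualb A j + m *+ N) / (g m) ^+ N - z 0 j) < d].
  exact: open_ratio_ball.
have restrE x m' : dual_cone s m' -> restr s x m' = (sval x).2 m'.
  by move=> dm'; rewrite /restr; case: asboolP.
(* A point of U_s lies in the second chart exactly when its cone lies in the common face; m is
   nonnegative on s and vanishes exactly on that face. *)
have key x : affine_open s x -> affine_open (row_cone A J) x <-> perp (sval x).1 m.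
  move=> xs; split=> [xA y xy|pm y xy].
    have : row_cone B K' y by rewrite -eT; split; [exact: xs|exact: xA].
    move/(row_coneE _ _ uB) => H; rewrite (crd_sum y uB) dot_sumr big1 // => k _.
    rewrite dotZr dot_toR ipm inE; have [kK'|kK'] := boolP (k \in K'); first by rewrite mulr0.
    by rewrite (H k).2 // mul0r.
  suff : (s `&` row_cone A J) y by case.
  rewrite eT; have : s y by exact: xs.
  rewrite es => /(row_coneE _ _ uB) H; have := pm y xy.
  have -> : dot (toR R m) y = \sum_(k in K :\: K') crd B y 0 k.
    rewrite /m {1}/toR raddf_sum dot_suml; apply: eq_bigr => k _.
    by rewrite crdE.
  move/eqP; rewrite psumr_eq0 => [/allP e|k _]; last by case: (H k).
  apply/(row_coneE _ _ uB) => k; split=> [|kK']; first by case: (H k).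
  have [kK|kK] := boolP (k \in K); last by rewrite (H k).2.
  by have := e k (mem_index_enum _); rewrite inE kK' kK /= => /eqP.
have val x j : perp (sval x).1 m ->
    (sval x).2 (dualb A j + m *+ N) / (sval x).2 m ^+ N = chart_coord A x 0 j.
  move=> pm; rewrite chart_coordE; have [_ _ xM xn] := svalP x.
  have nz : (sval x).2 m ^+ N != 0 by rewrite expf_neq0 //; exact/point_neq0.
  have pN : perp (sval x).1 (m *+ N).
    by move=> y xy; rewrite /toR raddfMn -scaler_nat dotZl pm // mulr0.
  have eN : (sval x).2 (m *+ N) = (sval x).2 m ^+ N.
    by rewrite -scaler_nat natz point_exp.
  have [pd|npd] := pselect (perp (sval x).1 (dualb A j)).
    by rewrite xM // eN mulfK.
  rewrite (xn _ npd) xn ?mul0r // => H; apply: npd.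
  by rewrite -[dualb A j](addrK (m *+ N)); apply: perpD => //; exact: perpN.
apply/seteqP; split=> x /= [xs].
  move=> [xA xd]; split=> //; have pm := (key x xs).1 xA.
  rewrite restrE //; split; first exact/point_neq0.
  by move=> j; rewrite restrE // val.
rewrite restrE // => -[/point_neq0 pm xd]; split=> //; split; first exact/(key x xs).
by move=> j; have := xd j; rewrite restrE // val.
Qed.

Hypothesis compact_X : compact [set: toric].

(** Turns a property that holds locally with some constant into one with finitely many charts and
    constants. It serves to bound a field and, in [fan_complete], to bound the coordinates
    themselves. *)
Lemma compact_cover_charts (Q : 'M[int]_n -> {set 'I_n} -> R -> 'rV[C]_n -> Prop) :
  (forall A J z, is_chart Delta A J -> chart_dom J z -> exists M (d : R), 0 < d /\
     forall y : 'rV[C]_n, (forall j, cabs (y 0 j - z 0 j) < d) -> Q A J M y) ->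
  exists s : seq ('M[int]_n * {set 'I_n} * R),
    (forall q, q \in s -> is_chart Delta q.1.1 q.1.2) /\
    forall y : toric, exists2 q, q \in s & affine_open (row_cone q.1.1 q.1.2) y /\
      Q q.1.1 q.1.2 q.2 (chart_coord q.1.1 y).
Proof.
move=> H.
have /choice [c cP] : forall x : toric, exists c : 'M[int]_n * {set 'I_n} * R * R,
    [/\ is_chart Delta c.1.1.1 c.1.1.2, affine_open (row_cone c.1.1.1 c.1.1.2) x, 0 < c.2 &
     forall y : 'rV[C]_n, (forall j, cabs (y 0 j - chart_coord c.1.1.1 x 0 j) < c.2) ->
       Q c.1.1.1 c.1.1.2 c.1.2 y].
  move=> x; have [A [J [cA _ xU]]] := point_chart smooth_X x.
  have [M [d [d0 dP]]] := H A J _ cA (coord_dom fan_Delta cA xU).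
  by exists (A, J, M, d).
pose U x := chart_ball (c x).1.1.1 (c x).1.1.2 (chart_coord (c x).1.1.1 x) (c x).2.
(* The filter of finite lists, ordered by inclusion: near-covering compactness along it yields one
   list whose balls cover X. *)
pose F : set_system (seq toric) := [set V : set (seq toric) | exists s0 : seq toric, forall s : seq toric, {subset s0 <= s} -> V s].
have FF : Filter F.
  split=> [|V V' [s0 H0] [s1 H1]|V V' sV [s0 H0]].
  - by exists [::].
  - exists (s0 ++ s1) => s sub; split.
      by apply: H0 => x xs; apply: sub; rewrite mem_cat xs.
    by apply: H1 => x xs; apply: sub; rewrite mem_cat xs orbT.
  - by exists s0 => s sub; apply/sV/H0.
have /compact_near_coveringP nc := compact_X.
have [x _|s sP] := nc _ F (fun s y => exists2 x, x \in s & U x y) FF.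
  exists (U x, [set s : seq toric | x \in s]) => [|[y s] /= [Uy xs]]; last by exists x.
  split=> /=; last by exists [:: x] => s; apply; rewrite inE.
  apply: open_nbhs_nbhs; split; first by apply: chart_ball_open; case: (cP x).
  by have [_ xU d0 _] := cP x; split=> // j; rewrite subrr cabs0.
exists [seq (c x).1 | x <- s]; split=> [_ /mapP[x _ ->]|y].
  by case: (cP x).
have [x xD [yU yd]] := sP s (fun _ h => h) y I.
exists (c x).1; first by apply/mapP; exists x.
by split=> //; have [_ _ _] := cP x; apply.
Qed.

End ChartTopology.

(** * Monomials and changes of charts *)

Section MonomialDerivatives.
Variable R : realType.
Local Notation C := R[i].
Implicit Types (f g : C -> C) (p z : C).

Lemma cder_uniq f p c c' : cder f p c -> cder f p c' -> c = c'.
Proof. by move=> /cderP h /cderP h'; apply: (cvg_unique _ h h'). Qed.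

Lemma cderM f g p c d : cder f p c -> cder g p d ->
  cder (fun z => f z * g z) p (f p * d + g p * c).
Proof.
move=> /cder_is_derive hf /cder_is_derive hg; exact/cder_is_derive.
Qed.

Lemma cder_cst k p : cder (fun=> k) p 0.
Proof.
by move=> e e0; exists 1 => // z _; rewrite mul0r !subrr cabs0 mulr_ge0 ?cabs_ge0 // ltW.
Qed.

Lemma cder_shift (a : C) p : cder (fun z => a + z) p 1.
Proof.
move=> e e0; exists 1 => // z _; rewrite mul1r (_ : a + z - (a + p) - (z - p) = 0); last by ring.
by rewrite cabs0 mulr_ge0 ?cabs_ge0 // ltW.
Qed.

Lemma cderX f p c (n : nat) : cder f p c ->
  cder (fun z => f z ^+ n) p (n%:R * f p ^+ n.-1 * c).
Proof.
move=> hf; elim: n => [|n IH].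
  rewrite !mul0r (_ : (fun _ => _) = (fun=> 1)); first exact: cder_cst.
  by apply/funext => z; rewrite expr0.
rewrite (_ : (fun _ => _) = (fun z => f z * f z ^+ n)); last first.
  by apply/funext => z; rewrite exprS.
have := cderM hf IH; congr cder; rewrite -pred_Sn.
case: (n) => [|k] /=; first by rewrite !mul0r mulr0 add0r expr0 !mul1r.
by rewrite exprS -[in RHS]natr1; ring.
Qed.

(** The quotient rule provides some derivative; its value follows by differentiating the product of
    f and 1/f, which is 1 near p. *)
Lemma cderV f p c : f p != 0 -> cder f p c -> cder (fun z => (f z)^-1) p (- c / f p ^+ 2).
Proof.
move=> nz hf; have [d hd] : cdiff (fun z => (f z)^-1) p by apply: cdiffV => //; exists c.
suff -> : - c / f p ^+ 2 = d by [].
have [r r0 rP] : exists2 r : R, 0 < r & forall z, cabs (z - p) < r -> f z != 0.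
  have [r r0 rP] := cdiff_econt (ex_intro _ c hf) (ltac:(rewrite divr_gt0 ?cabs_gt0 //; exact nz) : 0 < cabs (f p) / 2).
  exists r => // z /rP le; rewrite -cabs_gt0.
  have e1 : cabs (f p - f z) = cabs (f z - f p) by rewrite -cabsN opprB.
  have := ler_cabsB (f p) (f z); rewrite e1.
  have := cabs_gt0 (f p); rewrite nz; lra.
have h1 : cder (fun z => f z * (f z)^-1) p 0.
  move=> e e0; exists r => // z /rP fz.
  by rewrite !divff // mul0r subr0 subrr cabs0 mulr_ge0 ?cabs_ge0 // ltW.
have e := cder_uniq (cderM hf hd) h1.
apply: (mulfI nz); have -> : f p * d = - ((f p)^-1 * c) by apply/eqP; rewrite -addr_eq0 e.
by field.
Qed.

Lemma cder_exprz f p c (e : int) : cder f p c -> (f p = 0 -> 0 <= e) ->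
  cder (fun z => f z ^ e) p (e%:~R * f p ^ (e - 1) * c).
Proof.
move=> hf; case: e => n pe.
  have := cderX n hf; case: n {pe} => [|n]; first by rewrite !mul0r.
  by rewrite -[n.+1.-1]/n (_ : n.+1%:Z - 1 = n%:Z) //; lia.
have nz : f p != 0 by apply/eqP => /pe; rewrite NegzE.
have := cderV (f := fun z => f z ^+ n.+1) (expf_neq0 n.+1 nz) (cderX n.+1 hf); congr cder.
have -> : Negz n - 1 = - (n.+2)%:Z by lia.
rewrite NegzE mulrNz -exprnN -pmulrn -exprM muln2 -addnn addSn exprS exprD -[n.+1.-1]/n !exprS.
field; rewrite nz expf_neq0 //.
Qed.

Lemma cdiff_exprz f p (e : int) : cdiff f p -> (f p = 0 -> 0 <= e) -> cdiff (fun z => f z ^ e) p.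
Proof. by move=> [c hf] pe; exists (e%:~R * f p ^ (e - 1) * c); exact: cder_exprz. Qed.

Lemma cdiff_prod (I : Type) (r : seq I) (P : pred I) (F : I -> C -> C) p :
  (forall i, P i -> cdiff (F i) p) -> cdiff (fun z => \prod_(i <- r | P i) F i z) p.
Proof.
move=> dF; elim: r => [|i r IH].
  by rewrite (_ : (fun _ => _) = (fun=> 1)); [exact: cdiff_cst|apply/funext => z; rewrite big_nil].
have [Pi|Pi] := boolP (P i); last first.
  by rewrite (_ : (fun _ => _) = (fun z => \prod_(i <- r | P i) F i z)) //; apply/funext => z;
    rewrite big_cons (negPf Pi).
rewrite (_ : (fun _ => _) = (fun z => F i z * \prod_(i <- r | P i) F i z)).
  by apply: cdiffM => //; exact: dF.
by apply/funext => z; rewrite big_cons Pi.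
Qed.

End MonomialDerivatives.

Section Monomials.
Variables (R : realType) (n : nat).
Local Notation C := R[i].
Local Notation torus := (torus R n).
Definition rdiff (f : 'rV[C]_n -> C) x := differentiable (f : 'rV[C]_n -> C^o) x.
Definition rdiffv (f : 'rV[C]_n -> 'rV[C]_n) x := differentiable f x.

Implicit Types (f g : 'rV[C]_n -> C) (z : 'rV[C]_n) (e : 'rV[int]_n) (A B G : 'M[int]_n).

Definition mono e z : C := \prod_j (z 0 j) ^ (e 0 j).

Lemma character_mono e (t : torus) : character e t = mono e (val t).
Proof. by []. Qed.

Lemma rdiff_cst (k : C) z : rdiff (fun=> k) z.
Proof. exact: differentiable_cst. Qed.

Lemma rdiffM f g z : rdiff f z -> rdiff g z -> rdiff (fun y => f y * g y) z.
Proof. by move=> df dg; apply: differentiableM. Qed.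

Lemma rdiff_exprz f z (k : int) :
  rdiff f z -> (f z = 0 -> 0 <= k) -> rdiff (fun y => f y ^ k) z.
Proof.
move=> df; have X m : rdiff (fun y => f y ^+ m) z.
  elim: m => [|m IH].
    rewrite (_ : (fun _ => _) = (fun=> 1)); first exact: rdiff_cst.
    by apply/funext => y; rewrite expr0.
  rewrite (_ : (fun _ => _) = (fun y => f y * f y ^+ m)); first exact: rdiffM.
  by apply/funext => y; rewrite exprS.
case: k => m pe; first exact: X.
have nz : f z != 0 by apply/eqP => /pe; rewrite NegzE.
by apply: (differentiableV (X m.+1)); rewrite expf_neq0.
Qed.

Lemma rdiff_mono e z : (forall j, z 0 j = 0 -> 0 <= e 0 j) -> rdiff (mono e) z.
Proof.
move=> pe; rewrite /mono; elim: (index_enum _) => [|j s IH].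
  rewrite (_ : (fun _ => _) = (fun=> 1)); first exact: rdiff_cst.
  by apply/funext => y; rewrite big_nil.
rewrite (_ : (fun _ => _) = (fun y : 'rV[C]_n => y 0 j ^ e 0 j * \prod_(j <- s) (y 0 j) ^ (e 0 j))).
  apply: rdiffM => //; apply: rdiff_exprz; last exact: pe.
  exact: (@differentiable_coord C 1 n z 0 j).
by apply/funext => y; rewrite big_cons.
Qed.

Lemma cdiff_mono e (f : C -> 'rV[C]_n) p : (forall j, cdiff (fun w => f w 0 j) p) ->
  (forall j, f p 0 j = 0 -> 0 <= e 0 j) -> cdiff (fun w => mono e (f w)) p.
Proof. by move=> df pe; apply: cdiff_prod => j _; apply: cdiff_exprz => //; exact: pe. Qed.

(** Restriction to a complex line: the passage from differentiability in several variables to the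
    one-variable theory. *)
Lemma rdiff_cdiff f (a v : 'rV[C]_n) (w0 : C) :
  rdiff f (a + w0 *: v) -> cdiff (fun w => f (a + w *: v)) w0.
Proof.
move=> /(@diff_derivable _ _ _ _ _ v) /cvg_ex [c hc]; exists c; apply/cderP; move: hc.
rewrite (_ : (fun h : C => h^-1 *: _) =
  (fun h : C^o => h^-1 *: (f (a + (h *: (1 : C^o) + w0) *: v) - f (a + w0 *: v)))) //.
apply/funext => h /=; congr (_ *: (f _ - _)).
by rewrite [h *: 1]mulr1 scalerDl addrCA.
Qed.

Lemma mono_partial e z j : (forall i, z 0 i = 0 -> 0 <= e 0 i) ->
  'D_(delta_mx 0 j) (mono e : 'rV[C]_n -> C^o) z =
  (e 0 j)%:~R * z 0 j ^ (e 0 j - 1) * \prod_(i | i != j) z 0 i ^ e 0 i.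
Proof.
move=> pe; pose P := \prod_(i | i != j) z 0 i ^ e 0 i.
have gE w : mono e (w *: delta_mx 0 j + z) = (z 0 j + w) ^ e 0 j * P.
  rewrite /mono (bigD1 j) //= !mxE !eqxx mulr1 addrC; congr (_ * _).
  apply: eq_bigr => i ni; rewrite !mxE (negPf ni) andbF mulr0 add0r //.
have h : cder (fun w => (z 0 j + w) ^ e 0 j * P) 0 ((e 0 j)%:~R * z 0 j ^ (e 0 j - 1) * P).
  have h1 : cder (fun w => (z 0 j + w) ^ e 0 j) 0 ((e 0 j)%:~R * (z 0 j + 0) ^ (e 0 j - 1) * 1).
    by apply: cder_exprz; [exact: cder_shift|rewrite addr0; exact: pe].
  have := cderM h1 (cder_cst P 0); congr cder.
  by rewrite !addr0 mulr0 add0r mulr1 mulrC.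
apply/cvg_lim => //; move/cderP: h.
set F1 := fun h : C^o => _; set F2 := fun h : C => _; suff -> : F2 = F1 by [].
have g0 : mono e z = (z 0 j + 0) ^ e 0 j * P by rewrite -gE scale0r add0r.
by apply/funext => w; rewrite /F1 /F2 /= gE g0 [w *: 1]mulr1 [w + 0]addr0.
Qed.

Definition expcol A B k : 'rV[int]_n := (col k (A *m invmx B))^T.

Lemma expcolE A B k j : expcol A B k 0 j = (A *m invmx B) j k.
Proof. by rewrite [LHS]mxE [LHS]mxE. Qed.

Lemma transitionE A B z k : transition A B z 0 k = mono (expcol A B k) z.
Proof. by rewrite mxE; apply: eq_bigr => j _; rewrite expcolE. Qed.

Lemma rdiff_rV (f : 'rV[C]_n -> 'rV[C]_n) z :
  (forall k, rdiff (fun y => f y 0 k) z) -> rdiffv f z.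
Proof.
move=> df; rewrite /rdiffv (_ : f = \sum_(k < n) (fun y => f y 0 k *: (delta_mx 0 k : 'rV[C]_n))).
  by apply: differentiable_sum => k; apply: differentiableZl; exact: df.
by apply/funext => y; rewrite fct_sumE {1}(row_sum_delta (f y)).
Qed.

Lemma derive_coord (F : 'rV[C]_n -> 'rV[C]_n) z (v : 'rV[C]_n) k : derivable F z v ->
  ('D_v F z) 0 k = 'D_v ((fun y => F y 0 k) : 'rV[C]_n -> C^o) z.
Proof.
move=> dF; apply/esym/cvg_lim => //.
have := @cvg_comp _ _ _ _ (fun M : 'rV[C]_n => M 0 k : C^o) _ _ _ dF (@coord_continuous C 1 n 0 k _).
rewrite -fmap_comp.
set f1 := (X in X @ _ `=>` _ -> _); set f2 := (X in _ -> X @ _ --> _).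
suff -> : f1 = f2 by [].
by apply/funext => h; rewrite /f1 /f2 /= !mxE.
Qed.

Lemma jacobian_transition A B z j k :
  (forall j, z 0 j = 0 -> forall k, 0 <= (A *m invmx B) j k) ->
  'J (transition A B) z j k = ((A *m invmx B) j k)%:~R * z 0 j ^ ((A *m invmx B) j k - 1) *
    \prod_(i | i != j) z 0 i ^ (A *m invmx B) i k.
Proof.
move=> pe.
have pe' k' i : z 0 i = 0 -> 0 <= expcol A B k' 0 i by rewrite expcolE => h; exact: pe.
have dF : rdiffv (transition A B) z.
  apply: rdiff_rV => k'.
  rewrite (_ : (fun _ => _) = mono (expcol A B k')); first by apply: rdiff_mono; exact: pe'.
  by apply/funext => y; rewrite transitionE.
have -> : 'J (transition A B) z j k = ((delta_mx 0 j : 'rV[C]_n) *m 'J (transition A B) z) 0 k.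
  by rewrite -rowE [RHS]mxE.
rewrite -(deriveEjacobian _ dF).
rewrite derive_coord; last exact: diff_derivable.
rewrite (_ : (fun _ => _) = (mono (expcol A B k) : 'rV[C]_n -> C^o)); last first.
  by apply/funext => y; rewrite transitionE.
rewrite mono_partial //; first by rewrite expcolE; congr (_ * _); apply: eq_bigr => i _; rewrite expcolE.
exact: pe'.
Qed.

End Monomials.

Lemma differentiable_near (K : numFieldType) n (f : 'rV[K]_n -> K^o) z : differentiable f z ->
  exists2 e : K, 0 < e & forall y : 'rV[K]_n, (forall j, `|y 0 j - z 0 j| < e) -> `|f y - f z| < 1.
Proof.
move=> /differentiable_continuous cf.
have := cf _ (nbhsx_ballx (f z : K^o) 1 ltr01).
rewrite /fmap /= => /(nbhs_ballP z) [e /= e0 he].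
exists e => // y hy.
have : ball (f z : K^o) 1 (f y).
  apply: he; split=> // i0 j; rewrite (ord1 i0) /ball /= -normrN opprB; exact: hy.
by rewrite /ball /= -normrN opprB.
Qed.

(** * Monomial maps of the torus and their Jacobians *)

Section TorusMaps.
Variables (R : realType) (n : nat).
Local Notation C := R[i].
Local Notation torus := (torus R n).
Implicit Types (A B G : 'M[int]_n) (z t : torus) (m : 'rV[int]_n) (u : ext C n).

Definition Cmx A : 'M[C]_n := map_mx intr A.

Lemma CmxM A B : Cmx (A *m B) = Cmx A *m Cmx B.
Proof. exact: map_mxM. Qed.

Lemma Cmx1 : Cmx 1%:M = 1%:M.
Proof. exact: map_mx1. Qed.

Lemma Cmx_unit A : A \in unitmx -> Cmx A \in unitmx.
Proof.
by move=> uA; have /mulmx1_unit[] : Cmx A *m Cmx (invmx A) = 1%:M by rewrite -CmxM mulmxV ?Cmx1.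
Qed.

Lemma Cmx_inv A : A \in unitmx -> invmx (Cmx A) = Cmx (invmx A).
Proof.
move=> uA; rewrite -[LHS]mulmx1 -Cmx1 -(mulmxV uA) CmxM mulmxA mulVmx ?mul1mx //.
exact: Cmx_unit.
Qed.

Lemma characterZ (k : int) m t : character (k *: m) t = character m t ^ k.
Proof.
rewrite /character; apply: (big_ind2 (fun a b => a = b ^ k)).
- by rewrite exp1rz.
- by move=> _ b _ b' -> ->; rewrite expfzMl.
- by move=> j _; rewrite mxE mulrC exprz_exp.
Qed.

Lemma character_sumexp (I : Type) (r : seq I) (P : pred I) (F : I -> 'rV[int]_n) t :
  character (\sum_(i <- r | P i) F i) t = \prod_(i <- r | P i) character (F i) t.
Proof.
apply: (big_morph (fun m => character m t)); last exact: character0.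
by move=> a b; exact: characterD.
Qed.

Definition tmap G z : torus := mkt (fun k => character (col k G)^T z).

Lemma tmapE G z k : val (tmap G z) 0 k = character (col k G)^T z.
Proof. by rewrite mktE // character_neq0. Qed.

Lemma character_tmap m G z : character m (tmap G z) = character (m *m G^T) z.
Proof.
rewrite (mulmx_sum_row m) character_sumexp; apply: eq_bigr => k _.
by rewrite characterZ tmapE tr_col.
Qed.

Lemma tmap_tmap G G' z : tmap G' (tmap G z) = tmap (G *m G') z.
Proof.
apply: torus_ext => k; rewrite !tmapE character_tmap; congr character.
by rewrite -trmx_mul !colE mulmxA.
Qed.

Lemma tmap1 z : tmap 1%:M z = z.
Proof.
apply: torus_ext => k; rewrite tmapE /character (bigD1 k) //= !mxE eqxx expr1z big1 ?mulr1 // => j nj.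
by rewrite !mxE (negPf nj).
Qed.

Lemma tcoord_tmap A z : tcoord A z = tmap (invmx A) z.
Proof. by []. Qed.

Lemma transition_tmap A B z : transition A B (val z) = val (tmap (A *m invmx B) z).
Proof. by apply/rowP => k; rewrite transitionE tmapE -character_mono. Qed.

Lemma tmapK A z : A \in unitmx -> tcoord A (tmap A z) = z.
Proof. by move=> uA; rewrite tcoord_tmap tmap_tmap mulmxV // tmap1. Qed.

Lemma rhoK t : cancel (fun u => rho u t) (fun u => rho u (tinv t)).
Proof.
move=> u; apply/ffunP => T; rewrite !rhoE mulrA -characterM tmulC.
by rewrite (_ : tmul t (tinv t) = tone R n) ?character1 ?mul1r //; apply: torus_ext => j;
  rewrite tmulE tinvE toneE divff // torus_neq0.
Qed.

Lemma rhoVK t : cancel (fun u => rho u (tinv t)) (fun u => rho u t).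
Proof.
move=> u; apply/ffunP => T; rewrite !rhoE mulrA -characterM.
by rewrite (_ : tmul t (tinv t) = tone R n) ?character1 ?mul1r //; apply: torus_ext => j;
  rewrite tmulE tinvE toneE divff // torus_neq0.
Qed.

(** On T the change of charts is a group homomorphism, so in the frames z_j d/dz_j its differential
    is the constant matrix of exponents. *)
Lemma jacobian_torus A B z : diag_mx (val z) *m 'J (transition A B) (val z) =
  Cmx (A *m invmx B) *m diag_mx (val (tmap (A *m invmx B) z)).
Proof.
have nz j : val z 0 j = 0 -> False by move/eqP; rewrite (negPf (torus_neq0 z j)).
apply/matrixP => j k; rewrite mul_diag_mx mul_mx_diag [LHS]mxE [RHS]mxE tmapE.
rewrite jacobian_transition; last by move=> i /nz.
rewrite [Cmx _ j k]mxE -!mulrA mulrCA; congr (_ * _).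
rewrite mulrA [RHS](bigD1 j) //=; congr (_ * _).
  rewrite -{1}[val z 0 j]expr1z -expfzDr ?torus_neq0 // addrCA subrr addr0; congr (_ ^ _).
  by rewrite [RHS]mxE [RHS]mxE.
by apply: eq_bigr => i _; congr (_ ^ _); rewrite [RHS]mxE [RHS]mxE.
Qed.

Lemma extmap_jacobian A B z u : extmap ('J (transition A B) (val z)) (rho u z) =
  rho (extmap (Cmx (A *m invmx B)) u) (tmap (A *m invmx B) z).
Proof. by rewrite /rho -!extmapM jacobian_torus. Qed.

Lemma cabs_character m t : cabs (character m t) <= tnorm t ^+ (\sum_(j < n) absz (m 0%R j))%N.
Proof.
rewrite /character cabs_prod expr_sum; apply: ler_prod => j _.
rewrite cabs_ge0 /= cabs_exprz.
have h1 : cabs (val t 0 j) <= tnorm t /\ (cabs (val t 0 j))^-1 <= tnorm t.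
  have := ltac:(rewrite cabs_gt0; exact: torus_neq0) : 0 < cabs (val t 0 j).
  move=> h; have h' : 0 < (cabs (val t 0 j))^-1 by rewrite invr_gt0.
  have : tnorm t = 1 + (cabs (val t 0 j) + (cabs (val t 0 j))^-1 +
      \sum_(i | i != j) (cabs (val t 0 i) + (cabs (val t 0 i))^-1)).
    rewrite [LHS]/tnorm; congr (1 + _); rewrite [LHS](bigD1 j) //= -cabsV; congr (_ + _).
    by apply: eq_bigr => i _; rewrite cabsV.
  have : 0 <= \sum_(i | i != j) (cabs (val t 0 i) + (cabs (val t 0 i))^-1).
    by apply: sumr_ge0 => i _; rewrite addr_ge0 ?invr_ge0 ?cabs_ge0.
  move=> s0 ->; split; lra.
case: (m 0 j) => k; first by rewrite absz_nat lerXn2r ?nnegrE ?cabs_ge0 ?tnorm_ge0 //; case: h1.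
by rewrite NegzE abszN absz_nat -exprnN -exprVn lerXn2r ?nnegrE ?invr_ge0 ?cabs_ge0 ?tnorm_ge0 //; case: h1.
Qed.

End TorusMaps.

(** * Growth of the global fields *)

Section GlobalFields.
Variables (R : realType) (n : nat) (Delta : set (set 'rV[R]_n)).
Hypotheses (fan_Delta : is_fan Delta) (smooth_X : is_smooth Delta).
Local Notation C := R[i].
Local Notation toric := (toric Delta).
Local Notation torus := (torus R n).
Implicit Types (A B : 'M[int]_n) (J K : {set 'I_n}) (m : 'rV[int]_n) (t : torus).
Implicit Types (E u : ext C n) (v : tfield R n).

Lemma chart_unit A J : is_chart Delta A J -> A \in unitmx.
Proof. by case. Qed.

Lemma torus_dom J t : chart_dom J (val t).
Proof. by move=> j _; exact: torus_neq0. Qed.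

(** Conjugating by [rho] passes to the invariant frame, where only the constant matrix [invmx A]
    acts. *)
Lemma field_chart k w v A J t : is_holo_field Delta k w ->
  (forall t, v t = w 1%:M finset.set0 (val t)) -> is_chart Delta A J ->
  w A J (val (tcoord A t)) = rho (extmap (Cmx R (invmx A)) (rho (v t) (tinv t))) (tcoord A t).
Proof.
move=> [_ hw] hv cA; have c1 := chart1 fan_Delta smooth_X.
have := hw _ _ _ _ c1 cA (torus_point fan_Delta smooth_X t) (torus_point_open c1) (torus_point_open cA).
rewrite torus_point_coord torus_point_coord1 -hv => ->.
by rewrite -{1}(rhoVK t (v t)) extmap_jacobian mul1mx.
Qed.

Lemma chart_field k w v A J t : is_holo_field Delta k w ->
  (forall t, v t = w 1%:M finset.set0 (val t)) -> is_chart Delta A J ->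
  v t = rho (extmap (Cmx R A) (rho (w A J (val (tcoord A t))) (tinv (tcoord A t)))) t.
Proof.
move=> hw hv cA; have uA := chart_unit cA.
have -> : w A J (val (tcoord A t)) =
    rho (extmap (invmx (Cmx R A)) (rho (v t) (tinv t))) (tcoord A t).
  by rewrite (Cmx_inv R uA); exact: field_chart hw hv cA.
rewrite (rhoK (tcoord A t) (extmap (invmx (Cmx R A)) (rho (v t) (tinv t)))).
by rewrite (extmapVK (Cmx_unit R uA) (rho (v t) (tinv t))); exact: (esym (rhoVK t (v t))).
Qed.

(** Going from the frame of the chart to that of T multiplies the coefficients by fixed matrix
    entries and by characters. As c and d depend on A alone, a common bound exists for finitely many
    charts. *)
Lemma chart_growth A : exists (c : R) (d : nat), forall (M : R) t u, (forall S, cabs (u S) <= M) ->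
  forall S, cabs (rho (extmap (Cmx R A) (rho u (tinv (tcoord A t)))) t S) <= c * `|M| * tnorm t ^+ d.
Proof.
pose e (S T : {set 'I_n}) : 'rV[int]_n := ind S - ind T *m (invmx A)^T.
pose a (S T : {set 'I_n}) : C := extmap (Cmx R A) (ebas C T) S.
pose D (m : 'rV[int]_n) := (\sum_(j < n) absz (m 0%R j))%N.
exists (\sum_S \sum_T cabs (a S T)), (\sum_S \sum_T D (e S T))%N => M t u uM S.
have -> : rho (extmap (Cmx R A) (rho u (tinv (tcoord A t)))) t S =
    \sum_T a S T * (character (e S T) t * (u T : C)).
  rewrite rhoE (ext_ebas (rho u _)) extmap_sum ext_sumE mulr_sumr; apply: eq_bigr => T _.
  rewrite extmapZ ffunE rhoE /e characterD characterN characterV -character_tmap tcoord_tmap.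
  by rewrite /a /GRing.scale /=; ring.
apply: le_trans (cabs_sum _ _ _) _.
have M0 := normr_ge0 M; have P0 d : 0 <= tnorm t ^+ d by rewrite exprn_ge0 ?tnorm_ge0.
apply: (@le_trans _ _ (\sum_T cabs (a S T) * (`|M| * tnorm t ^+ (\sum_S \sum_T D (e S T))%N))).
  apply: ler_sum => T _; rewrite !cabsM ler_wpM2l ?cabs_ge0 // mulrC.
  apply: ler_pM; rewrite ?cabs_ge0 //; first exact: le_trans (uM T) (ler_norm M).
  apply: le_trans (cabs_character _ _) _; apply: ler_weXn2l; first exact: tnorm_ge1.
  by rewrite (bigD1 S) //= (bigD1 T) //= -addnA leq_addr.
rewrite -mulr_suml mulrA; apply: ler_wpM2r => //; apply: ler_wpM2r => //.
rewrite [leRHS](bigD1 S) //= lerDl; apply: sumr_ge0 => i0 _; apply: sumr_ge0 => T _; exact: cabs_ge0.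
Qed.

Lemma chart_growth_seq (s : seq ('M[int]_n * {set 'I_n} * R)) : exists M' d, forall q, q \in s ->
  forall t u, (forall S, cabs (u S) <= q.2) ->
  forall S, cabs (rho (extmap (Cmx R q.1.1) (rho u (tinv (tcoord q.1.1 t)))) t S) <= M' * tnorm t ^+ d.
Proof.
elim: s => [|q s [M' [d IH]]]; first by exists 0, 0%N.
have [K [d' hK]] := chart_growth q.1.1.
exists (`|K * `|q.2| | + `|M'|), (d + d')%N => q' q's t u hu S.
have T1 := tnorm_ge1 t; have P0 k : 0 <= tnorm t ^+ k by rewrite exprn_ge0 ?tnorm_ge0.
have W (a b : R) k l : (k <= l)%N -> a <= `|b| -> a * tnorm t ^+ k <= `|b| * tnorm t ^+ l.
  move=> kl ab; apply: le_trans (_ : `|b| * tnorm t ^+ k <= _); first exact: ler_wpM2r.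
  by apply: ler_wpM2l => //; apply: ler_weXn2l.
rewrite mulrDl; move: q's; rewrite inE => /orP[/eqP e|q's].
  rewrite e in hu *; apply: le_trans (hK _ _ _ hu _) _.
  apply: le_trans (W _ (K * `|q.2|) _ (d + d')%N (leq_addl _ _) (ler_norm _)) _.
  by rewrite lerDl mulr_ge0.
apply: le_trans (IH _ q's _ _ hu _) _.
apply: le_trans (W _ M' _ (d + d')%N (leq_addr _ _) (ler_norm _)) _.
by rewrite lerDr mulr_ge0.
Qed.

Lemma holo_bounded (f : 'rV[C]_n -> ext C n) (z : 'rV[C]_n) : holo_at f z ->
  exists M (d : R), 0 < d /\
    forall y : 'rV[C]_n, (forall j, cabs (y 0 j - z 0 j) < d) -> forall S, cabs (f y S) <= M.
Proof.
move=> hf.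
have hS S : exists d : R, 0 < d /\ forall y : 'rV[C]_n, (forall j, cabs (y 0 j - z 0 j) < d) ->
    cabs (f y S) <= 1 + cabs (f z S).
  have [e /cgt0P [x x0 ->] he] := differentiable_near (hf S).
  exists x; split=> // y hy.
  have : `|f y S - f z S| < 1 :> C by apply: he => j; rewrite normC_cabs ltcR.
  rewrite normC_cabs -[X in _ < X -> _]/((1%:C)%C) ltcR => h.
  have := ler_cabsB (f y S) (f z S); lra.
have /choice [d hd] := hS.
exists (\sum_S (1 + cabs (f z S))), (\big[Num.min/1]_S d S); split.
  apply: (big_ind (fun x => 0 < x)) => // [x y x0 y0|S _]; first by rewrite lt_min x0.
  by case: (hd S).
move=> y hy S; have [_ h] := hd S.
apply: le_trans (h y _) _.
  by move=> j; apply: lt_le_trans (hy j) _; rewrite (bigD1 S) //= ge_min lexx.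
rewrite (bigD1 S) //= lerDl; apply: sumr_ge0 => i0 _; by rewrite addr_ge0 ?cabs_ge0.
Qed.

Lemma rdiff_tset (f : 'rV[C]_n -> C) t j (z : C) : z != 0 ->
  (forall y : 'rV[C]_n, (forall j, y 0 j != 0) -> rdiff f y) -> cdiff (fun w => f (val (tset t j w))) z.
Proof.
move=> z0 df; pose a : 'rV[C]_n := \row_i (if i == j then 0 else val t 0 i).
have aE w : w != 0 -> a + w *: delta_mx 0 j = val (tset t j w).
  move=> w0; apply/rowP => k; rewrite tsetE // !mxE eqxx /=.
  by case: eqP => _; rewrite ?mulr1 ?mulr0 ?add0r ?addr0.
apply: (@cdiff_local _ (fun w => f (a + w *: delta_mx 0 j)) _ _ (cabs z)); first by rewrite cabs_gt0.
  move=> w hw; rewrite aE //; apply/eqP => w0.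
  by move: hw; rewrite w0 sub0r cabsN ltxx.
by apply: rdiff_cdiff; apply: df => k; rewrite aE // torus_neq0.
Qed.

Hypothesis compact_X : compact [set: toric].

Lemma field_laurent k v : H0 Delta k v ->
  exists2 B : seq 'rV[int]_n, uniq B & exists E : 'rV[int]_n -> ext C n, forall t,
    v t = \sum_(m <- B) character m t *: rho (E m) t.
Proof.
move=> [w hw hv].
have [s [sc hs]] := @compact_cover_charts _ _ _ fan_Delta smooth_X compact_X
  (fun A J M y => forall S, cabs (w A J y S) <= M)
  (fun A J z cA dz => holo_bounded (proj2 (proj1 hw A J cA z dz))).
have [M [d hM]] := chart_growth_seq s.
apply: (@tfield_laurent _ _ _ M d) => [S t j z z0|S t].
  rewrite (_ : (fun _ => _) = fun w0 => w 1%:M finset.set0 (val (tset t j w0)) S); last first.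
    by apply/funext => w0; rewrite hv.
  apply: (@rdiff_tset (fun y => w 1%:M finset.set0 y S)) => // y y0.
  by have [_] := proj1 hw _ _ (chart1 fan_Delta smooth_X) y (fun j _ => y0 j); apply.
have [q qs [qo hq]] := hs (torus_point fan_Delta smooth_X t).
rewrite (chart_field t hw hv (sc _ qs)); apply: hM => // S'.
by have := hq S'; rewrite torus_point_coord.
Qed.

End GlobalFields.

(** * The terms which extend to X *)

Section ComplexLimits.
Variable R : realType.
Local Notation C := R[i].

(** By continuity; it carries identities from T to the points outside T. *)
Lemma cdiff_eq_at0 (f g : C -> C) : cdiff f 0 -> cdiff g 0 ->
  (forall z, z != 0 -> f z = g z) -> f 0 = g 0.
Proof.
move=> /cdiff_econt cf /cdiff_econt cg e; apply/eqP; rewrite -subr_eq0 -cabs_eq0.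
have := cabs_ge0 (f 0 - g 0); rewrite le_eqVlt eq_sym => /orP[//|h].
have h3 : 0 < cabs (f 0 - g 0) / 3 by rewrite divr_gt0.
have [d d0 hd] := cf _ h3; have [d' d0' hd'] := cg _ h3.
pose w : C := ((Num.min d d' / 2)%:C)%C.
have m0 : 0 < Num.min d d' by rewrite lt_min d0.
have cw : cabs (w - 0) = Num.min d d' / 2 by rewrite subr0 cabs_real gtr0_norm // divr_gt0.
have w0 : w != 0 by rewrite -cabs_gt0 -[w]subr0 cw divr_gt0.
have l1 : cabs (w - 0) < d by rewrite cw; have : Num.min d d' <= d by [rewrite ge_min lexx]; lra.
have l2 : cabs (w - 0) < d' by rewrite cw; have : Num.min d d' <= d' by [rewrite ge_min lexx orbT]; lra.
have := hd _ l1; have := hd' _ l2; rewrite (e _ w0) => e1 e2.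
have := ler_cabsD (- (g w - f 0)) (g w - g 0).
rewrite cabsN (_ : - (g w - f 0) + (g w - g 0) = f 0 - g 0); [lra|by ring].
Qed.

Lemma expz_bounded (k : int) (c : C) (M r : R) : c != 0 -> 0 < r ->
  (forall z, z != 0 -> cabs z < r -> cabs (z ^ k * c) <= M) -> 0 <= k.
Proof.
move=> c0 r0 h; case: k h => // k h; exfalso.
have cp : 0 < cabs c by rewrite cabs_gt0.
(* For a negative exponent and 0 < x <= 1 the modulus at x is at least |c| / x, and the last bound
   makes this exceed |M|. *)
pose x := Num.min (r / 2) (Num.min 1 (cabs c / (`|M| + 1))).
have M1 : 0 < `|M| + 1 by rewrite ltr_wpDl.
have x0 : 0 < x by rewrite !lt_min !divr_gt0 // ltr01.
have x1 : x <= r / 2 by rewrite ge_min lexx.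
have x2 : x <= 1 by rewrite !ge_min lexx orbT.
have x3 : x <= cabs c / (`|M| + 1) by rewrite !ge_min lexx !orbT.
have cx : cabs (x%:C)%C = x by rewrite cabs_real gtr0_norm.
have := h (x%:C)%C; rewrite -cabs_gt0 cx x0 cabsM cabs_exprz cx => /(_ isT (ltac:(lra))).
rewrite NegzE -exprnN exprS => le; have : x ^+ k <= 1 by apply: exprn_ile1 => //; exact: ltW.
have P : 0 < x ^+ k by rewrite exprn_gt0.
move=> xk; have Px : 0 < x * x ^+ k by rewrite mulr_gt0.
move: le; rewrite mulrC ler_pdivrMr // => le.
have le2 : x * (`|M| + 1) <= cabs c by rewrite -ler_pdivlMr.
have : M * (x * x ^+ k) <= `|M| * x.
  apply: le_trans (_ : `|M| * (x * x ^+ k) <= _); first by apply: ler_wpM2r; [exact: ltW|exact: ler_norm].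
  by apply: ler_wpM2l => //; rewrite -[leRHS]mulr1; apply: ler_wpM2l => //; exact: ltW.
nra.
Qed.

End ComplexLimits.

Section Extendability.
Variables (R : realType) (n : nat) (Delta : set (set 'rV[R]_n)).
Hypotheses (fan_Delta : is_fan Delta) (smooth_X : is_smooth Delta).
Local Notation C := R[i].
Local Notation toric := (toric Delta).
Local Notation torus := (torus R n).
Implicit Types (A B : 'M[int]_n) (J K T : {set 'I_n}) (m : 'rV[int]_n) (t : torus).
Implicit Types (E u : ext C n) (v : tfield R n).

(* In the coordinates of the chart A, the coefficient of chi^m rho(E) on the
   T-th frame vector is a monomial whose exponent at j is the right-hand side. *)
Definition extendable m E := forall A J, is_chart Delta A J ->
  forall j T, j \in J -> extmap (Cmx R (invmx A)) E T != 0 -> 0 <= ip m (row j A) + (j \in T)%:Z.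

Lemma ip_row m A j : (m *m A^T) 0 j = ip m (row j A).
Proof. by rewrite mxE; apply: eq_bigr => i _; rewrite !mxE. Qed.

Lemma trmx_inj_mul A m m' : A \in unitmx -> m *m A^T = m' *m A^T -> m = m'.
Proof.
by move=> uA e; rewrite -(mulmxK (_ : A^T \in unitmx) m) ?unitmx_tr // e mulmxK // unitmx_tr.
Qed.

Lemma tset_mul t s j z : z != 0 -> tmul s (tset t j z) = tset (tmul s t) j (val s 0 j * z).
Proof.
move=> z0; apply: torus_ext => k; rewrite tmulE !tsetE ?mulf_neq0 ?torus_neq0 //.
by case: (k =P j) => [->|_] //; rewrite tmulE.
Qed.

Lemma rho_sumK (B : seq 'rV[int]_n) (E : 'rV[int]_n -> ext C n) t :
  rho (\sum_(m <- B) character m t *: rho (E m) t) (tinv t) = \sum_(m <- B) character m t *: E m.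
Proof.
rewrite [LHS]/rho extmap_sum; apply: eq_bigr => m' _.
by rewrite extmapZ -/(rho _ _) rhoK.
Qed.

(** The j-th coordinate of the chart tends to 0 while the others stay fixed; the field is bounded
    near the limit point. Between the two frames the coefficient at T changes by the product of the
    coordinates in T, of which only the j-th varies. *)
Lemma field_coef_bounded k w v A J j t T : is_holo_field Delta k w ->
  (forall t, v t = w 1%:M finset.set0 (val t)) -> is_chart Delta A J -> j \in J ->
  exists (M r : R), 0 < r /\ forall z, z != 0 -> cabs z < r ->
    cabs (z ^ (j \in T)%:Z *
      extmap (Cmx R (invmx A)) (rho (v (tmap A (tset t j z))) (tinv (tmap A (tset t j z)))) T) <= M.
Proof.
move=> hw hv cA jJ; have uA := chart_unit cA.
pose a : 'rV[C]_n := \row_i (if i == j then 0 else val t 0 i).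
have da : chart_dom J a.
  move=> i iJ; rewrite mxE; case: (i =P j) => [ij|_]; first by rewrite ij jJ in iJ.
  exact: torus_neq0.
have [M [r [r0 hM]]] := holo_bounded (proj2 (proj1 hw A J cA a da)).
pose c := \prod_(i in T | i != j) val t 0 i.
have c0 : 0 < cabs c.
  rewrite cabs_gt0; apply/prodf_neq0 => i _; exact: torus_neq0.
exists (M / cabs c), r; split=> // z z0 zr; set s := tset t j z.
have e : w A J (val s) T = character (ind T) s *
    extmap (Cmx R (invmx A)) (rho (v (tmap A s)) (tinv (tmap A s))) T.
  by rewrite -rhoE -{1}(tmapK s uA) (field_chart fan_Delta smooth_X _ hw hv cA) tmapK.
have ce : character (ind T) s = c * z ^ (j \in T)%:Z.
  rewrite character_ind; have P i : i != j -> val s 0 i = val t 0 i.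
    by move=> ij; rewrite tsetE // (negPf ij).
  have [jT|jT] := boolP (j \in T).
    rewrite (bigD1 j) //= mulrC expr1z; congr (_ * _); last by rewrite tsetE // eqxx.
    by apply: eq_bigr => i /andP[_ /P].
  rewrite expr0z mulr1; apply: eq_big => [i|i iT].
    by case: (boolP (i \in T)) => //= iT; apply/esym; apply: contra jT => /eqP <-.
  by apply: P; apply: contra jT => /eqP <-.
rewrite ler_pdivlMr // mulrC -cabsM mulrA -ce -e; apply: hM => i.
rewrite tsetE // mxE; case: (i =P j) => _; rewrite ?subr0 // subrr cabs0 //.
Qed.

Lemma laurent_term_extendable k v (B : seq 'rV[int]_n) (E : 'rV[int]_n -> ext C n) :
  H0 Delta k v -> uniq B -> (forall t, v t = \sum_(m <- B) character m t *: rho (E m) t) ->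
  forall m, m \in B -> homog k (E m) /\ extendable m (E m).
Proof.
move=> [w hw hv] uB hE m mB; split.
  have := @isotypic_extraction _ _ (ext C n) (fun f => forall t, homog k (f t)) _ _ _ B E uB _ m mB (tone R n).
  rewrite character1 scale1r; apply.
  - by move=> f g hf hg t; apply: homogD.
  - by move=> a f hf t; apply: homogZ.
  - by move=> s f hf t; exact: hf.
  move=> t; rewrite -rho_sumK -hE; apply: homog_extmap; rewrite hv; apply/extpowT.
  by have [] := proj1 hw _ _ (chart1 fan_Delta smooth_X) _ (torus_dom (J := finset.set0) t).
move=> A J cA j T jJ nz; have uA := chart_unit cA.
(* The bound and the radius may depend on t: translation by s multiplies the j-th coordinate by s_j
   and so rescales the disc. *)
pose P (f : torus -> C^o) := forall t, exists (M r : R), 0 < r /\ forall z, z != 0 -> cabs z < r ->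
    cabs (z ^ (j \in T)%:Z * f (tset t j z)) <= M.
(* In the coordinates of the chart the exponent m' becomes [m' *m A^T], and the coefficients are
   reindexed accordingly. *)
pose c (m' : 'rV[int]_n) : C^o := extmap (Cmx R (invmx A)) (E (m' *m invmx A^T)) T.
have cE m' : c (m' *m A^T) = extmap (Cmx R (invmx A)) (E m') T by rewrite /c mulmxK // unitmx_tr.
have Pm : P (fun t => \sum_(m' <- [seq m' *m A^T | m' <- B]) character m' t *: c m').
  move=> t; have [M [r [r0 hM]]] := field_coef_bounded t T hw hv cA jJ.
  exists M, r; split=> // z z0 zr; have := hM z z0 zr; congr (cabs (_ * _) <= M).
  rewrite big_map hE rho_sumK extmap_sum ext_sumE; apply: eq_bigr => m' _.
  by rewrite extmapZ ffunE cE character_tmap.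
have Q : P (fun t => character (m *m A^T) t *: c (m *m A^T)).
  apply: (@isotypic_extraction _ _ C^o P _ _ _ [seq m' *m A^T | m' <- B] c).
  - move=> f g hf hg t; have [M [r [r0 h]]] := hf t; have [M' [r' [r0' h']]] := hg t.
    exists (M + M'), (Num.min r r'); split; first by rewrite lt_min r0.
    move=> z z0; rewrite lt_min => /andP[zr zr']; rewrite mulrDr.
    by apply: le_trans (ler_cabsD _ _) _; apply: lerD; [exact: h|exact: h'].
  - move=> a f hf t; have [M [r [r0 h]]] := hf t; exists (cabs a * M), r; split=> // z z0 zr.
    by rewrite [a *: _]/(a * _) mulrCA cabsM ler_wpM2l ?cabs_ge0 //; exact: h.
  - move=> s f hf t; have [M [r [r0 h]]] := hf (tmul s t).
    have sp : 0 < cabs (val s 0 j) by rewrite cabs_gt0 torus_neq0.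
    exists (cabs (val s 0 j) ^ (- (j \in T)%:Z) * M), (r / cabs (val s 0 j)).
    split; first exact: divr_gt0.
    move=> z z0; rewrite ltr_pdivlMr // mulrC -cabsM => zr; rewrite tset_mul //.
    have := h _ (mulf_neq0 (torus_neq0 s j) z0) zr.
    rewrite expfzMl -mulrA cabsM cabs_exprz -invr_expz mulrC -ler_pdivlMr ?exprz_gt0 // [_ ^-1 * M]mulrC [X in cabs X <= _]mulrC; apply.
  - by rewrite map_inj_uniq // => m1 m2; exact: trmx_inj_mul.
  - exact: Pm.
  - exact: map_f.
(* With all other coordinates equal to 1, the term is a constant times a power of z, whose exponent
   is the one in [extendable]. *)
have [M [r [r0 h]]] := Q (tone R n); rewrite -ip_row addrC.
apply: (@expz_bounded _ _ (extmap (Cmx R (invmx A)) (E m) T) M r) => // z z0 zr.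
have := h z z0 zr; rewrite cE character_tset // expfzDr //.
by rewrite [_ *: _]/(_ * _) mulrA.
Qed.

End Extendability.

Section ExtmapDiff.
Variables (R : realType) (n : nat).
Local Notation C := R[i].

Lemma cdiff_wedges (I : Type) (s : seq I) (x : I -> C -> 'rV[C]_n) p :
  (forall a k, cdiff (fun w => x a w 0 k) p) ->
  forall S, cdiff (fun w => wedges [seq x a w | a <- s] S) p.
Proof.
move=> dx; elim: s => [|a s IH] S /=; first exact: cdiff_cst.
rewrite (_ : (fun _ => _) = fun w => \sum_(A : {set 'I_n} | A \subset S)
    (-1) ^+ inversions A (S :\: A) * (\sum_(k | A == [set k]%SET) x a w 0 k) *
    wedges [seq x a w | a <- s] (S :\: A)%SET); last first.
  by apply/funext => w; rewrite ffunE; apply: eq_bigr => A _; rewrite ffunE.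
apply: cdiff_sum => A _; apply: cdiffM; last exact: IH.
by apply: cdiffM; [exact: cdiff_cst|apply: cdiff_sum => k _; exact: dx].
Qed.

Lemma cdiff_extmap (M : C -> 'M[C]_n) (u : C -> ext C n) p :
  (forall j k, cdiff (fun w => M w j k) p) -> (forall S, cdiff (fun w => u w S) p) ->
  forall S, cdiff (fun w => extmap (M w) (u w) S) p.
Proof.
move=> dM du S.
rewrite (_ : (fun _ => _) = fun w => \sum_T u w T * wedges [seq row a (M w) | a <- enum T] S); last first.
  by apply/funext => w; rewrite ext_sumE; apply: eq_bigr => T _; rewrite ffunE.
apply: cdiff_sum => T _; apply: cdiffM => //; apply: cdiff_wedges => a k.
by rewrite (_ : (fun _ => _) = fun w => M w a k) //; apply/funext => w; rewrite mxE.
Qed.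

End ExtmapDiff.

(** * Gluing the monomial expressions into a global field; weight vectors *)

Section Converse.
Variables (R : realType) (n : nat) (Delta : set (set 'rV[R]_n)).
Hypotheses (fan_Delta : is_fan Delta) (smooth_X : is_smooth Delta).
Local Notation C := R[i].
Local Notation toric := (toric Delta).
Local Notation torus := (torus R n).
Implicit Types (A B : 'M[int]_n) (J K T : {set 'I_n}) (m : 'rV[int]_n) (t : torus).
Implicit Types (E u : ext C n) (v : tfield R n).

(* The expression of chi^m rho(E) in the chart A. *)
Definition mono_field m E A (J : {set 'I_n}) (z : 'rV[C]_n) : ext C n :=
  [ffun T => (extmap (Cmx R (invmx A)) E T : C) * mono (m *m A^T + ind T) z].

Lemma mono_field_torus m E A J t :
  mono_field m E A J (val t) = character (m *m A^T) t *: rho (extmap (Cmx R (invmx A)) E) t.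
Proof.
apply/ffunP => T; rewrite !ffunE rhoE -character_mono characterD.
by rewrite mulrCA [_ * character (ind T) t]mulrC.
Qed.

Lemma mono_field_exp m E A J (z : 'rV[C]_n) T : extendable Delta m E -> is_chart Delta A J -> chart_dom J z ->
  extmap (Cmx R (invmx A)) E T != 0 -> forall j, z 0 j = 0 -> 0 <= (m *m A^T + ind T) 0 j.
Proof.
move=> ex cA dz nz j zj; rewrite [X in 0 <= X]mxE ip_row [ind T 0 j]mxE; apply: ex cA _ _ _ nz.
by apply: contraT => /dz; rewrite zj eqxx.
Qed.

Lemma mono_field_holo m E A J z : extendable Delta m E -> is_chart Delta A J -> chart_dom J z ->
  holo_at (mono_field m E A J) z.
Proof.
move=> ex cA dz T.
rewrite (_ : (fun _ => _) = fun y => extmap (Cmx R (invmx A)) E T * mono (m *m A^T + ind T) y);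
  last by apply/funext => y; rewrite ffunE.
have [e|nz] := eqVneq (extmap (Cmx R (invmx A)) E T) 0.
  rewrite (_ : (fun _ => _) = fun=> 0); first exact: rdiff_cst.
  by apply/funext => y; rewrite e mul0r.
apply: rdiffM; first exact: rdiff_cst.
by apply: rdiff_mono => j; exact: (mono_field_exp ex cA dz nz).
Qed.

Lemma mono_field_cdiff m E A J (f : C -> 'rV[C]_n) p T : extendable Delta m E -> is_chart Delta A J ->
  chart_dom J (f p) -> (forall j, cdiff (fun w => f w 0 j) p) ->
  cdiff (fun w => mono_field m E A J (f w) T) p.
Proof.
move=> ex cA dz df.
rewrite (_ : (fun _ => _) = fun w => extmap (Cmx R (invmx A)) E T * mono (m *m A^T + ind T) (f w));
  last by apply/funext => y; rewrite ffunE.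
have [e|nz] := eqVneq (extmap (Cmx R (invmx A)) E T) 0.
  rewrite (_ : (fun _ => _) = fun=> 0); first exact: cdiff_cst.
  by apply/funext => y; rewrite e mul0r.
apply: cdiffM; first exact: cdiff_cst.
by apply: cdiff_mono => // j; exact: (mono_field_exp ex cA dz nz).
Qed.

Lemma extmap_Cmx A B E : extmap (Cmx R B) (extmap (Cmx R A) E) = extmap (Cmx R (A *m B)) E.
Proof. by rewrite CmxM extmapM. Qed.

Lemma mono_field_compat_torus m E A J B K t : A \in unitmx -> B \in unitmx ->
  mono_field m E B K (transition A B (val t)) =
  extmap ('J (transition A B) (val t)) (mono_field m E A J (val t)).
Proof.
move=> uA uB; rewrite transition_tmap !mono_field_torus extmapZ extmap_jacobian character_tmap.
have -> : m *m B^T *m (A *m invmx B)^T = m *m A^T.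
  by rewrite -mulmxA -trmx_mul -mulmxA mulVmx // mulmx1.
have e : invmx A *m (A *m invmx B) = invmx B by rewrite mulmxA mulVmx // mul1mx.
have := extmap_Cmx (invmx A) (A *m invmx B) E; rewrite e => e'.
exact: (congr1 (fun u => character (m *m A^T) t *: rho u (tmap (A *m invmx B) t)) (esym e')).
Qed.

(** On T this is [mono_field_compat_torus]. Elsewhere the vanishing coordinates of x are replaced by
    w: both sides are differentiable at w = 0 and agree for w <> 0. *)
Lemma mono_field_compat m E A J B K (x : toric) : extendable Delta m E ->
  is_chart Delta A J -> is_chart Delta B K ->
  affine_open (row_cone A J) x -> affine_open (row_cone B K) x ->
  mono_field m E B K (chart_coord B x) =
  extmap ('J (transition A B) (chart_coord A x)) (mono_field m E A J (chart_coord A x)).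
Proof.
move=> ex cA cB xA xB; have uA := chart_unit cA; have uB := chart_unit cB.
set z := chart_coord A x.
have eB : chart_coord B x = transition A B z by exact: coord_transition cA cB xA xB.
have pe j k : z 0 j = 0 -> 0 <= (A *m invmx B) j k by exact: exp_ge0_at_zero cA cB xA xB.
have dz : chart_dom J z := coord_dom fan_Delta cA xA.
have dB : chart_dom K (transition A B z) by move: (coord_dom fan_Delta cB xB); rewrite eB.
rewrite eB.
pose f (w : C) : 'rV[C]_n := \row_j (if z 0 j == 0 then w else z 0 j).
have f0 : f 0 = z by apply/rowP => j; rewrite mxE; case: (z 0 j =P 0) => [->|].
have df j : cdiff (fun w => f w 0 j) 0.
  rewrite (_ : (fun _ => _) = fun w => if z 0 j == 0 then w else z 0 j); last first.
    by apply/funext => w; rewrite mxE.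
  by case: eqP => _; [exact: cdiff_id|exact: cdiff_cst].
have ft w : w != 0 -> exists t, f w = val t.
  move=> w0; have h : forall j, f w 0 j != 0 by move=> j; rewrite mxE; case: ifP => // /negbT.
  by exists (mkt (fun j => f w 0 j)); apply/rowP => j; rewrite mktE.
have dt j : cdiff (fun w => transition A B (f w) 0 j) 0.
  rewrite (_ : (fun _ => _) = fun w => mono (expcol A B j) (f w)); last first.
    by apply/funext => w; rewrite transitionE.
  by apply: cdiff_mono => // k; rewrite f0 expcolE => /pe.
have dJ j k : cdiff (fun w => 'J (transition A B) (f w) j k) 0.
  set G := A *m invmx B in pe *.
  rewrite (_ : (fun _ => _) = fun w => (G j k)%:~R * f w 0 j ^ (G j k - 1) *
      \prod_(i | i != j) f w 0 i ^ G i k); last first.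
    apply/funext => w; apply: jacobian_transition => i fi k'; apply: pe.
    by move: fi; rewrite mxE; case: ifP => [/eqP|].
  (* An exponent 0 makes the entry identically 0; otherwise, where the j-th coordinate of z
     vanishes, the exponent is at least 1 and its predecessor is nonnegative. *)
  have [e|nz] := eqVneq (G j k) 0.
    rewrite (_ : (fun _ => _) = fun=> 0); first exact: cdiff_cst.
    by apply/funext => w; rewrite e mul0r mul0r.
  apply: cdiffM.
    apply: cdiffM; first exact: cdiff_cst.
    by apply: cdiff_exprz => //; rewrite f0 => /(pe j k); lia.
  apply: cdiff_prod => i _; apply: cdiff_exprz => //; rewrite f0; exact: pe.
apply/ffunP => S.
have := @cdiff_eq_at0 _ (fun w => mono_field m E B K (transition A B (f w)) S)
  (fun w => extmap ('J (transition A B) (f w)) (mono_field m E A J (f w)) S).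
rewrite f0; apply.
- by apply: (mono_field_cdiff S ex cB _ dt); rewrite f0.
- apply: cdiff_extmap => // T; by apply: (mono_field_cdiff T ex cA _ df); rewrite f0.
- by move=> w w0; have [t ->] := ft w w0; rewrite (mono_field_compat_torus _ _ J).
Qed.

Lemma extendable_H0 k m E : homog k E -> extendable Delta m E ->
  H0 Delta k (fun t => character m t *: rho E t).
Proof.
move=> hE ex; exists (mono_field m E).
  split=> [A J cA z dz|A J B K cA cB x xA xB]; last exact: mono_field_compat xA xB.
  split; last exact: mono_field_holo.
  apply/extpowT => T; rewrite ffunE mulf_eq0 negb_or => /andP[nz _].
  exact: homog_extmap hE _ nz.
move=> t; rewrite mono_field_torus trmx1 mulmx1; congr (_ *: rho _ _).
by rewrite invmx1 Cmx1 extmap1.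
Qed.

Lemma H00 k : H0 Delta k (fun=> 0).
Proof.
have := @extendable_H0 k 0 0 (@homog0 _ _ k); rewrite (_ : (fun _ => _) = (fun=> 0)).
  by apply => A J _ j T _; rewrite extmap0 ffunE eqxx.
by apply/funext => t; rewrite [rho 0 t]extmap0 scaler0.
Qed.

Lemma H0D k v v' : H0 Delta k v -> H0 Delta k v' -> H0 Delta k (fun t => v t + v' t).
Proof.
move=> [w [hw1 hw2] hv] [w' [hw1' hw2'] hv'].
exists (fun A J z => w A J z + w' A J z); last by move=> t; rewrite hv hv'.
split=> [A J cA z dz|A J B K cA cB x xA xB]; last first.
  by rewrite extmapD (hw2 _ _ _ _ cA cB x xA xB) (hw2' _ _ _ _ cA cB x xA xB).
have [/extpowT h1 h2] := hw1 A J cA z dz; have [/extpowT h1' h2'] := hw1' A J cA z dz.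
split; first by apply/extpowT; exact: homogD.
move=> S; have := differentiableD (h2 S) (h2' S).
set f1 := _ + _; set f2 := fun y => _; suff -> : f2 = f1 by [].
by apply/funext => y; rewrite /f2 ffunE.
Qed.

(** Evaluating the weight equation for t at the point t itself gives rho(v(1))(t) = chi^(-m)(t)
    v(t). The sign is that of functions under pushforward. *)
Lemma weight_spaceP k m v : weight_space Delta k (- m) v <->
  H0 Delta k v /\ exists E, v = fun t => character m t *: rho E t.
Proof.
split=> [[hv pv]|[hv [E vE]]]; split=> //.
  exists (v (tone R n)); apply/funext => t.
  have := congr1 (fun f => f t) (pv t); rewrite /torus_push.
  have -> : tmul (tinv t) t = tone R n.
    by apply: torus_ext => j; rewrite tmulE tinvE toneE mulVf // torus_neq0.
  rewrite -/(rho _ t) characterN => ->; rewrite scalerA divff ?scale1r //; exact: character_neq0.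
move=> t; apply/funext => s; rewrite /torus_push vE extmapZ characterM characterV characterN scalerA; congr (_ *: _).
rewrite /rho -extmapM; congr extmap; apply/matrixP => i j; rewrite mul_diag_mx !mxE.
by rewrite mulrnAr mulrAC mulVf ?torus_neq0 // mul1r.
Qed.

End Converse.

(** * Lattice points and faces of the polytope *)

Section Completeness.
Variables (R : realType) (n : nat) (Delta : set (set 'rV[R]_n)).
Hypotheses (fan_Delta : is_fan Delta) (smooth_X : is_smooth Delta).
Hypothesis compact_X : compact [set: toric Delta].
Local Notation C := R[i].
Local Notation toric := (toric Delta).
Local Notation torus := (torus R n).
Implicit Types (A B : 'M[int]_n) (J K T : {set 'I_n}) (m v e : 'rV[int]_n) (t : torus).

(* The one-parameter subgroup of v at the parameter 2^-l. *)
Definition oneps v (l : nat) : torus := mkt (fun j => ((2 ^ (- (l%:Z * v 0 j)) : R)%:C)%C).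

Lemma onepsE v l j : val (oneps v l) 0 j = ((2 ^ (- (l%:Z * v 0 j)) : R)%:C)%C.
Proof. by rewrite mktE // -cabs_gt0 cabs_real normr_gt0 expfz_neq0 // pnatr_eq0. Qed.

Lemma cabs_character_oneps m v l : cabs (character m (oneps v l)) = 2 ^ (- (l%:Z * ip m v)).
Proof.
rewrite /character cabs_prod; transitivity (\prod_j (2 : R) ^ (- (l%:Z * (m 0 j * v 0 j)))).
  apply: eq_bigr => j _; rewrite cabs_exprz onepsE cabs_real gtr0_norm ?exprz_gt0 //.
  by rewrite exprz_exp; congr (_ ^ _); ring.
rewrite /ip mulr_sumr -sumrN; apply/esym.
by apply: (big_morph (fun k : int => (2 : R) ^ k)) => [a b|]; rewrite ?expfzDr ?pnatr_eq0 ?expr0z.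
Qed.

Lemma ltn_exp2z (l k : nat) (d : int) : (l.+1 <= k)%N -> 0 < d -> (l%:R : R) < 2 ^ (k%:Z * d).
Proof.
move=> lk; case: d => // d; case: d => // d _.
rewrite -PoszM -exprnP; apply: lt_le_trans (_ : (l.+1)%:R <= _); first by rewrite ltr_nat.
rewrite -natrX ler_nat; apply: leq_trans (ltnW (ltn_expl _ (ltnSn 1))) _.
by rewrite leq_exp2l // (leq_trans lk) // leq_pmulr.
Qed.

Lemma fan_complete v : exists A J, is_chart Delta A J /\ row_cone A J (toR R v).
Proof.
(* Each coordinate is bounded, and those that do not vanish on the chart are bounded away from 0. *)
pose Q A (J : {set 'I_n}) (M : R) (y : 'rV[C]_n) :=
  forall j, cabs (y 0 j) <= M /\ (j \notin J -> 1 <= M * cabs (y 0 j)).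
have [|s [sc hs]] := @compact_cover_charts _ _ _ fan_Delta smooth_X compact_X Q.
  move=> A J z cA dz.
  (* The radius below is at most 1 and, for j outside J, at most |z_j| / 2: so |z_j| + 1 bounds
     |y_j|, and 2 / |z_j| bounds its inverse. *)
  pose b j := cabs (z 0 j) + 1 + 2 / cabs (z 0 j).
  have b0 j : 0 <= b j by rewrite !addr_ge0 ?cabs_ge0 // divr_ge0 ?cabs_ge0.
  exists (\sum_j b j), (\big[Num.min/1]_(j | j \notin J) (cabs (z 0 j) / 2)); split.
    apply: (big_ind (fun x => 0 < x)) => // [x y x0 y0|j jJ]; first by rewrite lt_min x0.
    by rewrite divr_gt0 // cabs_gt0 dz.
  move=> y hy j.
  have bM : b j <= \sum_j b j by rewrite [leRHS](bigD1 j) //= lerDl sumr_ge0.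
  have c0 := cabs_ge0 (z 0 j); have c1 : 0 <= 2 / cabs (z 0 j) by rewrite divr_ge0.
  split.
    apply: le_trans bM; have := ler_cabsB (y 0 j) (z 0 j).
    have : cabs (y 0 j - z 0 j) < 1.
      by apply: lt_le_trans (hy j) _; elim/big_rec: _ => // i0 x _ h; rewrite ge_min h orbT.
    rewrite /b; lra.
  move=> jJ; have zj : 0 < cabs (z 0 j) by rewrite cabs_gt0 dz.
  have lt2 : cabs (y 0 j - z 0 j) < cabs (z 0 j) / 2.
    by apply: lt_le_trans (hy j) _; rewrite (bigD1 j) //= ge_min lexx.
  have := ler_cabsB (z 0 j) (y 0 j); rewrite -[z 0 j - y 0 j]opprB cabsN => le1.
  have y2 : cabs (z 0 j) / 2 <= cabs (y 0 j) by lra.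
  apply: le_trans (_ : 2 / cabs (z 0 j) * (cabs (z 0 j) / 2) <= _).
    by rewrite [X in _ <= X](_ : _ = 1) //; field; rewrite gt_eqF.
  apply: ler_pM => //; first by rewrite divr_ge0.
  by apply: le_trans bM; rewrite /b; lra.
pose l := \sum_(q <- s) `|Num.ceil q.2|%N.
have lP q : q \in s -> q.2 <= l%:R.
  move=> qs; apply: le_trans (ceil_ge _) _.
  apply: le_trans (_ : (`|Num.ceil q.2|%N)%:R <= _); first by rewrite natr_absz ler_int ler_norm.
  by rewrite ler_nat /l (big_rem q) //= leq_addr.
(* All constants of the cover are at most l. In the chart q the coordinates of this point have
   modulus 2^(-(l+1) a), where a is the pairing with the dual vector; a < 0 would violate the upper
   bound, and a > 0 the lower one for j outside J. *)
have [q qs [_ hq]] := hs (torus_point fan_Delta smooth_X (oneps v l.+1)).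
exists q.1.1, q.1.2; split; first exact: sc.
have cA := sc _ qs; have uA := chart_unit cA.
have cE j : cabs (chart_coord q.1.1 (torus_point fan_Delta smooth_X (oneps v l.+1)) 0 j) =
    2 ^ (- (l.+1%:Z * ip (dualb q.1.1 j) v)).
  by rewrite torus_point_coord tcoordE cabs_character_oneps.
have ql := lP _ qs.
apply/(row_coneE _ _ uA) => j; rewrite crdE dot_toR ler0z.
have [h1 h2] := hq j; rewrite cE in h1 h2.
have ge : 0 <= ip (dualb q.1.1 j) v.
  rewrite leNgt; apply/negP => lt.
  have := @ltn_exp2z l l.+1 (- ip (dualb q.1.1 j) v) (leqnn _); rewrite oppr_gt0 => /(_ lt).
  by rewrite mulrN ltNge (le_trans h1).
split=> // jJ; apply/eqP; rewrite intr_eq0; move: ge; rewrite le_eqVlt eq_sym => /orP[//|gt].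
have := @ltn_exp2z l l.+1 _ (leqnn _) gt; rewrite ltNge => /negP[].
have := h2 jJ; rewrite -invr_expz ler_pdivlMr ?exprz_gt0 // mul1r => h.
exact: le_trans h ql.
Qed.

Definition bounded_lattice (N : nat) : set 'rV[int]_n := [set m | forall j, (`|m 0%R j| <= N)%N].

Lemma finite_bounded_lattice N : finite_set (bounded_lattice N).
Proof.
pose f (g : {ffun 'I_n -> 'I_(N + N).+1}) : 'rV[int]_n := \row_j ((g j)%:Z - N%:Z).
apply: (@sub_finite_set _ _ (f @` setT)); last by apply: finite_image; exact: finite_finset.
move=> m hm; exists [ffun j => inord (absz (m 0 j + N%:Z))] => //.
apply/rowP => j; rewrite mxE ffunE inordK; have := hm j; lia.
Qed.

(** Writing v as a nonnegative combination of generators of one cone bounds <m, v> below on the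
    polytope by minus the sum of the coefficients. With v = e_j and v = - e_j this bounds every
    coordinate of m. *)
Lemma finite_polytope_lattice : finite_set (lattice_pts (polytope Delta)).
Proof.
have bd v : exists N : nat, forall m, polytope Delta (toR R m) -> - N%:Z <= ip m v.
  have [A [J [cA vA]]] := fan_complete v; have uA := chart_unit cA.
  pose c := crd A (toR R v); have cP := proj1 (row_coneE _ _ uA) vA.
  exists `|Num.ceil (\sum_j c 0 j)|%N => m mP.
  rewrite -(@ler_int R) -dot_toR (crd_sum (toR R v) uA) dot_sumr rmorphN /=.
  apply: le_trans (_ : - \sum_j c 0 j <= _).
    rewrite lerN2; apply: le_trans (ceil_ge _) _.
    by rewrite -[X in _ <= X]/(_ %:~R) ler_int; exact: lez_abs.
  rewrite -sumrN; apply: ler_sum => j _; rewrite dotZr -/c.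
  have [c0 cJ] := cP j; have [jJ|jJ] := boolP (j \in J).
    have := mP _ (ray_gens_in fan_Delta smooth_X cA jJ); rewrite -/c in c0 *; nra.
  by rewrite /c (cJ jJ) mul0r oppr0.
have /choice [N hN] := bd.
pose D := (\sum_(j < n) (N (delta_mx 0%R j) + N (- delta_mx 0%R j)%R))%N.
apply: sub_finite_set (finite_bounded_lattice D) => m mP j.
have ipd : ip m (delta_mx 0 j) = m 0 j.
  rewrite /ip (bigD1 j) //= mxE !eqxx mulr1 big1 ?addr0 // => i0 ni.
  by rewrite mxE eqxx (negPf ni) mulr0.
have ipn : ip m (- delta_mx 0 j) = - m 0 j.
  by rewrite -ipd /ip -sumrN; apply: eq_bigr => i0 _; rewrite !mxE mulrN.
have := hN (delta_mx 0 j) m mP; have := hN (- delta_mx 0 j) m mP; rewrite ipd ipn.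
have : (N (delta_mx 0%R j) + N (- delta_mx 0%R j)%R <= D)%N by rewrite /D (bigD1 j) //= leq_addr.
lia.
Qed.

End Completeness.

Section AffineDimension.
Variables (R : realType) (n : nat).
Implicit Types (F : set 'rV[R]_n) (x y u : 'rV[R]_n) (e m : 'rV[int]_n) (s : seq 'rV[int]_n).

Lemma affdim_uniq F d d' : affdim F d -> affdim F d' -> d = d'.
Proof.
have le d1 d2 : affdim F d1 -> affdim F d2 -> (d1 <= d2)%N.
  move=> [x [A [/eqP rA Fx FA _]]] [x' [A' [/eqP rA' _ _ hA']]].
  rewrite -rA -rA'; apply: mxrankS; apply/row_subP => i0.
  rewrite (_ : row i0 A = (x + row i0 A - x') - (x - x')).
    by rewrite addmx_sub ?eqmx_opp //; exact: hA'.
  by apply/rowP => j; rewrite !mxE; ring.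
by move=> h h'; apply/eqP; rewrite eqn_leq !le.
Qed.

Lemma aff_dot F x e (c : R) : (forall y, F y -> dot y (toR R e) = c) -> aff F x -> dot x (toR R e) = c.
Proof.
move=> hF [m [a [y [a1 Fy ->]]]]; rewrite dot_suml -[RHS]mul1r -a1 mulr_suml.
by apply: eq_bigr => i0 _; rewrite dotZl hF.
Qed.

Lemma dot_near x e (c : R) : c < dot x (toR R e) -> \forall y \near x, c < dot y (toR R e).
Proof.
move=> lt; pose M := \sum_j `|(e 0 j)%:~R : R|; have M0 : 0 <= M by apply: sumr_ge0.
pose d := (dot x (toR R e) - c) / (M + 1).
have d0 : 0 < d by rewrite divr_gt0 ?subr_gt0 // ltr_wpDl.
have dM : d * (M + 1) = dot x (toR R e) - c by rewrite divfK // gt_eqF // ltr_wpDl.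
apply/(nbhs_ballP x); exists d => //= y [_ /(_ 0) hy].
have : dot x (toR R e) - dot y (toR R e) <= d * M.
  rewrite /dot -sumrB mulr_sumr; apply: ler_sum => j _; rewrite -mulrBl mxE.
  apply: le_trans (ler_norm _) _; rewrite normrM; apply: ler_wpM2r => //.
  by have := hy j; rewrite /ball /= => /ltW.
lra.
Qed.

Definition genmx_of s : 'M[R]_(size s, n) := \matrix_(i < size s) toR R (nth 0 s i).

Lemma row_genmx s (i0 : 'I_(size s)) : row i0 (genmx_of s) = toR R (nth 0 s i0).
Proof. by rewrite rowK. Qed.

Lemma sub_genmx s e : e \in s -> (toR R e <= genmx_of s)%MS.
Proof.
move=> es; have i0 : (index e s < size s)%N by rewrite index_mem.
by have := row_sub (Ordinal i0) (genmx_of s); rewrite row_genmx /= nth_index.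
Qed.

Lemma lspan_genmx s x : lspan [set y | exists2 e, e \in s & y = toR R e] x <-> (x <= genmx_of s)%MS.
Proof.
split.
  elim/lspan_ind => [|y z hy hz|c y hy|_ [e es ->]]; rewrite ?sub0mx ?addmx_sub ?scalemx_sub //.
  exact: sub_genmx.
move=> /submxP [y ->]; rewrite mulmx_sum_row; apply: lspan_sum => i0 _.
by rewrite row_genmx; exists (nth 0 s i0) => //; exact: mem_nth.
Qed.

Lemma dot_genmx s x : x *m (genmx_of s)^T = 0 <-> forall e, e \in s -> dot x (toR R e) = 0.
Proof.
have E i0 : (x *m (genmx_of s)^T) 0 i0 = dot x (toR R (nth 0 s i0)).
  by rewrite [LHS]mxE; apply: eq_bigr => j _; rewrite [_^T _ _]mxE [genmx_of s _ _]mxE.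
split=> [h e es|h].
  have i0 : (index e s < size s)%N by rewrite index_mem.
  by have := E (Ordinal i0); rewrite h [LHS]mxE /= nth_index.
by apply/rowP => i0; rewrite E [RHS]mxE; apply: h; exact: mem_nth.
Qed.

(** [row_ebase] is invertible and its first [\rank] rows form a basis of the row space, which brings
    the span of the generators to the form used in [extpow_line]. *)
Lemma rows_span_genmx s : rows_span (row_ebase (genmx_of s)) [set j : 'I_n | (j < \rank (genmx_of s))%N]%SET
  = [set x | (x <= genmx_of s)%MS].
Proof.
set G := genmx_of s; apply/seteqP; split=> x /=.
  move=> [y -> hy].
  have -> : y = y *m (pid_mx (\rank G) : 'M[R]_(n, \rank G)) *m pid_mx (\rank G).
    rewrite -mulmxA pid_mx_id ?rank_leq_col //; apply/rowP => j.
    rewrite [RHS]mxE (bigD1 j) //= big1 ?addr0; last first.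
      by move=> i0 ni; rewrite [pid_mx _ _ _]mxE (negPf (_ : val i0 != val j)) ?mulr0.
    rewrite [pid_mx _ _ _]mxE eqxx /=; case: ltnP => h; first by rewrite mulr1.
    by rewrite mulr0 hy // inE -leqNgt.
  by rewrite -mulmxA; apply: submx_trans (submxMl _ _) _; rewrite -[_ *m row_ebase G]/(row_base G) eq_row_base.
rewrite -(eq_row_base G) => /submxP [y ->]; exists (y *m pid_mx (\rank G)); first by rewrite mulmxA.
move=> j; rewrite inE -leqNgt => h; rewrite [LHS]mxE big1 // => i0 _.
rewrite [pid_mx _ _ _]mxE (_ : (val i0 == val j) = false) ?mulr0 //.
by apply/eqP => e; have := ltn_ord i0; rewrite e ltnNge h.
Qed.

End AffineDimension.

(** * Faces of the polytope, described by active generators *)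

Section PolytopeFaces.
Variables (R : realType) (n : nat) (Delta : set (set 'rV[R]_n)).
Variable gens : seq 'rV[int]_n.
Hypothesis gensP : forall e, ray_gens Delta e <-> e \in gens.
Local Notation P := (polytope Delta).
Implicit Types (F : set 'rV[R]_n) (x y u : 'rV[R]_n) (e m : 'rV[int]_n).

Definition active x := [seq e <- gens | dot x (toR R e) == -1].

Lemma activeP x e : e \in active x <-> ray_gens Delta e /\ dot x (toR R e) = -1.
Proof. by rewrite seq.mem_filter gensP; split=> [/andP[/eqP]|[? ->]]; rewrite ?eqxx. Qed.

(** The face with x in its relative interior, and the only one, by [face_of_relint] and
    [relint_face_of]. *)
Definition face_of x : set 'rV[R]_n :=
  [set y | P y /\ forall e, e \in active x -> dot y (toR R e) = -1].

Lemma face_of_self x : P x -> face_of x x.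
Proof. by move=> Px; split=> // e /activeP[]. Qed.

Lemma face_of_face x : P x -> face P (face_of x).
Proof.
move=> Px; split; first by exists x; exact: face_of_self.
(* On the polytope each active generator takes values at least -1, so the sum attains minus their
   number only when all of them equal -1. *)
exists (\sum_(e <- active x) toR R e), (- (size (active x))%:R).
have D y : dot (\sum_(e <- active x) toR R e) y = \sum_(e <- active x) dot y (toR R e).
  by rewrite dot_suml; apply: eq_bigr => e _; rewrite dotC.
have Z : - (size (active x))%:R = \sum_(e <- active x) (-1) :> R.
  by rewrite big_const_seq count_predT iter_addr_0 mulNrn.
split=> [y Py|].
  by rewrite D Z !big_seq; apply: ler_sum => e /activeP[/Py].
apply/seteqP; split=> y /= [Py hy]; split=> //.
  by rewrite D Z !big_seq; apply: eq_bigr => e /hy.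
move=> e ea; apply/eqP; rewrite -subr_eq0 opprK.
have h0 : \sum_(e <- active x) (dot y (toR R e) + 1) = 0.
  by rewrite big_split /= -D hy Z -big_split /= big1 // => e' _; rewrite addNr.
have := h0; rewrite (big_rem e ea) /= => h1.
have h2 : 0 <= \sum_(e' <- rem e (active x)) (dot y (toR R e') + 1).
  rewrite big_seq; apply: sumr_ge0 => e' /mem_rem /activeP[/Py]; lra.
have := Py e (proj1 (proj1 (activeP _ _) ea)).
move=> h3; apply/eqP; lra.
Qed.

Lemma near_inactive x : P x -> \forall y \near x, forall e, ray_gens Delta e -> e \notin active x -> -1 < dot y (toR R e).
Proof.
move=> Px.
have : \forall y \near x, forall e, e \in gens -> e \notin active x -> -1 < dot y (toR R e).
  have : forall e, e \in gens -> e \notin active x -> \forall y \near x, -1 < dot y (toR R e).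
    move=> e eg na; apply: dot_near; rewrite lt_neqAle (Px e) ?andbT; last exact/gensP.
    by apply: contra na => /eqP ea; apply/activeP; split=> //; exact/gensP.
  elim: (gens) => [|e s IH] h; first by near=> y.
  have h1 : \forall y \near x, e \notin active x -> -1 < dot y (toR R e).
    have [ea|na] := boolP (e \in active x); first by near=> y.
    by have := h e (mem_head _ _) na; apply: filterS => y.
  have h2 := IH (fun e' es => h e' (mem_behead (s := e :: s) es)).
  near=> y => e'; rewrite inE => /orP[/eqP ->|es]; first by near: y.
  by move: e' es; near: y.
by apply: filterS => y h e /gensP; exact: h.
Unshelve. all: by end_near. Qed.

Lemma face_of_relint x : P x -> relint (face_of x) x.
Proof.
move=> Px; split; first exact: face_of_self.
apply: filterS (near_inactive Px) => y hy ay.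
have E e : e \in active x -> dot y (toR R e) = -1.
  by move=> ea; apply: aff_dot ay => z [_]; apply.
split=> // e ge; have [ea|na] := boolP (e \in active x); first by rewrite E.
exact: ltW (hy e ge na).
Qed.

Lemma near_line x y (Q : 'rV[R]_n -> Prop) : (\forall z \near x, Q z) ->
  exists2 c : R, 0 < c & Q (x + c *: (x - y)).
Proof.
move=> /(nbhs_ballP x) [d /= d0 hd].
pose M := \sum_j `|x 0 j - y 0 j|; have M0 : 0 <= M by apply: sumr_ge0.
have M1 : 0 < M + 1 by rewrite ltr_wpDl.
have cM : d / (M + 1) * (M + 1) = d by rewrite divfK // gt_eqF.
exists (d / (M + 1)); first exact: divr_gt0.
have c0 : 0 < d / (M + 1) by exact: divr_gt0.
apply: hd; split=> // i0 j; rewrite (ord1 i0) /ball /= !mxE opprD addNKr normrN normrM gtr0_norm //.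
have : `|x 0 j - y 0 j| <= M by rewrite /M (bigD1 j) //= lerDl sumr_ge0.
by move=> h; nra.
Qed.

(** The segment from y to x can be prolonged a little beyond x, inside F or inside the polytope. A
    linear form that is minimal at x is then constant on it; this gives one inclusion with the
    active generators and the other with the form defining F. *)
Lemma relint_face_of F x : face P F -> relint F x -> F = face_of x.
Proof.
move=> [_ [u [c [uP FE]]]] [Fx nF].
have [Px ux] : P x /\ dot u x = c by move: Fx; rewrite FE.
apply/seteqP; split=> y.
  move=> Fy; have Py : P y by move: Fy; rewrite FE => -[].
  split=> // e /activeP[ge ex].
  have [d d0 Fd] := near_line y nF.
  have /Fd : aff F (x + d *: (x - y)).
    exists 2%N, (fun i0 : 'I_2 => if i0 == 0 then 1 + d else - d),
      (fun i0 : 'I_2 => if i0 == 0 then x else y); split.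
    - by rewrite big_ord_recl big_ord1 /=; ring.
    - by move=> i0; case: ifP.
    - by rewrite big_ord_recl big_ord1 /= scalerDl scale1r scaleNr scalerBr addrA.
  rewrite FE => -[/(_ e ge) + _]; rewrite dotDl dotZl dotDl dotNl ex => h.
  have := Py e ge => h'; apply/eqP; rewrite eq_le h' andbT; nra.
move=> [Py hy]; rewrite FE; split=> //; apply/eqP; rewrite eq_le uP // andbT.
have [d d0 hd] := near_line y (near_inactive Px).
have /uP : P (x + d *: (x - y)).
  move=> e ge; have [ea|na] := boolP (e \in active x); last exact: ltW (hd e ge na).
  rewrite dotDl dotZl dotDl dotNl (hy e ea).
  by have /activeP[_ ->] := ea; lra.
by rewrite dotDr dotZr dotDr dotNr ux => h; nra.
Qed.

Definition codim x := \rank (genmx_of R (active x)).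

Lemma codim_le x : (codim x <= n)%N.
Proof. exact: rank_leq_col. Qed.

Lemma affdim_face_of x : P x -> affdim (face_of x) (n - codim x).
Proof.
move=> Px; pose G := genmx_of R (active x).
have -> : (n - codim x)%N = \rank (kermx G^T) by rewrite mxrank_ker mxrank_tr.
have nx : \forall y \near x, forall e, ray_gens Delta e -> e \notin active x -> -1 < dot y (toR R e).
  exact: near_inactive.
have kA i0 e : e \in active x -> dot (row i0 (row_base (kermx G^T))) (toR R e) = 0.
  move: e; apply/dot_genmx; apply: sub_kermxP; rewrite -/G.
  by apply: submx_trans (row_sub _ _) _; rewrite eq_row_base.
(* The directions of the face are the vectors orthogonal to the active generators. Each basis vector
   is scaled so that its translate by x stays in the polytope, as [affdim] requires. *)
have /choice [c hc] : forall i0, exists c : R, 0 < c /\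
    face_of x (x + c *: row i0 (row_base (kermx G^T))).
  move=> i0; have [c c0 hc] := near_line (x - row i0 (row_base (kermx G^T))) nx.
  rewrite subKr in hc.
  exists c; split=> //; split=> [e ge|e ea]; last first.
    by rewrite dotDl dotZl kA // mulr0 addr0; have /activeP[] := ea.
  have [ea|na] := boolP (e \in active x); last exact: ltW (hc e ge na).
  by rewrite dotDl dotZl kA // mulr0 addr0; have /activeP[_ ->] := ea.
exists x, (diag_mx (\row_i0 c i0) *m row_base (kermx G^T)).
have rA i0 : row i0 (diag_mx (\row_i0 c i0) *m row_base (kermx G^T)) = c i0 *: row i0 (row_base (kermx G^T)).
  by apply/rowP => j; rewrite mul_diag_mx !mxE.
have uD : diag_mx (\row_i0 c i0) \in unitmx.
  by rewrite unitmxE det_diag unitfE; apply/prodf_neq0 => i0 _; rewrite mxE gt_eqF //; case: (hc i0).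
split.
- by rewrite /row_free mxrankMfree ?row_base_free // mxrank_unit.
- exact: face_of_self.
- by move=> i0; rewrite rA; case: (hc i0).
move=> y [Py hy]; rewrite (eqmxMfull _ (_ : row_full _)) ?row_full_unit // eq_row_base.
apply/sub_kermxP/dot_genmx => e ea; rewrite dotDl dotNl hy //.
by have /activeP[_ ->] := ea; rewrite subrr.
Qed.

(** The face is forced to be that of I, so k is determined by its dimension; both k and the rank are
    at most n, so that the truncated differences can be compared. *)
Lemma ScodimP (I : 'rV[int]_n) k : Scodim Delta k I <-> P (toR R I) /\ k = codim (toR R I).
Proof.
split=> [[kn [F [fF dF] hI]]|[PI ->]].
  have PI : P (toR R I) by case: fF hI => _ [u [c [_ ->]]] [[]].
  split=> //; move: dF; rewrite (relint_face_of fF hI) => /(affdim_uniq (affdim_face_of PI)).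
  have := codim_le (toR R I); lia.
split; first exact: codim_le.
exists (face_of (toR R I)); last exact: face_of_relint.
by split; [exact: face_of_face|exact: affdim_face_of].
Qed.

End PolytopeFaces.

(** * The spaces V_I and the decomposition *)

Section ExteriorSums.
Variables (K : numFieldType) (n : nat).

Lemma evec_mulmx (y : 'rV[K]_n) (M : 'M[K]_n) : evec (y *m M) = \sum_j y 0 j *: evec (row j M).
Proof.
rewrite mulmx_sum_row; apply: (big_ind2 (fun a b => evec a = b)) => [|a b a' b' <- <-|j _].
- by apply/ffunP => S; rewrite !ffunE big1 // => i0 _; rewrite mxE.
- exact: evecD.
- exact: evecZ.
Qed.

Lemma wedge_ebas_supp (Z T : {set 'I_n}) (u : ext K n) : wedge (ebas K Z) u T != 0 -> Z \subset T.
Proof.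
apply: contraNT => ZT; rewrite ffunE big1 // => A AT; rewrite ffunE.
by case: eqP AT => [->|]; rewrite ?(negPf ZT) // mulr0 mul0r.
Qed.

End ExteriorSums.

Section Sectors.
Variables (R : realType) (n : nat) (Delta : set (set 'rV[R]_n)).
Hypotheses (fan_Delta : is_fan Delta) (smooth_X : is_smooth Delta).
Variable gens : seq 'rV[int]_n.
Hypothesis gensP : forall e, ray_gens Delta e <-> e \in gens.
Local Notation C := R[i].
Local Notation torus := (torus R n).
Local Notation P := (polytope Delta).
Implicit Types (A B : 'M[int]_n) (J T : {set 'I_n}) (I e : 'rV[int]_n) (E U : ext C n) (v : tfield R n).

Lemma dot_toR_eqN1 I e : (dot (toR R I) (toR R e) = -1) <-> ip I e = -1.
Proof.
rewrite dot_toR -[-1 : R]/((-1)%:~R : R); split=> [/intr_inj|->] //.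
Qed.

Lemma dot_toR_geN1 I e : (-1 <= dot (toR R I) (toR R e)) = (-1 <= ip I e).
Proof. by rewrite dot_toR -[-1 : R]/((-1)%:~R : R) ler_int. Qed.

(** In a chart with e as row j the exponent is <I, e> + [j in T] for each T in the support of E.
    When <I, e> = -1, all T must contain j, which is e /\ E = 0 by [wedge_row0]. *)
Lemma extendable_facets I E : E != 0 -> extendable Delta I E <->
  P (toR R I) /\ forall e, ray_gens Delta e -> ip I e = -1 -> wedge (evec (map_mx intr e)) E = 0.
Proof.
have eA A J j : is_chart Delta A J -> wedge (evec (map_mx intr (row j A))) E = 0 <->
    forall T, extmap (Cmx R (invmx A)) E T != 0 -> j \in T.
  move=> cA; have uA := chart_unit cA.
  by rewrite -Cmx_inv // map_row; apply: wedge_row0; exact: Cmx_unit.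
move=> nz; split=> [ex|[PI hE] A J cA j T jJ ET].
  split=> e ge; have /(ray_gensP fan_Delta smooth_X) [A [J [j [cA jJ ee]]]] := ge; subst e.
    rewrite dot_toR_geN1 leNgt; apply/negP => lt; move/eqP: nz; apply.
    have uA := chart_unit cA.
    rewrite -(extmapVK (Cmx_unit R uA) E) Cmx_inv // (_ : extmap (Cmx R (invmx A)) E = 0) ?extmap0 //.
    apply/ffunP => T; rewrite [RHS]ffunE; apply/eqP; apply: contraT => /(ex _ _ cA _ _ jJ).
    by case: (j \in T) => /=; lia.
  move=> ip1; apply/(eA _ _ _ cA) => T /(ex _ _ cA _ _ jJ).
  by rewrite ip1; case: (j \in T).
have ge := ray_gens_in fan_Delta smooth_X cA jJ.
have := PI _ ge; rewrite dot_toR_geN1 le_eqVlt => /orP[/eqP h|].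
  have /(eA _ _ _ cA) /(_ T ET) -> := hE _ ge (esym h).
  by rewrite -h.
by case: (j \in T) => /=; lia.
Qed.

Local Notation actI I := (active gens (toR R I)).

(** A basis of N_R whose first vectors, those with index in [fdirs I], span F_I^perp. *)
Definition fbasis I : 'M[R]_n := row_ebase (genmx_of R (actI I)).
Definition fdirs I : {set 'I_n} := [set j : 'I_n | (j < codim gens (toR R I))%N]%SET.
Definition cbasis I : 'M[C]_n := map_mx (real_complex R) (fbasis I).

Lemma card_fdirs I : #|fdirs I| = codim gens (toR R I).
Proof.
have cn := codim_le gens (toR R I).
by rewrite /fdirs -sum1dep_card (big_ord_narrow cn) /= sum1_card card_ord.
Qed.

Lemma fbasis_unit I : fbasis I \in unitmx.
Proof. exact: row_ebase_unit. Qed.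

Lemma cbasis_unit I : cbasis I \in unitmx.
Proof. by rewrite map_unitmx fbasis_unit. Qed.

Lemma FIperpE I : FIperp Delta I = rows_span (fbasis I) (fdirs I).
Proof.
rewrite rows_span_genmx; apply/seteqP; split=> x /=.
  move=> h; apply/lspan_genmx; move: h; congr (lspan _ x); apply/seteqP; split=> y /=.
    by move=> [e ge [de ->]]; exists e => //; apply/(activeP gensP).
  by move=> [e /(activeP gensP) [ge de] ->]; exists e.
move=> /lspan_genmx h; move: h; congr (lspan _ x); apply/seteqP; split=> y /=.
  by move=> [e /(activeP gensP) [ge de] ->]; exists e.
by move=> [e ge [de ->]]; exists e => //; apply/(activeP gensP).
Qed.

Lemma toC_toR e : map_mx (real_complex R) (toR R e) = map_mx intr e.
Proof. by apply/rowP => j; rewrite !mxE rmorph_int. Qed.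

Lemma facets_basis I E :
  (forall e, ray_gens Delta e -> ip I e = -1 -> wedge (evec (map_mx intr e)) E = 0) <->
  forall j, j \in fdirs I -> wedge (evec (row j (cbasis I))) E = 0.
Proof.
split=> [h j jZ|h e ge /dot_toR_eqN1 de].
  have : FIperp Delta I (row j (fbasis I)).
    rewrite FIperpE; exists (delta_mx 0 j); first by rewrite rowE.
    by move=> k kZ; rewrite mxE eqxx /=; case: eqP => // ek; rewrite ek jZ in kZ.
  rewrite /cbasis -map_row; elim/lspan_ind => [|x y hx hy|c x hx|_ [e ge [/dot_toR_eqN1 de ->]]].
  - by rewrite map_mx0 (_ : evec 0 = 0) ?wedge0l //; apply/ffunP => S; rewrite !ffunE big1 // => i0 _; rewrite mxE.
  - by rewrite map_mxD evecD wedgeDl hx hy addr0.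
  - by rewrite map_mxZ evecZ wedgeZl hx scaler0.
  - by rewrite toC_toR; exact: h.
have : FIperp Delta I (toR R e) by apply: sub_lspan; exists e.
rewrite FIperpE => -[y ey y0]; rewrite -toC_toR ey map_mxM evec_mulmx wedge_suml big1 // => j _.
rewrite wedgeZl; have [jZ|jZ] := boolP (j \in fdirs I); first by rewrite h // scaler0.
by rewrite mxE y0 // rmorph0 scale0r.
Qed.

(** The coefficients of E, in the basis [cbasis I], when it is divisible by the generator of the top
    power of F_I^perp and has degree k. Being a condition on the support, it exhibits a basis of the
    space. *)
Definition sector I (k : nat) U := forall T, U T != 0 -> fdirs I \subset T /\ #|T| = k.

Lemma extendable_sector I k E : E != 0 -> homog k E ->
  extendable Delta I E <-> P (toR R I) /\ sector I k (extmap (invmx (cbasis I)) E).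
Proof.
move=> nz hE; rewrite (extendable_facets I nz) facets_basis.
split=> -[PI h]; split=> //.
  move=> T ET; split; last exact: homog_extmap hE _ ET.
  apply/fintype.subsetP => j jZ.
  by have /(wedge_row0 _ _ (cbasis_unit I)) := h j jZ; apply.
move=> j jZ; apply/(wedge_row0 _ _ (cbasis_unit I)) => T ET.
by have [/fintype.subsetP + _] := h T ET; apply.
Qed.

Lemma sector_homog I k U : sector I k U -> homog k U.
Proof. by move=> h T /h[]. Qed.

Lemma sector0 I k : sector I k 0.
Proof. by move=> T; rewrite ffunE eqxx. Qed.

Lemma sector_le I k U : U != 0 -> sector I k U -> (codim gens (toR R I) <= k)%N.
Proof.
move=> nz h; have [T UT] : exists T, U T != 0.
  apply: contrapT => hn; move/eqP: nz; apply; apply/ffunP => T; rewrite [RHS]ffunE.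
  by apply/eqP; apply: contraT => UT; exfalso; apply: hn; exists T.
by have [/subset_leq_card + <-] := h T UT; rewrite card_fdirs.
Qed.

Lemma sector_extendable I k U : P (toR R I) -> sector I k U -> extendable Delta I (extmap (cbasis I) U).
Proof.
move=> PI h; have [->|nz] := eqVneq U 0.
  by rewrite extmap0 => A J _ j T _; rewrite extmap0 ffunE eqxx.
have nz' : extmap (cbasis I) U != 0.
  by apply: contra nz => /eqP e; rewrite -(extmapK (cbasis_unit I) U) e extmap0.
have hU := @homog_extmap _ _ k (cbasis I) _ (sector_homog h).
apply: (proj2 (extendable_sector I nz' hU)).
by rewrite (extmapK (cbasis_unit I) U).
Qed.

Lemma sectorP I k U : (codim gens (toR R I) <= k)%N -> sector I k U <->
  exists2 E, homog (k - codim gens (toR R I)) E & U = wedge (ebas C (fdirs I)) E.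
Proof.
move=> le; split=> [h|[E hE ->] T UT].
  have [E [UE hE]] := ebas_factor (fun T UT => proj1 (h T UT)).
  by exists E => //; rewrite -card_fdirs; apply: hE; exact: sector_homog h.
split; first exact: wedge_ebas_supp UT.
have := homog_wedge (@homog_ebas C n (fdirs I)) hE UT; rewrite card_fdirs; lia.
Qed.

(** The set in the definition of [calE] is nonempty, so the default value 0 is not taken; any choice
    is a nonzero multiple of the standard generator by [extpow_line]. *)
Lemma calEP I : exists2 c : R, c != 0 &
  calE Delta I (codim gens (toR R I)) = c *: extmap (fbasis I) (ebas R (fdirs I)).
Proof.
rewrite /calE; case: xgetP => [E _ [hE nz]|/(_ (extmap (fbasis I) (ebas R (fdirs I))))].
  move: hE; rewrite FIperpE -card_fdirs => /extpow_line [c ec].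
  by exists c => //; apply: contra nz => /eqP c0; rewrite ec c0 scale0r.
case; split.
  by rewrite FIperpE -{1}card_fdirs; apply/extpow_line; exists 1; rewrite scale1r.
apply/negP => /eqP e; have := ebas_neq0 R (fdirs I).
by rewrite -(extmapK (fbasis_unit I) (ebas R _)) e extmap0 eqxx.
Qed.

Lemma WIP I k (w : tfield R n) : (codim gens (toR R I) <= k)%N ->
  WI Delta k I (codim gens (toR R I)) w <->
  exists2 U, sector I k U & w = rho (extmap (cbasis I) U).
Proof.
move=> le; rewrite /WI le; case: eqP => [c0|_].
  (* The separate branch i = 0 of [WI] agrees with the general description: [fdirs I] is empty and
     only the degree condition remains. *)
  have Z0 : fdirs I = finset.set0 by apply/eqP; rewrite -cards_eq0 card_fdirs c0.
  split=> [[E /extpowT hE <-]|[U hU ->]].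
    exists (extmap (invmx (cbasis I)) E); last by rewrite extmapVK // cbasis_unit.
    by move=> T ET; rewrite Z0 finset.sub0set; split=> //; exact: homog_extmap hE _ ET.
  by exists (extmap (cbasis I) U) => //; apply/extpowT/homog_extmap; exact: sector_homog hU.
have [c nz ec] := calEP I.
(* The scalar a and the arbitrary factor c of the chosen generator are both absorbed into E. *)
have eV E (a : C) t : a *: twedge (calV Delta I (codim gens (toR R I))) (rho (extmap (cbasis I) E)) t =
    rho (extmap (cbasis I) (wedge (ebas C (fdirs I)) ((a * (c%:C)%C) *: E))) t.
  rewrite /calV ec ext_complex_extmap_ebas twedge_rho wedgeZr extmapZ extmap_wedge.
  by rewrite wedgeZl !rhoZ scalerA.
split=> [[a [_ [E /extpowT hE <-] ->]]|[U /(sectorP _ le) [E hE ->] ->]].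
  exists (wedge (ebas C (fdirs I)) ((a * (c%:C)%C) *: extmap (invmx (cbasis I)) E)).
    by apply/(sectorP _ le); eexists; last reflexivity; apply: homogZ; apply: homog_extmap.
  by apply/funext => t; rewrite -eV (extmapVK (cbasis_unit I) E).
have cC : (c%:C)%C != 0 :> C by rewrite -cabs_gt0 cabs_real normr_gt0.
exists ((c%:C)%C)^-1, (rho (extmap (cbasis I) E)).
  by exists (extmap (cbasis I) E) => //; apply/extpowT/homog_extmap.
by apply/funext => t; rewrite [RHS](eV E _ t) (mulVf cC) scale1r.
Qed.

Lemma VIP I k v : P (toR R I) -> (codim gens (toR R I) <= k)%N -> VI Delta k I v <->
  exists2 U, sector I k U & v = fun t => character I t *: rho (extmap (cbasis I) U) t.
Proof.
move=> PI le; split=> [[i0 /(ScodimP gensP) [_ ->]] [w /(WIP _ le) [U hU ->] ->]|[U hU ->]].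
  by exists U.
exists (codim gens (toR R I)); first by apply/(ScodimP gensP).
by exists (rho (extmap (cbasis I) U)) => //; apply/(WIP _ le); exists U.
Qed.

Lemma SleP I k : Sle Delta k I <-> P (toR R I) /\ (codim gens (toR R I) <= k)%N.
Proof.
split=> [[i0 le /(ScodimP gensP) [PI <-]]|[PI le]] //.
by exists (codim gens (toR R I)) => //; apply/(ScodimP gensP).
Qed.

Lemma extendable_VI I k E : E != 0 -> homog k E -> extendable Delta I E ->
  Sle Delta k I /\ VI Delta k I (fun t => character I t *: rho E t).
Proof.
move=> nz hE /(extendable_sector _ nz hE) [PI hs].
have nz' : extmap (invmx (cbasis I)) E != 0.
  by apply: contra nz => /eqP e; rewrite -(extmapVK (cbasis_unit I) E) e extmap0.
have le := sector_le nz' hs; split; first exact/SleP.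
apply/(VIP _ PI le); exists (extmap (invmx (cbasis I)) E); first exact: hs.
by rewrite (extmapVK (cbasis_unit I) E).
Qed.

End Sectors.

Section DimensionCount.
Variables (K : numDomainType) (V : lmodType K).

(** Passes from a basis indexed by a duplicate-free list to one indexed by ordinals. The empty list
    is treated apart because [nth] needs a default element. *)
Lemma has_dim_seq (J : eqType) (r : seq J) (b : J -> V) (H : set V) : uniq r ->
  (forall v, H v <-> exists c : J -> K, v = \sum_(x <- r) c x *: b x) ->
  (forall c : J -> K, \sum_(x <- r) c x *: b x = 0 -> forall x, x \in r -> c x = 0) ->
  has_dim H (size r).
Proof.
move=> ur hH hb.
have [r0|[x0]] : size r = 0%N \/ exists x0 : J, True.
  by case: (r) => [|x s]; [left|right; exists x].
  have rn : r = [::] by apply/nilP; rewrite /nilp r0.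
  rewrite r0; exists (fun=> 0); split=> [v|c _ []//].
  by rewrite hH; split=> -[c ->]; exists (fun=> 0); rewrite rn big_nil big_ord0.
move=> _; exists (fun i0 => b (nth x0 r i0)).
have E (c : J -> K) : \sum_(x <- r) c x *: b x = \sum_(i0 < size r) c (nth x0 r i0) *: b (nth x0 r i0).
  by rewrite (big_nth x0) big_mkord.
have S (c : 'I_(size r) -> K) : exists c' : J -> K, forall i0 : 'I_(size r), c' (nth x0 r i0) = c i0.
  exists (fun x => if insub (index x r) is Some i0 then c i0 else 0) => i0.
  by rewrite index_uniq // valK.
split=> [v|c hc i0].
  rewrite hH; split=> [[c ->]|[c ->]]; first by exists (fun i0 => c (nth x0 r i0)); rewrite E.
  have [c' hc'] := S c; exists c'; rewrite E; apply: eq_bigr => i0 _; by rewrite hc'.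
have [c' hc'] := S c; rewrite -hc'; apply: hb (mem_nth _ _) => //.
by rewrite E -[RHS]hc; apply: eq_bigr => i1 _; rewrite hc'.
Qed.

End DimensionCount.

Section Decomposition.
Variables (R : realType) (n : nat) (Delta : set (set 'rV[R]_n)).
Hypotheses (fan_Delta : is_fan Delta) (smooth_X : is_smooth Delta).
Hypothesis compact_X : compact [set: toric Delta].
Variable gens : seq 'rV[int]_n.
Hypothesis gensP : forall e, ray_gens Delta e <-> e \in gens.
Local Notation C := R[i].
Local Notation torus := (torus R n).
Local Notation tfield := (tfield R n).
Local Notation cd I := (codim gens (toR R I)).
Local Notation cb I := (cbasis R gens I).
Implicit Types (I : 'rV[int]_n) (E U : ext C n) (v : tfield) (T : {set 'I_n}).

Definition chi I E : tfield := fun t => character I t *: rho E t.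

Lemma chi_sum I (J : Type) (r : seq J) (Q : pred J) (F : J -> ext C n) :
  chi I (\sum_(x <- r | Q x) F x) = \sum_(x <- r | Q x) chi I (F x).
Proof.
apply/funext => t; rewrite fct_sumE /chi -scaler_sumr; congr (_ *: _).
by rewrite /rho extmap_sum.
Qed.

Lemma chiZ I (a : C) E : chi I (a *: E) = a *: chi I E.
Proof. by apply/funext => t; rewrite /chi rhoZ scalerA mulrC -scalerA. Qed.

Lemma chi0 I : chi I 0 = 0.
Proof. by have := chiZ I 0 0; rewrite !scale0r. Qed.

(** Independence of characters: [isotypic_extraction] for the property of vanishing identically,
    evaluated at 1. *)
Lemma chi_eq0 (r : seq 'rV[int]_n) (E : 'rV[int]_n -> ext C n) : uniq r ->
  \sum_(I <- r) chi I (E I) = 0 -> forall I, I \in r -> E I = 0.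
Proof.
move=> ur h I Ir.
have := @isotypic_extraction R n (ext C n) (fun f => forall t, f t = 0) _ _ _ r E ur _ I Ir (tone R n).
rewrite character1 scale1r; apply.
- by move=> f g hf hg t; rewrite hf hg addr0.
- by move=> a f hf t; rewrite hf scaler0.
- by move=> s f hf t; exact: hf.
move=> t; rewrite -rho_sumK (_ : \sum_(m <- r) _ = 0); first exact: extmap0.
by have := congr1 (fun f => f t) h; rewrite fct_sumE.
Qed.

Lemma VI_chi k I v : Sle Delta k I -> VI Delta k I v <->
  exists2 U, sector gens I k U & v = chi I (extmap (cb I) U).
Proof. by move=> /(SleP gensP) [PI le]; exact: VIP. Qed.

Lemma VI_H0 k I v : Sle Delta k I -> VI Delta k I v -> H0 Delta k v.
Proof.
move=> sI /(VI_chi _ sI) [U hU ->]; have [PI _] := proj1 (SleP gensP _ _) sI.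
apply: extendable_H0 => //; first exact: homog_extmap (sector_homog hU).
exact: (sector_extendable fan_Delta smooth_X gensP PI hU).
Qed.

Lemma VI0 k I : Sle Delta k I -> VI Delta k I 0.
Proof. by move=> sI; apply/(VI_chi _ sI); exists 0; [exact: sector0|rewrite extmap0 chi0]. Qed.

Lemma H0_decomposition k v : H0 Delta k v -> exists (r : seq 'rV[int]_n) (E : 'rV[int]_n -> ext C n),
  [/\ uniq r, forall I, I \in r -> Sle Delta k I /\ VI Delta k I (chi I (E I)) &
      v = \sum_(I <- r) chi I (E I)].
Proof.
move=> hv; have [B uB [E hE]] := field_laurent fan_Delta smooth_X compact_X hv.
(* Zero terms are discarded, as their extendability gives no information on I. *)
exists [seq m <- B | E m != 0], E; split; first exact: filter_uniq.
  move=> I; rewrite seq.mem_filter => /andP[nz IB].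
  have [hk ex] := laurent_term_extendable fan_Delta smooth_X hv uB hE IB.
  exact: (extendable_VI fan_Delta smooth_X gensP).
apply/funext => t; rewrite hE big_filter fct_sumE [LHS](bigID (fun I => E I != 0)) /= [X in _ + X]big1 ?addr0 //.
by move=> I /negPn/eqP ->; rewrite /rho extmap0 scaler0.
Qed.

(** A field of weight -I consists of a single term, so the extendability of Laurent terms applies to
    the list reduced to I. *)
Lemma VI_weight k I : Sle Delta k I -> VI Delta k I = weight_space Delta k (- I).
Proof.
move=> sI; apply/seteqP; split=> v.
  move=> hv; apply/weight_spaceP; split; first exact: VI_H0 hv.
  by have [U _ ->] := proj1 (VI_chi _ sI) hv; exists (extmap (cb I) U).
move=> /weight_spaceP [hv [E vE]].
have [E0|nz] := eqVneq E 0.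
  by rewrite vE E0 -/(chi I 0) chi0; exact: VI0.
have [|hk ex] := @laurent_term_extendable _ _ _ fan_Delta smooth_X k v [:: I] (fun=> E) hv isT _ I (mem_head _ _).
  by move=> t; rewrite big_seq1 vE.
by rewrite vE; have [] := extendable_VI fan_Delta smooth_X gensP nz hk ex.
Qed.

Lemma finite_Sle k : finite_set (Sle Delta k).
Proof.
apply: sub_finite_set (finite_polytope_lattice fan_Delta smooth_X compact_X) => I.
by move=> /(SleP gensP) [].
Qed.

Definition Sseq k : seq 'rV[int]_n := fset_set (Sle Delta k).

Lemma mem_Sseq k I : I \in Sseq k <-> Sle Delta k I.
Proof. by rewrite in_fset_set; [split=> [/set_mem|/mem_set]|exact: finite_Sle]. Qed.

Lemma H0_bigsum k (J : eqType) (r : seq J) (F : J -> tfield) :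
  (forall x, x \in r -> H0 Delta k (F x)) -> H0 Delta k (\sum_(x <- r) F x).
Proof.
move=> hF; rewrite big_seq; apply: (big_ind (H0 Delta k)) => //; first exact: H00.
by move=> f g hf hg; exact: H0D.
Qed.

Lemma direct_sum_H0 k : is_direct_sum (H0 Delta k) (Sle Delta k) (VI Delta k).
Proof.
split=> [v|w w' [hw _] [hw' _]].
  split=> [/H0_decomposition [r [E [ur hr ->]]]|[w [hw _] ->]]; last first.
    rewrite fsbig_finite; last exact: finite_Sle.
    by apply: H0_bigsum => I /mem_Sseq sI; exact: VI_H0 (hw I sI).
  exists (fun I => if I \in r then chi I (E I) else 0).
    split=> [I sI|]; first by case: ifP => [/hr []|_] //; exact: VI0.
    by apply: sub_finite_set (finite_Sle k) => I [].
  rewrite (fsbigE _ _ ur) /=.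
  - rewrite big_seq_cond [RHS]big_seq_cond; apply: eq_big => [I|I /andP[-> _] //].
    by have [/hr [sI _]|//] := boolP (I \in r); rewrite mem_set.
  - by move=> I /hr [].
  - by move=> I _ /negPf ->.
rewrite !fsbig_finite; try exact: finite_Sle.
move=> e I sI.
have X f : (forall I, Sle Delta k I -> VI Delta k I (f I)) -> exists E : 'rV[int]_n -> ext C n,
    forall I, Sle Delta k I -> f I = chi I (E I).
  move=> hf; have /choice [E hE] : forall I, exists E, Sle Delta k I -> f I = chi I E.
    move=> J; have [sJ|nJ] := pselect (Sle Delta k J); last by exists 0.
    by have [U _ ->] := proj1 (VI_chi _ sJ) (hf J sJ); exists (extmap (cb J) U).
  by exists E.
have [E hE] := X _ hw; have [E' hE'] := X _ hw'.
have := @chi_eq0 (Sseq k) (fun I => E I - E' I) (fset_uniq _) _ I (proj2 (mem_Sseq _ _) sI).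
rewrite (hE _ sI) (hE' _ sI) => h; congr (chi I _); apply/eqP; rewrite -subr_eq0; apply/eqP; apply: h.
have chiB J : chi J (E J - E' J) = chi J (E J) - chi J (E' J).
  by apply/funext => t; rewrite /chi rhoD -scaleN1r rhoZ scaleN1r scalerBr.
rewrite (eq_bigr _ (fun J _ => chiB J)) sumrB; apply/eqP; rewrite subr_eq0; apply/eqP.
transitivity (\sum_(J <- Sseq k) w J); first by rewrite !big_seq; apply: eq_bigr => J /mem_Sseq sJ; rewrite hE.
by rewrite [LHS]e !big_seq; apply: eq_bigr => J /mem_Sseq sJ; rewrite hE'.
Qed.

(** The index set of a basis of V_I^k; the complements of [fdirs I] in its members give the binomial
    coefficient. *)
Definition flags I k : seq {set 'I_n} :=
  enum [set T : {set 'I_n} | (fdirs R gens I \subset T) && (#|T| == k)]%SET.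

Lemma mem_flags I k T : (T \in flags I k) = (fdirs R gens I \subset T) && (#|T| == k).
Proof. by rewrite mem_enum inE. Qed.

Lemma flags_sector I k (c : {set 'I_n} -> C) :
  sector gens I k (\sum_(T <- flags I k) c T *: ebas C T).
Proof.
move=> T; apply: contraNP => /not_andP h; rewrite ext_sumE big_seq big1 // => T'.
rewrite mem_flags => /andP[h1 /eqP h2]; rewrite !ffunE; case: eqP => [e|_]; last exact: mulr0.
by exfalso; case: h; rewrite e.
Qed.

Lemma sector_flags I k U : sector gens I k U -> U = \sum_(T <- flags I k) (U T : C) *: ebas C T.
Proof.
move=> h; rewrite big_enum {1}(ext_ebas U) [LHS](bigID (fun T => T \in [set T : {set 'I_n} | (fdirs R gens I \subset T) && (#|T| == k)]%SET)) /= [X in _ + X]big1 ?addr0 //.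
move=> T; rewrite inE => hT; have [->|/h [h1 /eqP h2]] := eqVneq (U T) 0; first by rewrite scale0r.
by rewrite h1 h2 in hT.
Qed.

Lemma size_flags I k : (cd I <= k)%N -> size (flags I k) = 'C(n - cd I, k - cd I).
Proof. by move=> le; rewrite -cardE -(card_fdirs R gens I); apply: card_supersets; rewrite card_fdirs. Qed.

Lemma has_dim_H0 k : has_dim (H0 Delta k) (\sum_(I <- Sseq k) 'C(n - cd I, k - cd I)).
Proof.
pose r := [seq (m, T) | m <- Sseq k, T <- flags m k].
pose b (x : 'rV[int]_n * {set 'I_n}) : tfield := chi x.1 (extmap (cb x.1) (ebas C x.2)).
have sr : size r = (\sum_(I <- Sseq k) 'C(n - cd I, k - cd I))%N.
  rewrite size_allpairs_dep sumnE big_map !big_seq; apply: eq_bigr => I /mem_Sseq /(SleP gensP) [_ le].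
  exact: size_flags.
have E (c : 'rV[int]_n * {set 'I_n} -> C) : \sum_(x <- r) c x *: b x =
    \sum_(I <- Sseq k) chi I (extmap (cb I) (\sum_(T <- flags I k) c (I, T) *: ebas C T)).
  rewrite big_allpairs_dep; apply: eq_bigr => I _; rewrite extmap_sum chi_sum.
  by apply: eq_bigr => T _; rewrite extmapZ chiZ.
rewrite -sr; apply: (has_dim_seq (b := b)).
- apply: allpairs_uniq_dep => [|I _|]; [exact: fset_uniq|exact: enum_uniq|].
  by move=> [I T] [I' T'] _ _ /= [-> ->].
- move=> v; split=> [/(proj1 (direct_sum_H0 k) v) [w [hw _] ->]|[c ->]]; last first.
    rewrite E; apply: H0_bigsum => I /mem_Sseq sI; apply: (VI_H0 sI); apply/(VI_chi _ sI).
    by exists (\sum_(T <- flags I k) c (I, T) *: ebas C T) => //; exact: flags_sector.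
  rewrite fsbig_finite; last exact: finite_Sle.
  have /choice [U hU] : forall I, exists U, Sle Delta k I ->
      sector gens I k U /\ w I = chi I (extmap (cb I) U).
    move=> J; have [sJ|nJ] := pselect (Sle Delta k J); last by exists 0.
    by have [U hU ->] := proj1 (VI_chi _ sJ) (hw J sJ); exists U.
  exists (fun x => U x.1 x.2); rewrite E !big_seq; apply: eq_bigr => I /mem_Sseq sI.
  by have [hs ->] := hU I sI; exact: (congr1 (fun u => chi I (extmap (cb I) u)) (sector_flags hs)).
move=> c; rewrite E => h [I T] /allpairsPdep [I' [T' [IS TF [-> ->]]]].
have := chi_eq0 (fset_uniq _) h IS => /= h0.
have h1 : \sum_(T <- flags I' k) c (I', T) *: ebas C T = 0.
  by rewrite -(extmapK (cbasis_unit R gens I') (\sum_(T <- flags I' k) c (I', T) *: ebas C T)) h0 extmap0.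
have := congr1 (fun u : ext C n => u T') h1; rewrite ext_sumE (bigD1_seq T') ?enum_uniq //= big1 => [|T1 nT].
  by rewrite !ffunE eqxx addr0 [_ *: _]mulr1.
by rewrite !ffunE eq_sym (negPf nT); exact: mulr0.
Qed.

Lemma card_pts_seq (F : set 'rV[R]_n) (r : seq 'rV[int]_n) : uniq r ->
  (forall I, lattice_pts F I <-> I \in r) -> card_pts F = size r.
Proof.
move=> ur h; rewrite /card_pts.
have hf : finite_set (lattice_pts F).
  by apply/finite_seqP; exists r; apply/seteqP; split=> I /h.
apply: perm_size; apply: uniq_perm => // I; rewrite in_fset_set //.
by apply/idP/idP => [/set_mem/h|/h/mem_set].
Qed.

(** The lattice points of codimension i0 are partitioned according to the face of each. *)
Lemma face_count k i0 : (i0 <= k)%N -> (k <= n)%N ->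
  (\sum_(F \in faces Delta (n - i0)) ('C(n - i0, k - i0) * card_pts (relint F)))%N =
  ('C(n - i0, k - i0) * count (fun I => cd I == i0) (Sseq k))%N.
Proof.
move=> ik kn; pose s := [seq m <- Sseq k | cd m == i0].
pose fo I := face_of Delta gens (toR R I).
(* Only the faces with a lattice point in their relative interior are listed; the others contribute
   0, so the finitely supported sum reduces to L. *)
pose L := undup [seq fo m | m <- s].
have sP I : I \in s <-> polytope Delta (toR R I) /\ cd I = i0.
  rewrite seq.mem_filter; split=> [/andP[/eqP ci /mem_Sseq /(SleP gensP) []]|[PI ci]] //.
  by rewrite ci eqxx; apply/mem_Sseq/(SleP gensP); rewrite ci.
have us : uniq s by apply: filter_uniq; exact: fset_uniq.
have cF F : faces Delta (n - i0) F -> card_pts (relint F) = count (fun I => fo I == F) s.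
  move=> [fF dF]; rewrite -size_filter; apply: card_pts_seq; first exact: filter_uniq.
  move=> I; rewrite seq.mem_filter; split=> [hI|/andP[/eqP <- /sP [PI _]]]; last exact: face_of_relint.
  rewrite /fo -(relint_face_of gensP fF hI) eqxx /=; apply/sP.
  have /(ScodimP gensP) [PI ->] : Scodim Delta i0 I; last by [].
  by split; [exact: leq_trans ik kn|exists F].
have fL F : F \in L -> faces Delta (n - i0) F.
  rewrite mem_undup => /mapP [I /sP [PI <-] ->].
  by split; [exact: face_of_face|exact: affdim_face_of].
rewrite (@fsbigE _ _ _ _ _ L) ?undup_uniq //=; last first.
  move=> F fF nL; rewrite cF // (_ : count _ _ = 0%N) ?muln0 //; apply/eqP.
  rewrite eqn0Ngt -has_count; apply: contra nL => /hasP [I Is /eqP <-].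
  by rewrite mem_undup; apply: map_f.
transitivity (\sum_(F <- L) 'C(n - i0, k - i0) * count_mem F [seq fo m | m <- s])%N.
  rewrite [LHS]big_seq_cond [RHS]big_seq; apply: eq_big => [F|F /andP[FL _]].
    by have [/fL fF|//] := boolP (F \in L); rewrite mem_set.
  by rewrite cF ?count_map //; exact: fL.
rewrite -big_distrr /=; congr (_ * _)%N; rewrite -size_filter -/s -(size_map fo).
rewrite -(perm_size (perm_count_undup [seq fo m | m <- s])) size_flatten /shape -map_comp sumnE big_map.
by apply: eq_bigr => F _ /=; rewrite size_nseq.
Qed.

(** After exchanging the sums, a point I of [Sle Delta k] contributes for the single index i0 =
    [cd I], which is at most k. *)
Lemma dim_count k : (k <= n)%N ->
  (\sum_(i0 < k.+1) \sum_(F \in faces Delta (n - i0)) ('C(n - i0, k - i0) * card_pts (relint F)))%N =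
  (\sum_(I <- Sseq k) 'C(n - cd I, k - cd I))%N.
Proof.
move=> kn; transitivity (\sum_(i0 < k.+1) \sum_(I <- Sseq k | cd I == i0) 'C(n - cd I, k - cd I))%N.
  apply: eq_bigr => i0 _; rewrite face_count //; last by rewrite -ltnS.
  rewrite -sum1_count big_distrr /=; apply: eq_bigr => I /eqP ->; exact: muln1.
rewrite (exchange_big_dep xpredT) //= big_seq [RHS]big_seq; apply: eq_bigr => I /mem_Sseq /(SleP gensP) [_ le].
by rewrite (big_pred1 (Ordinal (le : (cd I < k.+1)%N))) // => i0; rewrite -val_eqE eq_sym.
Qed.

End Decomposition.

Theorem mainTheorem1 (R : realType) (n : nat) (Delta : set (set 'rV[R]_n))
    (fan_Delta : is_fan Delta) (smooth_X : is_smooth Delta)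
    (compact_X : compact [set: toric Delta]) :
  (forall k : nat, (k <= n)%N ->
     is_direct_sum (H0 Delta k) (Sle Delta k) (VI Delta k) /\
     (forall I, Sle Delta k I -> VI Delta k I = weight_space Delta k (- I))) /\
  (forall k : nat, (k <= n)%N ->
     has_dim (H0 Delta k)
       (\sum_(i < k.+1) \sum_(F \in faces Delta (n - i))
          ('C(n - i, k - i) * card_pts (relint F)))%N).
Proof.
have [gens gensE] := proj1 (finite_seqP _) (ray_gens_finite fan_Delta).
have gensP e : ray_gens Delta e <-> e \in gens by rewrite gensE.
split=> k kn; last by rewrite (dim_count fan_Delta smooth_X compact_X gensP kn); exact: has_dim_H0.
split; first exact: (direct_sum_H0 fan_Delta smooth_X compact_X gensP).
by move=> I; exact: (VI_weight fan_Delta smooth_X gensP).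
Qed.
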